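(* Let $D<0$ be the discriminant of the imaginary quadratic field $K=\mathbb{Q}(\sqrt{D})$, and assume $D\equiv 3\pmod 9$. Assume that $3$ does not divide the class number of the real quadratic field $\mathbb{Q}(\sqrt{-D/3})$. Then the $3$-Hilbert class field of $K$ is contained in the anticyclotomic $\mathbb{Z}_3$-extension of $K$.
   Context: The $3$-Hilbert class field of $K$ is the maximal unramified abelian extension of $K$ whose Galois group over $K$ has $3$-power order (corresponding to the $3$-part of the class group). Fix an algebraic closure $\overline{K}$. The anticyclotomic $\mathbb{Z}_3$-extension of $K$ is the unique $\mathbb{Z}_3$-extension $K_\infty\subset\overline{K}$ of $K$ that is Galois over $\mathbb{Q}$ with $\mathrm{Gal}(K_\infty/\mathbb{Q})\cong\mathbb{Z}_3\rtimes\mathbb{Z}/2\mathbb{Z}$, the generator of $\mathrm{Gal}(K/\mathbb{Q})$ acting on $\mathbb{Z}_3$ by inversion. *)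

(* Defs.v *)
From HB Require Import structures.
From mathcomp Require Import all_boot all_order all_algebra all_field.
From mathcomp Require Import finmap all_classical.
From mathcomp Require Import topology.
Set Implicit Arguments.
Unset Strict Implicit.
Unset Printing Implicit Defensive.
Import Order.TTheory GRing.Theory Num.Theory.
Local Open Scope classical_set_scope.
Local Open Scope card_scope.
Local Open Scope ring_scope.

(* All fields are subfields of algC, which is an algebraic closure of every   *)
(* number field; every extension below is therefore algebraic.                *)

Definition subfield (F : set algC) : Prop :=
  [/\ F 1, forall x y, F x -> F y -> F (x - y)
         & forall x y, F x -> F y -> F (x / y)].

Definition rationals : set algC := [set x | x \in Crat].

(* The least subfield containing [sqrtC a]; it contains [rationals]. *)
Definition Qsqrt (a : algC) : set algC := smallest subfield [set sqrtC a].

(* A function on F is represented by its extension to algC that is the        *)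
(* identity outside F, so that equality of elements of [embeddings] and [Gal] *)
(* is Leibniz equality, and the group law on [Gal] is composition.            *)
Definition embeddings (F : set algC) : set (algC -> algC) :=
  [set s | [/\ s 1 = 1,
               forall x y, F x -> F y -> s (x + y) = s x + s y,
               forall x y, F x -> F y -> s (x * y) = s x * s y
             & forall x, ~ F x -> s x = x]].

Definition Gal (L K : set algC) : set (algC -> algC) :=
  [set s | [/\ embeddings L s, s @` L = L & forall x, K x -> s x = x]].

Definition is_galois (K L : set algC) : Prop :=
  [/\ subfield K, subfield L, K `<=` L
    & forall x, L x -> (forall s, Gal L K s -> s x = x) -> K x].

Definition is_abelian (K L : set algC) : Prop :=
  is_galois K L /\
  forall s t, Gal L K s -> Gal L K t -> s \o t = t \o s.

(** Ideals of rings of integers *)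

Definition int_ring (F : set algC) : set algC := [set x | F x /\ x \in Aint].

Definition is_ideal (F I : set algC) : Prop :=
  [/\ I `<=` int_ring F, I 0, forall x y, I x -> I y -> I (x + y)
    & forall a x, int_ring F a -> I x -> I (a * x)].

Definition nonzero_ideal (F I : set algC) : Prop :=
  is_ideal F I /\ I != [set 0].

Definition prime_ideal (F P : set algC) : Prop :=
  [/\ is_ideal F P, P != int_ring F
    & forall x y, int_ring F x -> int_ring F y -> P (x * y) -> P x \/ P y].

Definition ideal_span (F S : set algC) : set algC := smallest (is_ideal F) S.

Definition ideal_mul (F I J : set algC) : set algC :=
  ideal_span F [set x * y | x in I & y in J].

Definition ideal_pow (F I : set algC) (e : nat) : set algC :=
  iter e (ideal_mul F I) (int_ring F).

Definition same_ideal_class (F I J : set algC) : Prop :=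
  exists a b, [/\ int_ring F a, int_ring F b, a != 0, b != 0
                & [set a * x | x in I] = [set b * y | y in J]].

Definition ideal_class (F I : set algC) : set (set algC) :=
  [set J | nonzero_ideal F J /\ same_ideal_class F I J].

Definition ideal_classes (F : set algC) : set (set (set algC)) :=
  [set ideal_class F I | I in nonzero_ideal F].

(* Meaningful when [ideal_classes F] is finite, as it is for number fields;   *)
(* [fset_set] returns the empty set otherwise.                                *)
Definition class_number (F : set algC) : nat :=
  #|` fset_set (ideal_classes F)|%fset.

(** Discriminant of a number field *)

Definition integral_basis (F : set algC) (n : nat) (b : 'I_n -> algC) : Prop :=
  (forall i, int_ring F (b i)) /\
  forall x, int_ring F x ->
    exists! c : {ffun 'I_n -> int}, x = \sum_(i < n) (c i)%:~R * b i.

Definition is_discriminant (F : set algC) (D : int) : Prop :=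
  exists n (b : 'I_n -> algC) (s : 'I_n -> algC -> algC),
    [/\ integral_basis F b, set_bij [set: 'I_n] (embeddings F) s
      & (\det (\matrix_(i, j) s i (b j))) ^+ 2 = D%:~R].

(** Unramified extensions *)

(* e is the exponent of P in the factorization of the extension to the        *)
(* integers of L of the prime of K below P.                                   *)
Definition ramification_index (K L P : set algC) (e : nat) : Prop :=
  let pL := ideal_span L (P `&` K) in
  pL `<=` ideal_pow L P e /\ ~ pL `<=` ideal_pow L P e.+1.

(* Residue fields are finite, so no separability condition is needed. The     *)
(* second clause is the condition at the infinite places; it is vacuous when  *)
(* K is imaginary quadratic.                                                  *)
Definition unramified (K L : set algC) : Prop :=
  (forall P, prime_ideal L P -> P != [set 0] -> ramification_index K L P 1) /\
  (forall s, embeddings L s -> (forall x, K x -> s x \in Num.real) ->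
     forall x, L x -> s x \in Num.real).

Definition unramified_abelian_p (p : nat) (K L : set algC) : Prop :=
  [/\ is_abelian K L, unramified K L & exists n, Gal L K #= `I_(p ^ n)%N].

Definition hilbert_p_class_field (p : nat) (K H : set algC) : Prop :=
  unramified_abelian_p p K H /\
  forall L, unramified_abelian_p p K L -> L `<=` H.

(** p-adic integers, and the anticyclotomic extension *)

(* The subspace topology induced on [Gal L K] is the Krull topology. *)
Definition Gal_space : topologicalType :=
  prod_topology (fun _ : algC => discrete_topology algC).

(* Z_p as the inverse limit of the Z/p^n, the residue classes modulo p^n      *)
(* being represented by 0, ..., p^n - 1.                                      *)
Definition padic_space : topologicalType := prod_topology (fun _ : nat => nat).

Definition padic_int (p : nat) : set padic_space :=
  [set a | forall n, (a n < p ^ n)%N /\ (a n.+1 %% p ^ n)%N = a n].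

Definition padic_add (p : nat) (a b : padic_space) : padic_space :=
  fun n => ((a n + b n) %% p ^ n)%N.

Definition padic_opp (p : nat) (a : padic_space) : padic_space :=
  fun n => ((p ^ n - a n) %% p ^ n)%N.

(* The semidirect product of Z_p by Z/2 acting by inversion. *)
Definition dihedral (p : nat) : set (padic_space * bool) :=
  padic_int p `*` [set: bool].

Definition dihedral_mul (p : nat) (u v : padic_space * bool) :
    padic_space * bool :=
  (padic_add p u.1 (if u.2 then padic_opp p v.1 else v.1), u.2 (+) v.2).

Definition topgroup_iso (S T : topologicalType) (G : set S) (mulG : S -> S -> S)
    (H : set T) (mulH : T -> T -> T) (f : S -> T) : Prop :=
  [/\ set_bij G H f,
      forall x y, G x -> G y -> f (mulG x y) = mulH (f x) (f y),
      {within G, continuous f}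
    & exists g : T -> S,
        (forall x, G x -> g (f x) = x) /\ {within H, continuous g}].

Definition Gal_mul (s t : Gal_space) : Gal_space := fun x => s (t x).

Definition Zp_extension (p : nat) (K L : set algC) : Prop :=
  is_galois K L /\
  exists f : Gal_space -> padic_space,
    topgroup_iso (Gal L K : set Gal_space) Gal_mul (padic_int p) (@padic_add p) f.

(* The last condition identifies the factor Z_p with Gal(L/K) and hence the   *)
(* factor Z/2 with Gal(K/Q), which thus acts on Gal(L/K) by inversion.        *)
Definition anticyclotomic (p : nat) (K L : set algC) : Prop :=
  [/\ Zp_extension p K L, is_galois rationals L
    & exists f : Gal_space -> padic_space * bool,
        topgroup_iso (Gal L rationals : set Gal_space) Gal_mul
                     (dihedral p) (@dihedral_mul p) f /\
        f @` Gal L K = padic_int p `*` [set false]].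

(* Main.v *)
(* Write D = -3d, so that Q(sqrt d) is the mirror field of K = Q(sqrt(-3d)).
   Let psi be a character of 3-power order of Gal(H/K), c complex conjugation,
   and phi_n the character of order 3^n of the anticyclotomic extension.

   - A cubic character fixed by c has a Kummer generator whose cube lies in
     Q(sqrt -3); in the unramified case that cube is a unit times a cube,
     because Z[omega] is Euclidean, and the unit omega is excluded at 3. So
     psi is inverted by c, like phi_n.
   - A cubic character chi = psi phi_n^i is thus inverted by c, and has a
     Kummer generator R with R^3 in Q(sqrt d). At a prime l that splits in
     Q(sqrt d), writing phi_n as the 3^c-th power of phi_(n+c) with c large
     shows that phi_n has a local Kummer generator of integral l-adic
     valuation, so (R^3) is locally a cube; at the other primes this follows
     from R^3 having a norm that is a cube. As 3 does not divide the class
     number, R^3 is a unit times a cube.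
   - The unit group of Q(sqrt d) modulo cubes has order 3, so chi is a power
     of phi_1. By induction on its order, psi is a power of phi_n for n large,
     and H is contained in the anticyclotomic extension.

   Galois groups are replaced throughout by ring automorphisms of algC. *)
From HB Require Import structures.
From mathcomp Require Import all_boot all_order all_fingroup all_solvable all_algebra all_field.
From mathcomp Require Import all_character.
From mathcomp Require Import finmap all_classical topology.
From mathcomp Require Import ring lra zify.
Require Import Defs.
Set Implicit Arguments.
Unset Strict Implicit.
Unset Printing Implicit Defensive.
Import Order.TTheory GRing.Theory Num.Theory.
Local Open Scope classical_set_scope.
Local Open Scope ring_scope.

(** * Subfields and automorphisms of the algebraic numbers *)

(** The congruence on D enters at the prime 3: it gives d = 2 mod 3, so 3 is inert in Q(sqrt d), and
    it ramifies in Q(sqrt -3). Hence a prime l that splits in either field differs from 3, and wild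
    ramification never meets the local analysis; at the other primes the norm condition alone
    decides, however phi_n ramifies there. At a split l, phi_n is not known to be unramified. Let
    rho be a Kummer generator of phi_(n+c), q = l^2, and s the square of a Frobenius lift. Then s
    fixes K, raises 3-power roots of unity to the power q, and so sends rho to rho^q times an
    element of a field unramified at l. Comparing valuations, 3^(n+c) divides q - 1 times the
    valuation of rho^(3^(n+c)); if 3^(c+1) does not divide q - 1, enough factors 3 remain.
    Valuations are read off at a prime P of the ring of all algebraic integers, whose localisation
    is a valuation ring: z has integral valuation when z / l^k is a unit there for some integer k.
    One P thus serves H, its complex conjugate, cyclotomic fields and Kummer extensions at once. *)

Notation Aut := {rmorphism algC -> algC}.
Notation pQtoC := (map_poly (ratr : rat -> algC)).

Definition acomp (s t : Aut) : Aut := s \o t.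
Definition ainv (s : Aut) : Aut := algC_invaut s.
Definition aid : Aut := idfun.
Definition aconj : Aut := Num.conj.

Lemma acompE (s t : Aut) x : acomp s t x = s (t x). Proof. by []. Qed.
Lemma ainvK (s : Aut) x : s (ainv s x) = x. Proof. exact: algC_invautK. Qed.
Lemma ainvKl (s : Aut) x : ainv s (s x) = x. Proof. exact: algC_autK. Qed.
Lemma aconjE x : aconj x = x^*. Proof. by []. Qed.

Section Subfield.
Variables (F : set algC) (hF : subfield F).

Lemma sf1 : F 1. Proof. by case: hF. Qed.
Lemma sfB x y : F x -> F y -> F (x - y). Proof. by case: hF => _ + _; apply. Qed.
Lemma sf0 : F 0. Proof. by rewrite -(subrr 1); apply: sfB; exact: sf1. Qed.
Lemma sfN x : F x -> F (- x). Proof. by rewrite -sub0r; apply: sfB sf0. Qed.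
Lemma sfD x y : F x -> F y -> F (x + y).
Proof. by move=> Fx Fy; rewrite -[y]opprK; apply/sfB/sfN. Qed.
Lemma sfdiv x y : F x -> F y -> F (x / y). Proof. by case: hF => _ _; apply. Qed.
Lemma sfV x : F x -> F x^-1. Proof. by rewrite -div1r; apply: sfdiv sf1. Qed.
Lemma sfM x y : F x -> F y -> F (x * y).
Proof. by move=> Fx Fy; rewrite -[y]invrK; apply/sfdiv/sfV. Qed.
Lemma sfX x n : F x -> F (x ^+ n).
Proof. by move=> Fx; elim: n => [|n IHn]; rewrite ?expr0 ?exprS; [apply: sf1|apply: sfM]. Qed.
Lemma sfMn x n : F x -> F (x *+ n).
Proof. by move=> Fx; elim: n => [|n IHn]; rewrite ?mulr0n ?mulrS; [apply: sf0|apply: sfD]. Qed.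
Lemma sfnat n : F n%:R. Proof. exact/sfMn/sf1. Qed.
Lemma sfint (m : int) : F m%:~R.
Proof. by case: m => n; rewrite ?NegzE ?rmorphN; [|apply: sfN]; apply: sfnat. Qed.
Lemma sfrat (q : rat) : F (ratr q).
Proof. by apply: sfdiv; apply: sfint. Qed.
Lemma sfCrat q : q \in Crat -> F q.
Proof. by case/CratP=> a ->; apply: sfrat. Qed.
Lemma sfsum (I : Type) (r : seq I) (P : pred I) (G : I -> algC) :
  (forall i, P i -> F (G i)) -> F (\sum_(i <- r | P i) G i).
Proof. by move=> FG; elim/big_rec: _ => [|i x /FG]; [apply: sf0|apply: sfD]. Qed.
Lemma sfhorner (p : {poly algC}) x : (forall i, F p`_i) -> F x -> F p.[x].
Proof.
by move=> Fp Fx; rewrite horner_coef; apply: sfsum => i _; apply: sfM => //; apply: sfX.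
Qed.
Lemma sfexpz x (n : int) : F x -> F (x ^ n).
Proof. by move=> Fx; case: n => n; rewrite /exprz; [|apply: sfV]; apply: sfX. Qed.
End Subfield.

Lemma subfield_smallest S : subfield (smallest subfield S).
Proof.
split=> [|x y Sx Sy|x y Sx Sy] A [hA SA]; first exact: sf1.
  by apply: sfB; [|apply: Sx|apply: Sy].
by apply: sfdiv; [|apply: Sx|apply: Sy].
Qed.

Lemma sub_smallest_in S x : S x -> smallest subfield S x.
Proof. by move=> Sx A [_ SA]; apply: SA. Qed.

(** Finite Galois theory takes place in splitting fields over [rat]; the product of the minimal
    polynomials supplies one that contains the whole list. *)
Lemma splitting_num_field (s : seq algC) :
  exists (Qn : splittingFieldType rat) (QnC : {rmorphism Qn -> algC}),
    forall x, x \in s -> exists y, QnC y = x.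
Proof.
have [P monP rP] : exists2 P : {poly rat}, P \is monic & forall x, x \in s -> root (pQtoC P) x.
  elim: s => [|a s [P monP rP]]; first by exists 1; rewrite ?monic1.
  have [q [Dq monq] _] := minCpolyP a.
  exists (q * P); first by rewrite monicMl.
  have rq : root (pQtoC q) a by rewrite -Dq root_minCpoly.
  by move=> x; rewrite inE rmorphM rootM => /orP[/eqP->|/rP->]; rewrite ?orbT ?rq.
have [r Dr] := closed_field_poly_normal (pQtoC P).
rewrite lead_coef_map (monicP monP) rmorph1 scale1r in Dr.
have [Qs [QsC [s1 Ds1 gens1]]] := num_field_exists r.
have Qs_ax : FieldExt_isSplittingField _ Qs.
  constructor; exists (map_poly (in_alg Qs) P).
    apply/polyOverP => i; rewrite coef_map /=.
    exact: memvZ (mem1v _).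
  exists s1 => //; suff -> : map_poly (in_alg Qs) P = \prod_(z <- s1) ('X - z%:P) by apply: eqpxx.
  apply: (map_inj_poly (fmorph_inj QsC) (rmorph0 QsC)).
  rewrite -map_poly_comp (eq_map_poly (g := ratr)); last first.
    by move=> a; rewrite /= rmorphZ_num rmorph1 mulr1.
  rewrite Dr -Ds1 big_map rmorph_prod /=; apply: eq_bigr => z _.
  by rewrite rmorphB /= map_polyX map_polyC.
exists (HB.pack_for (splittingFieldType rat) Qs Qs_ax), QsC => x /rP.
by rewrite Dr root_prod_XsubC -Ds1 => /mapP[y _ ->]; exists y.
Qed.

Lemma poly_num_field (Qn : fieldExtType rat) (QnC : {rmorphism Qn -> algC}) z x :
  x \in <<1; z>>%VS -> exists p : {poly rat}, QnC x = (pQtoC p).[QnC z].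
Proof.
case/Fadjoin_polyP => p /polyOver1P[q ->] ->; exists q.
rewrite -horner_map -map_poly_comp; congr (_.[_]); apply: eq_map_poly => a /=.
by rewrite rmorphZ_num rmorph1 mulr1.
Qed.

(** An automorphism of the number field fixing [z] extends to algC, so [x] lies in the fixed field
    of the Galois group over Q(z), which is Q(z). *)
Lemma galois_fixed_poly z x :
  (forall t : Aut, t z = z -> t x = x) -> exists p : {poly rat}, x = (pQtoC p).[z].
Proof.
move=> fixx; have [Qn [QnC imQ]] := splitting_num_field [:: z; x].
have [z1 Dz] := imQ z (mem_head _ _); have [|x1 Dx] := imQ x; first by rewrite !inE eqxx orbT.
have gal1 : galois <<1; z1>> {:Qn}.
  rewrite /galois subvf normalFieldf ?andbT /=; apply/separableP => y _; apply: pcharf0_separable => p.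
  by rewrite -(fmorph_pchar QnC) Cpchar.
suff /(poly_num_field QnC)[p] : x1 \in <<1; z1>>%VS by rewrite Dx Dz; exists p.
rewrite -(galois_fixedField gal1); apply/fixedFieldP; rewrite ?memvf // => g galg.
have [nu Dnu] := extend_algC_subfield_aut QnC g.
apply: (fmorph_inj QnC); rewrite Dnu Dx; apply: fixx.
rewrite -Dz -Dnu; congr (QnC _); apply: (fixed_gal (subvf _) galg).
exact: memv_adjoin.
Qed.

(** A normal number field containing both has an automorphism carrying [y] to its conjugate, and
    this extends to algC. *)
Lemma conjugate_aut y y' : root (minCpoly y) y' -> exists t : Aut, t y = y'.
Proof.
move=> ry'; have [Qn [QnC imQ]] := splitting_num_field [:: y; y'].
have [y1 Dy] := imQ y (mem_head _ _); have [|y1' Dy'] := imQ y'; first by rewrite !inE eqxx orbT.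
have [|g _ Dg] := normalField_root_minPoly (subvf 1%AS) (normalFieldf 1%AS) (memvf y1) (b := y1').
  have /polyOver1P[q Dq] := minPolyOver 1%AS y1.
  have DqC : map_poly QnC (minPoly 1%AS y1) = pQtoC q.
    rewrite Dq -map_poly_comp; apply: eq_map_poly => a /=.
    by rewrite rmorphZ_num rmorph1 mulr1.
  rewrite -(fmorph_root QnC) DqC Dy'.
  have [p [Dp _] minp] := minCpolyP y.
  have : root (pQtoC q) y by rewrite -DqC -Dy fmorph_root root_minPoly.
  rewrite minp => /dvdpP[r ->]; rewrite rmorphM rootM.
  by move: ry'; rewrite Dp => ->; rewrite orbT.
have [nu Dnu] := extend_algC_subfield_aut QnC g.
by exists nu; rewrite -Dy -Dnu -Dy'; congr (QnC _).
Qed.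

Lemma primitive_element (s : seq algC) : exists z,
  (forall F, subfield F -> (forall x, x \in s -> F x) -> F z) /\
  (forall x, x \in s -> exists p : {poly rat}, x = (pQtoC p).[z]).
Proof.
have [z [a Dz] [ps Ds]] := algC_PET s; exists z; split=> [F hF Fs|x].
  rewrite Dz; apply: sfsum => // i _; apply: sfMn => //; apply: Fs.
  exact: mem_nth.
by rewrite Ds => /mapP[p _ ->]; exists p.
Qed.

Lemma sf_ratpoly F (p : {poly rat}) z : subfield F -> F z -> F (pQtoC p).[z].
Proof. by move=> hF Fz; apply: sfhorner => // i; rewrite coef_map; apply: sfrat. Qed.

Lemma aut_ratpoly (t : Aut) (p : {poly rat}) z : t (pQtoC p).[z] = (pQtoC p).[t z].
Proof.
by rewrite -horner_map -map_poly_comp; congr (_.[_]); apply: eq_map_poly => a; rewrite /= fmorph_rat.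
Qed.

(** The Galois correspondence in the form used throughout: membership in F is tested on the
    automorphisms that fix finitely many elements of F. *)
Lemma galois_fixed F (s : seq algC) x :
  subfield F -> (forall a, a \in s -> F a) ->
  (forall t : Aut, (forall a, a \in s -> t a = a) -> t x = x) -> F x.
Proof.
move=> hF Fs fixx; have [z [Fz ps]] := primitive_element s.
have [t tz|p ->] := @galois_fixed_poly z x; last by apply: sf_ratpoly (Fz _ _ _).
by apply: fixx => a /ps[p ->]; rewrite aut_ratpoly tz.
Qed.

(** * Embeddings and Galois groups of subfields *)

Section Embedding.
Variables (L : set algC) (g : algC -> algC) (hL : subfield L) (hg : embeddings L g).

Lemma emb1 : g 1 = 1. Proof. by case: hg. Qed.
Lemma embD x y : L x -> L y -> g (x + y) = g x + g y. Proof. by case: hg => _ + _ _; apply. Qed.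
Lemma embM x y : L x -> L y -> g (x * y) = g x * g y. Proof. by case: hg => _ _ + _; apply. Qed.
Lemma emb0 : g 0 = 0.
Proof. by apply: (addrI (g 0)); rewrite -embD ?addr0 //; apply: sf0. Qed.
Lemma embN x : L x -> g (- x) = - g x.
Proof.
by move=> Lx; apply: (addrI (g x)); rewrite -embD ?subrr ?emb0 //; apply: sfN.
Qed.
Lemma embB x y : L x -> L y -> g (x - y) = g x - g y.
Proof. by move=> Lx Ly; rewrite embD ?embN //; apply: sfN. Qed.
Lemma emb_eq0 x : L x -> g x = 0 -> x = 0.
Proof.
move=> Lx gx0; apply/eqP; apply: contraTT (oner_neq0 algC) => nzx.
by rewrite -emb1 -(divff nzx) embM ?gx0 ?mul0r ?eqxx //; apply: sfV.
Qed.
Lemma emb_inj x y : L x -> L y -> g x = g y -> x = y.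
Proof.
move=> Lx Ly gxy; apply/eqP; rewrite -subr_eq0; apply/eqP/emb_eq0; first exact: sfB.
by rewrite embB ?gxy ?subrr.
Qed.
Lemma embX x n : L x -> g (x ^+ n) = g x ^+ n.
Proof. by move=> Lx; elim: n => [|n IHn]; rewrite ?emb1 // !exprS embM ?IHn //; apply: sfX. Qed.
Lemma embMn x n : L x -> g (x *+ n) = g x *+ n.
Proof.
by move=> Lx; elim: n => [|n IHn]; rewrite ?mulr0n ?emb0 // !mulrS embD ?IHn //; apply: sfMn.
Qed.
Lemma emb_int (m : int) : g m%:~R = m%:~R.
Proof.
have en n : g n%:R = n%:R by rewrite embMn ?emb1 //; apply: sf1.
by case: m => n; rewrite ?NegzE ?rmorphN /= ?embN ?en //; apply: (sfnat hL n.+1).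
Qed.
Lemma embV x : L x -> g x^-1 = (g x)^-1.
Proof.
move=> Lx; have [->|nzx] := eqVneq x 0; first by rewrite invr0 emb0 invr0.
have nzgx : g x != 0 by apply: contra_neq nzx; apply: emb_eq0.
by apply: (mulfI nzgx); rewrite -embM ?divff ?emb1 //; apply: sfV.
Qed.
Lemma emb_rat q : g (ratr q) = ratr q.
Proof.
have Li m := sfint hL m.
by rewrite /ratr embM ?embV ?emb_int //; apply: sfV.
Qed.
Lemma emb_sum (I : Type) (r : seq I) (G : I -> algC) :
  (forall i, L (G i)) -> g (\sum_(i <- r) G i) = \sum_(i <- r) g (G i).
Proof.
move=> LG; elim: r => [|i r IHr]; first by rewrite !big_nil emb0.
by rewrite !big_cons embD ?IHr //; apply: sfsum.
Qed.
Lemma emb_ratpoly (p : {poly rat}) x : L x -> g (pQtoC p).[x] = (pQtoC p).[g x].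
Proof.
move=> Lx; rewrite !horner_coef emb_sum => [|i].
  by apply: eq_bigr => i _; rewrite embM ?embX ?coef_map ?emb_rat //; [exact: sfrat|exact: sfX].
by rewrite coef_map; apply: sfM => //; [apply: sfrat|apply: sfX].
Qed.
Lemma emb_root_minCpoly x : L x -> root (minCpoly x) (g x).
Proof.
move=> Lx; have [p [Dp _] _] := minCpolyP x; have /eqP := root_minCpoly x.
by rewrite Dp => rx; apply/eqP; rewrite -emb_ratpoly ?rx ?emb0.
Qed.
(** [g] is a homomorphism on L only, so its effect on a polynomial with roots in L is traced
    coefficient by coefficient. *)
Lemma emb_coef_prod zs : (forall z, z \in zs -> L z) -> forall i,
  L (\prod_(z <- zs) ('X - z%:P))`_i /\
  g (\prod_(z <- zs) ('X - z%:P))`_i = (\prod_(z <- map g zs) ('X - z%:P))`_i.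
Proof.
elim: zs => [_ i|z zs IHzs Lzs i].
  by rewrite /= !big_nil coef1; split; [exact: sfnat|case: (i == 0)%N; rewrite /= ?mulr1n ?mulr0n ?emb1 ?emb0].
have /IHzs{}IHzs : forall u, u \in zs -> L u by move=> u zsu; apply: Lzs; rewrite inE zsu orbT.
have Lz := Lzs _ (mem_head z zs).
have [L1 g1] := IHzs i; have [L2 g2] := IHzs i.-1.
have L0 := sf0 hL; rewrite /= !big_cons !mulrBl !coefB !coefXM !coefCM.
have L3 : L (if (i == 0)%N then 0 else (\prod_(j <- zs) ('X - j%:P))`_i.-1) by case: ifP.
split; first by apply: sfB => //; apply: sfM.
have L4 : L (z * (\prod_(j <- zs) ('X - j%:P))`_i) by apply: sfM.
by rewrite embB // embM // g1; case: ifP => //; rewrite ?g2 // emb0.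
Qed.
End Embedding.

Lemma Gal_comp (L F : set algC) (g h : algC -> algC) : Gal L F g -> Gal L F h -> Gal L F (h \o g).
Proof.
move=> [[g1 gD gM gN] gL gF] [[h1 hD hM hN] hL hF].
have Lg x : L x -> L (g x) by move=> Lx; rewrite -gL; exists x.
have Lh x : L x -> L (h x) by move=> Lx; rewrite -hL; exists x.
split; [split => /=|by rewrite -image_comp gL hL|by move=> x Fx /=; rewrite gF ?hF].
- by rewrite g1.
- by move=> x y Lx Ly; rewrite gD ?hD //; apply: Lg.
- by move=> x y Lx Ly; rewrite gM ?hM //; apply: Lg.
- by move=> x nLx; rewrite gN ?hN.
Qed.

Lemma Gal_id (L F : set algC) : Gal L F id.
Proof. by split; [split|rewrite image_id|]. Qed.

(** [is_galois] speaks of the fixed elements of Gal(L/F) only. Normality comes from the finite orbit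
    [O] of x: the polynomial with these roots has coefficients in F, so [s] sends its root x to
    another of its roots. *)
Lemma galois_normal (F L : set algC) (s : Aut) x :
  is_galois F L -> (forall y, F y -> s y = y) -> L x -> L (s x).
Proof.
move=> [hF hL FL fixL] sF Lx.
have [rs Drs] := closed_field_poly_normal (minCpoly x).
rewrite (monicP (minCpoly_monic x)) scale1r in Drs.
pose O := undup [seq z <- rs | `[< exists2 g, Gal L F g & g x = z >]].
have memO z : z \in O <-> exists2 g, Gal L F g & g x = z.
  rewrite mem_undup mem_filter; split=> [/andP[/asboolP]//|ex].
  apply/andP; split; first exact/asboolP.
  case: ex => g [eg _ _] <-; rewrite -root_prod_XsubC -Drs.
  exact: (emb_root_minCpoly hL eg).
have LO z : z \in O -> L z by case/memO => g [_ gL _] <-; rewrite -gL; exists x.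
have permO h : Gal L F h -> perm_eq (map h O) O.
  move=> Gh; have [eh hLL _] := Gh; have hO : {subset map h O <= O}.
    move=> _ /mapP[_ /memO[g Gg <-] ->]; apply/memO; exists (h \o g) => //.
    exact: Gal_comp.
  have uhO : uniq (map h O).
    rewrite map_inj_in_uniq ?undup_uniq // => u v /LO Lu /LO Lv.
    exact: (emb_inj hL eh).
  apply: uniq_perm; rewrite ?undup_uniq //.
  by have [] := uniq_min_size uhO hO _; rewrite ?size_map.
pose p := \prod_(z <- O) ('X - z%:P).
have Fp i : F p`_i.
  apply: fixL => [|h Gh]; first by have [] := emb_coef_prod hL (g := id) _ LO i; first by case: (Gal_id L F).
  have [eh _ _] := Gh; have [_ ->] := emb_coef_prod hL eh LO i.
  by rewrite (perm_big _ (permO _ Gh)).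
have px : root p x by rewrite root_prod_XsubC; apply/memO; exists id; first exact: Gal_id.
have : root p (s x).
  have <- : map_poly s p = p by apply/polyP => i; rewrite coef_map; apply: sF.
  by rewrite fmorph_root.
by rewrite root_prod_XsubC; apply: LO.
Qed.

(** The identity outside L, as the encoding of [Gal] demands. *)
Definition restr (L : set algC) (s : algC -> algC) : algC -> algC :=
  fun x => if `[< L x >] then s x else x.

Lemma restrE (L : set algC) s x : L x -> restr L s x = s x.
Proof. by move=> Lx; rewrite /restr asboolT. Qed.

Lemma restr_out (L : set algC) s x : ~ L x -> restr L s x = x.
Proof. by move=> Lx; rewrite /restr asboolF. Qed.

Lemma galois_normal_inv (F L : set algC) (s : Aut) x :
  is_galois F L -> (forall y, F y -> s y = y) -> L x -> L (ainv s x).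
Proof.
move=> gFL sF; apply: galois_normal gFL _ => y Fy.
by rewrite -{1}(sF y Fy) ainvKl.
Qed.

Lemma restr_Gal (F L : set algC) (s : Aut) :
  is_galois F L -> (forall y, F y -> s y = y) -> Gal L F (restr L s).
Proof.
move=> gFL sF; have [hF hL FL _] := gFL; split; first split.
- by rewrite restrE ?rmorph1 //; apply: sf1.
- by move=> x y Lx Ly; rewrite !restrE ?rmorphD //; apply: sfD.
- by move=> x y Lx Ly; rewrite !restrE ?rmorphM //; apply: sfM.
- exact: restr_out.
- apply/seteqP; split=> [_ [x Lx <-]|x Lx]; first by rewrite restrE //; apply: galois_normal sF Lx.
  have Lsx := galois_normal_inv gFL sF Lx.
  by exists (ainv s x); rewrite ?restrE ?ainvK.
- by move=> x Fx; rewrite restrE ?sF //; apply: FL.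
Qed.

Lemma restr_comp (F L : set algC) (s t : Aut) : is_galois F L -> (forall y, F y -> t y = y) ->
  restr L (acomp s t) = restr L s \o restr L t.
Proof.
move=> gFL tF; apply/funext => x /=; have [Lx|nLx] := pselect (L x).
  by rewrite !(restrE _ Lx) restrE //; apply: galois_normal tF Lx.
by rewrite !restr_out.
Qed.

(** A primitive element handles a finite list, and the continuity of characters never asks for
    more. *)
Lemma Gal_lift (F L : set algC) (g : algC -> algC) (S : seq algC) : is_galois F L -> Gal L F g ->
  (forall x, x \in S -> L x) -> exists t : Aut, forall x, x \in S -> t x = g x.
Proof.
move=> [_ hL _ _] [eg _ _] LS; have [z [Lz ps]] := primitive_element S.
have {}Lz := Lz L hL LS.
have [t Dt] := conjugate_aut (emb_root_minCpoly hL eg Lz).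
by exists t => x /ps[p ->]; rewrite aut_ratpoly Dt (emb_ratpoly hL eg).
Qed.

(** * Localisation at a prime *)

Lemma Aint_integralP x : x \in Aint <-> integralOver (intr : int -> algC) x.
Proof.
split=> [|[p mon_p px]].
  rewrite unfold_in => /floorpP[p Dp]; exists p; last by rewrite -Dp root_minCpoly.
  apply/monicP/(@intr_inj algC).
  by rewrite -lead_coef_map_inj -?Dp ?(monicP (minCpoly_monic x)) //; apply: intr_inj.
apply: (root_monic_Aint px); first exact: monic_map.
by apply/polyOverP => i; rewrite coef_map /= rpred_int.
Qed.

Lemma Aint_root_monic (p : {poly algC}) x : p \is monic -> root p x ->
  (forall i, p`_i \in Aint) -> x \in Aint.
Proof.
move=> mon_p px Ap; apply/Aint_integralP; apply: (integral_root_monic mon_p px).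
by move=> c /(nthP 0)[i _ <-]; apply/Aint_integralP.
Qed.

Lemma Aint_exp x n : (0 < n)%N -> x ^+ n \in Aint -> x \in Aint.
Proof.
move=> n0 Axn; apply: (@Aint_root_monic ('X^n - (x ^+ n)%:P)); rewrite ?monicXnsubC //.
  by rewrite rootE !hornerE subrr.
by move=> i; rewrite coefB coefXn coefC rpredB ?rpred_nat //; case: ifP => // _; rewrite rpred0.
Qed.

(** A primitive integral multiple of the minimal polynomial has a coefficient prime to [l]. *)
Lemma int_poly_annihilator (l : nat) (z : algC) : prime l ->
  exists p : {poly int}, root (map_poly intr p) z /\ exists i, ~~ (l %| p`_i)%Z.
Proof.
move=> pl; have [q [Dq monq] _] := minCpolyP z.
have [p [a nza Dp]] := rat_poly_scale q.
have nzp : p != 0.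
  by apply: contraTneq (monic_neq0 monq) => p0; rewrite Dp p0 map_poly0 scaler0 eqxx.
have := zcontents_primitive p; rewrite nzp => cp.
exists (zprimitive p); split.
  have := root_minCpoly z; rewrite Dq Dp.
  rewrite linearZ /= rootZ ?fmorph_eq0 ?invr_eq0 ?intr_eq0 //.
  rewrite -map_poly_comp [p in map_poly _ p]zpolyEprim.
  rewrite (eq_map_poly (g := intr)) => [|m /=]; last by rewrite ratr_int.
  by rewrite linearZ /= rootZ // intr_eq0 zcontents_eq0.
apply: contrapT => all_dvd.
have : (l %| zcontents (zprimitive p))%Z.
  rewrite dvdz_contents; apply/polyOverP => i; apply: contrapT => /negP ndvd.
  by apply: all_dvd; exists i.
by rewrite cp /= dvdzE /= dvdn1 => /eqP l1; rewrite l1 in pl.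
Qed.

(* [prime_over l P]: P is a prime ideal of the ring of all algebraic integers. *)
Record prime_over (l : nat) (P : set algC) : Prop := PrimeOver {
  po_prime : prime l;
  po_l : P l%:R;
  po_Aint : forall x, P x -> x \in Aint;
  poD : forall x y, P x -> P y -> P (x + y);
  poMl : forall a x, a \in Aint -> P x -> P (a * x);
  po1 : ~ P 1;
  poM : forall x y, x \in Aint -> y \in Aint -> P (x * y) -> P x \/ P y }.

(* The localisation of the algebraic integers at P, and its maximal ideal. *)
Definition inA (P : set algC) : set algC :=
  [set z | exists u, [/\ u \in Aint, ~ P u & u * z \in Aint]].
Definition inM (P : set algC) : set algC :=
  [set z | exists u, [/\ u \in Aint, ~ P u & P (u * z)]].
Definition unitA (P : set algC) (z : algC) : Prop := [/\ z != 0, inA P z & inA P z^-1].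

Section Valuation.
Variables (l : nat) (P : set algC) (hP : prime_over l P).
Let pl := po_prime hP.

Lemma poMr a x : a \in Aint -> P x -> P (x * a).
Proof. by rewrite mulrC; apply: (poMl hP). Qed.
Lemma po0 : P 0. Proof. by rewrite -(mul0r l%:R); apply: (poMl hP); rewrite ?rpred0 //; apply: (po_l hP). Qed.
Lemma poN x : P x -> P (- x).
Proof. by rewrite -mulN1r; apply: (poMl hP); rewrite rpredN rpred1. Qed.
Lemma poB x y : P x -> P y -> P (x - y).
Proof. by move=> Px Py; apply: (poD hP) => //; apply: poN. Qed.
Lemma po_nM x y : x \in Aint -> y \in Aint -> ~ P x -> ~ P y -> ~ P (x * y).
Proof. by move=> Ax Ay nx ny /(poM hP Ax Ay)[]. Qed.
Lemma po_X x n : x \in Aint -> P (x ^+ n) -> P x.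
Proof.
move=> Ax; elim: n => [|n IHn]; first by rewrite expr0 => /(po1 hP).
by rewrite exprS => /(poM hP Ax)[]//; rewrite rpredX.
Qed.

Lemma po_int (m : int) : P m%:~R -> (l %| m)%Z.
Proof.
move=> Pm; apply: contrapT => /negP ndv; apply: (po1 hP).
have cop : coprimez l m by rewrite coprimezE prime_coprime // -dvdzE.
have [u [v e]] := Bezoutz l m; move: cop; rewrite /coprimez => /eqP gE; rewrite gE in e.
rewrite -[1]/(1%:~R) -e rmorphD !rmorphM /=.
by apply: (poD hP); apply: (poMl hP); rewrite ?rpred_int //; apply: (po_l hP).
Qed.

Lemma po_dvd (m : int) : (l %| m)%Z -> P m%:~R.
Proof.
by case/dvdzP=> q ->; rewrite rmorphM /=; apply: (poMl hP); rewrite ?Aint_int //; apply: (po_l hP).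
Qed.

(** The reason why [inA P] is a valuation ring: z is a quotient of algebraic integers b z and b that
    are not both in P. The candidates for b are the Horner tails B k of an integral polynomial of z;
    since its coefficients are B k - B (k+1) z, all tails in P would put every coefficient in P. *)
Lemma local_denominator (z : algC) : exists b,
  [/\ b \in Aint, b * z \in Aint, ~ (P b /\ P (b * z))
    & forall F, subfield F -> F z -> F b].
Proof.
have [p [pz [i0 nd]]] := int_poly_annihilator z pl.
pose pC : {poly algC} := map_poly intr p; pose B k := (drop_poly k pC).[z].
have cE k : pC`_k = B k - B k.+1 * z.
  rewrite /B; have -> : drop_poly k pC = drop_poly k.+1 pC * 'X + (pC`_k)%:P.
    apply/polyP => -[|i]; rewrite coefD coefMX coefC !coef_drop_poly ?add0r //=.
    by rewrite addr0 addSnnS.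
  by rewrite !hornerE addrAC subrr add0r.
have Ac k : pC`_k \in Aint by rewrite coef_map Aint_int.
(* With b = B (m+1) as leading coefficient, z is a root of b X^(m+1) plus lower terms with integer
   coefficients; multiplying by b^m makes b z a root of a monic polynomial. *)
have step m : B m.+1 \in Aint -> B m.+1 * z \in Aint.
  move=> AB; set b := B m.+1 in AB *.
  pose r : {poly algC} := \poly_(i < m.+1) (pC`_i * b ^+ (m - i)).
  pose q : {poly algC} := 'X^(m.+1) + r.
  have sq : (size r < size ('X^(m.+1) : {poly algC})%R)%N by rewrite size_polyXn ltnS size_poly.
  apply: (@Aint_root_monic q); first by rewrite monicE lead_coefDl // lead_coefXn.
    rewrite rootE hornerD hornerXn horner_poly.
    have <- : b ^+ m * pC.[z] = (b * z) ^+ m.+1 + \sum_(i < m.+1) pC`_i * b ^+ (m - i) * (b * z) ^+ i.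
      rewrite -[pC](poly_take_drop m.+1) hornerD hornerM hornerXn -/(B _) -/b.
      rewrite addrC mulrDr; congr (_ + _); first by rewrite exprMn (exprS b) mulrCA mulrA.
      rewrite /take_poly horner_poly mulr_sumr; apply: eq_bigr => i _.
      rewrite exprMn -{1}(subnK (leq_ord i)) exprD coefD coefMXn ltn_ord addr0 coef_poly ltn_ord.
      by move: (b ^+ (m - i)) (b ^+ i) (z ^+ i) (pC`_i) => ????; ring.
    by rewrite (eqP pz) mulr0.
  move=> i; rewrite coefD coefXn coef_poly rpredD ?rpred_nat //.
  by case: ifP => // _; rewrite ?rpred0 // rpredM ?rpredX.
(* Induction from the top degree down, where the tails vanish. *)
have AB k : B k \in Aint.
  have [n] := ubnP (size pC - k); elim: n k => // n IHn k lt_n.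
  have [le|gt] := leqP (size pC) k.
    by rewrite /B (drop_poly_eq0 le) horner0 rpred0.
  have -> : B k = pC`_k + B k.+1 * z by rewrite cE subrK.
  rewrite rpredD // step //; apply: IHn; rewrite subnS.
  by rewrite -ltnS (leq_trans _ lt_n) // ltnS prednK // subn_gt0.
have [[k nPk]|nex] := pselect (exists k, ~ (P (B k.+1) /\ P (B k.+1 * z))).
  exists (B k.+1); split=> //; first exact: step.
  move=> F hF Fz; apply: sfhorner => // i; rewrite coef_drop_poly coef_map; exact: sfint.
have {}nex k : P (B k.+1) /\ P (B k.+1 * z) by apply: contrapT => n; apply: nex; exists k.
case/negP: nd; apply: po_int; have -> : (p`_i0)%:~R = pC`_i0 by rewrite coef_map.
rewrite cE; apply: poB; last by case: (nex i0).
case: i0 => [|k]; last by case: (nex k).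
rewrite /B; have -> : drop_poly 0 pC = pC by apply/polyP => i; rewrite coef_drop_poly addn0.
by rewrite (eqP pz); apply: po0.
Qed.
End Valuation.

(** * Subrings and Frobenius congruences *)

Definition subring (S : set algC) : Prop :=
  [/\ S 1, forall x y, S x -> S y -> S (x - y) & forall x y, S x -> S y -> S (x * y)].

Section Subring.
Variables (S : set algC) (hS : subring S).
Lemma sr1 : S 1. Proof. by case: hS. Qed.
Lemma srB x y : S x -> S y -> S (x - y). Proof. by case: hS => _ + _; apply. Qed.
Lemma srM x y : S x -> S y -> S (x * y). Proof. by case: hS => _ _; apply. Qed.
Lemma sr0 : S 0. Proof. by rewrite -(subrr 1); apply: srB; exact: sr1. Qed.
Lemma srN x : S x -> S (- x). Proof. by rewrite -sub0r; apply: srB sr0. Qed.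
Lemma srD x y : S x -> S y -> S (x + y).
Proof. by move=> Sx Sy; rewrite -[y]opprK; apply/srB/srN. Qed.
Lemma srX x n : S x -> S (x ^+ n).
Proof. by move=> Sx; elim: n => [|n IHn]; rewrite ?expr0 ?exprS; [apply: sr1|apply: srM]. Qed.
Lemma srMn x n : S x -> S (x *+ n).
Proof. by move=> Sx; elim: n => [|n IHn]; rewrite ?mulr0n ?mulrS; [apply: sr0|apply: srD]. Qed.
Lemma srnat n : S n%:R. Proof. exact/srMn/sr1. Qed.
Lemma srsum (I : Type) (r : seq I) (Q : pred I) (G : I -> algC) :
  (forall i, Q i -> S (G i)) -> S (\sum_(i <- r | Q i) G i).
Proof. by move=> SG; elim/big_rec: _ => [|i x /SG]; [apply: sr0|apply: srD]. Qed.

Lemma frobeniusD l f x y : prime l -> S x -> S y ->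
  exists2 s, S s & (x + y) ^+ (l ^ f) = x ^+ (l ^ f) + y ^+ (l ^ f) + l%:R * s.
Proof.
move=> pl; have base a b : S a -> S b -> exists2 s, S s & (a + b) ^+ l = a ^+ l + b ^+ l + l%:R * s.
  case: l pl => // m pl Sa Sb; set l := m.+1; exists (\sum_(i < m) a ^+ (l - i.+1) * b ^+ i.+1 *+ ('C(l, i.+1) %/ l)).
    by apply: srsum => i _; apply/srMn/srM; apply: srX.
  rewrite exprDn big_ord_recl big_ord_recr /= subn0 bin0 mulr1 mulr1n.
  rewrite /bump /= add1n -/l subnn binn mul1r mulr1n mulr_sumr.
  rewrite [RHS]addrAC addrA; congr (_ + _ + _); apply: eq_bigr => i _.
  by rewrite /bump /= add1n mulr_natl -mulrnA divnK // prime_dvd_bin //; apply: (ltn_ord i).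
move=> Sx Sy; elim: f => [|f [s Ss IHf]].
  by exists 0; rewrite ?mulr0 ?addr0 ?expn0 ?expr1 //; apply: sr0.
have SX a n : S a -> S (a ^+ n) by apply: srX.
rewrite expnSr !exprM IHf.
have [s1 Ss1 ->] := base (x ^+ (l ^ f) + y ^+ (l ^ f)) (l%:R * s) (srD (SX _ _ Sx) (SX _ _ Sy)) (srM (srnat l) Ss).
have [s2 Ss2 ->] := base _ _ (SX _ (l ^ f)%N Sx) (SX _ (l ^ f)%N Sy).
exists (s2 + (l%:R ^+ l.-1 * s ^+ l + s1)).
  by apply/srD/srD => //; apply: srM; apply: srX => //; apply: srnat.
have E : l%:R ^+ l = l%:R * l%:R ^+ l.-1 :> algC by rewrite -exprS prednK ?prime_gt0.
by rewrite exprMn E; ring.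
Qed.

Lemma frobeniusB l f x y : prime l -> S x -> S y ->
  exists2 s, S s & (x - y) ^+ (l ^ f) = x ^+ (l ^ f) - y ^+ (l ^ f) + l%:R * s.
Proof.
move=> pl Sx Sy; have [s Ss] := frobeniusD f pl (srB Sx Sy) Sy.
rewrite subrK => ->; exists (- s); first exact: srN.
by ring.
Qed.
End Subring.

Lemma subring_Aint : subring [set x | x \in Aint].
Proof. by split=> [|x y|x y] /=; [exact: rpred1|exact: rpredB|exact: rpredM]. Qed.

Lemma minCpoly_conj w r : root (minCpoly w) r -> exists t : Aut, r = t w.
Proof. by case/conjugate_aut=> t <-; exists t. Qed.

(** The integer is the constant coefficient of the minimal polynomial, a norm up to sign; [v]
    collects the other conjugates. *)
Lemma Aint_dvd_int w : w \in Aint -> w != 0 ->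
  exists2 m : int, m != 0 & exists2 v, v \in Aint & m%:~R = v * w.
Proof.
move=> Aw nzw; have [rs Drs] := closed_field_poly_normal (minCpoly w).
rewrite (monicP (minCpoly_monic w)) scale1r in Drs.
have conj r : r \in rs -> exists t : Aut, r = t w.
  by rewrite -root_prod_XsubC -Drs; apply: minCpoly_conj.
have rw : w \in rs by rewrite -root_prod_XsubC -Drs root_minCpoly.
have : (minCpoly w)`_0 \in Num.int by move: Aw; rewrite unfold_in => /polyOverP.
case/intrP=> m Dm; have Em : m%:~R = \prod_(r <- rs) - r :> algC.
  rewrite -Dm -horner_coef0 Drs horner_prod; apply: eq_bigr => r _.
  by rewrite !hornerE.
exists m.
  rewrite -(intr_eq0 algC) Em prodf_seq_neq0; apply/allP => r /conj[t ->] /=.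
  by rewrite oppr_eq0 fmorph_eq0.
exists (- \prod_(r <- rem w rs) - r); last first.
  by rewrite Em (perm_big _ (perm_to_rem rw)) big_cons /= !mulNr mulrC.
rewrite rpredN big_seq; apply: rpred_prod => r /mem_rem/conj[t ->].
by rewrite rpredN Aint_aut.
Qed.

Section Local.
Variables (l : nat) (P : set algC) (hP : prime_over l P).
Let pl := po_prime hP.

Lemma po_fermat (c : int) : P (c%:~R ^+ l - c%:~R).
Proof.
have l0 := prime_gt0 pl; have nat_case n : P (n%:R ^+ l - n%:R).
  elim: n => [|n IHn]; first by rewrite expr0n eqn0Ngt l0 subr0; apply: (po0 hP).
  have [s As] := frobeniusD subring_Aint 1 pl (Aint_int n) (Aint_int 1).
  rewrite expn1 expr1n mulrS addrC => ->.
  rewrite (_ : _ - _ = (n%:R ^+ l - n%:R) + s * l%:R); last by rewrite -pmulrn; ring.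
  by apply: (poD hP) => //; apply: (poMl hP) => //; apply: (po_l hP).
case: c => n; rewrite ?NegzE; first exact: nat_case.
have [s As] := frobeniusB subring_Aint 1 pl (rpred0 _ : 0 \in Aint) (rpred_nat _ n.+1 : _ \in Aint).
rewrite expn1 rmorphN /= sub0r expr0n eqn0Ngt l0 /= => ->.
rewrite (_ : _ - _ = - (n.+1%:R ^+ l - n.+1%:R) + s * l%:R); last first.
  by rewrite -pmulrn; ring.
by apply: (poD hP); [apply: (poN hP)|apply: (poMl hP) => //; apply: (po_l hP)].
Qed.

Lemma po_Frobenius (p : {poly int}) x : x \in Aint ->
  P ((map_poly intr p).[x ^+ l] - (map_poly intr p).[x] ^+ l).
Proof.
move=> Ax; elim/poly_ind: p => [|p c IHp].
  by rewrite map_poly0 !horner0 expr0n eqn0Ngt prime_gt0 // subr0; apply: (po0 hP).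
have Ap y : y \in Aint -> (map_poly intr p).[y] \in Aint.
  by move=> Ay; rewrite rpred_horner //; apply/polyOverP => i; rewrite coef_map Aint_int.
rewrite !rmorphD !rmorphM /= map_polyX map_polyC !hornerE.
set a := (map_poly intr p).[x]; set b := (map_poly intr p).[x ^+ l] in IHp *.
have Sax : a * x \in Aint by rewrite rpredM ?Ap.
have [s As] := frobeniusD subring_Aint 1 pl Sax (Aint_int c).
rewrite !expn1 => ->; have -> : b * x ^+ l + c%:~R - ((a * x) ^+ l + c%:~R ^+ l + l%:R * s)
   = (b - a ^+ l) * x ^+ l - (c%:~R ^+ l - c%:~R) - l%:R * s by rewrite exprMn; ring.
apply: (poB hP); last by apply: (poMr hP) => //; apply: (po_l hP).
apply: (poB hP); first by apply: (poMr hP); rewrite ?rpredX.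
exact: po_fermat.
Qed.

(** Modulo P every y^(l^i) is a root of the minimal polynomial of y, hence congruent to one of
    finitely many conjugates. Two exponents i < j must collide, and taking l^i-th roots modulo P
    gives f = j - i. *)
Lemma residue_frobenius y : y \in Aint -> exists2 f, (0 < f)%N & P (y ^+ (l ^ f) - y).
Proof.
move=> Ay; have [rs Drs] := closed_field_poly_normal (minCpoly y).
rewrite (monicP (minCpoly_monic y)) scale1r in Drs.
have conj r : r \in rs -> exists t : Aut, r = t y.
  by rewrite -root_prod_XsubC -Drs; apply: minCpoly_conj.
have [p Dp] : exists p : {poly int}, minCpoly y = map_poly intr p.
  by move: Ay; rewrite unfold_in => /floorpP[p ->]; exists p.
have AX i : y ^+ i \in Aint by rewrite rpredX.
have Pp i : P (minCpoly y).[y ^+ (l ^ i)].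
  elim: i => [|i IHi]; first by rewrite expn0 expr1 (eqP (root_minCpoly y)); apply: (po0 hP).
  rewrite expnSr exprM Dp -[X in P X](subrK ((map_poly intr p).[y ^+ (l ^ i)] ^+ l)).
  apply: (poD hP); first exact: po_Frobenius.
  have E z : z ^+ l = z * z ^+ l.-1 :> algC by rewrite -exprS prednK ?prime_gt0.
  rewrite E; apply: (poMr hP); last by rewrite -Dp.
  by rewrite rpredX // rpred_horner //; apply/polyOverP => k; rewrite coef_map Aint_int.
have kx i : exists k : 'I_(size rs), P (y ^+ (l ^ i) - rs`_k).
  have : P (\prod_(k < size rs) (y ^+ (l ^ i) - rs`_k)).
    have := Pp i; rewrite Drs horner_prod (big_nth 0) big_mkord.
    by under eq_bigr do rewrite !hornerE.
  have Ak (k : 'I_(size rs)) : y ^+ (l ^ i) - rs`_k \in Aint.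
    by have [t ->] := conj _ (mem_nth 0 (ltn_ord k)); rewrite rpredB ?Aint_aut.
  apply: contraPP => nk.
  suff [] : \prod_(k < size rs) (y ^+ (l ^ i) - rs`_k) \in Aint /\
            ~ P (\prod_(k < size rs) (y ^+ (l ^ i) - rs`_k)) by [].
  elim/big_rec: _ => [|k x _ [Ax nPx]]; first by split; [exact: rpred1|exact: (po1 hP)].
  split; first by rewrite rpredM.
  by apply: (po_nM hP) => // Pk; apply: nk; exists k.
pose k i := projT1 (cid (kx i)).
have Pk i : P (y ^+ (l ^ i) - rs`_(k i)) by rewrite /k; case: cid.
have [i [j [lt_ij eq_k]]] : exists i j, (i < j)%N /\ k i = k j.
  have /injectivePn[i [j nij eij]] : ~~ injectiveb (fun i : 'I_(size rs).+1 => k i).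
    by apply: contraL (leqnn (size rs).+1) => /injectiveP/leq_card; rewrite !card_ord -ltnNge.
  by move: nij; rewrite neq_ltn => /orP[]; [exists i, j|exists j, i].
exists (j - i)%N; first by rewrite subn_gt0.
have Pij : P (y ^+ (l ^ j) - y ^+ (l ^ i)).
  rewrite (_ : _ - _ = (y ^+ (l ^ j) - rs`_(k j)) - (y ^+ (l ^ i) - rs`_(k i))).
    exact: (poB hP).
  by rewrite eq_k; ring.
apply: (@po_X _ _ hP _ (l ^ i)); first by rewrite rpredB.
have [s As ->] := frobeniusB subring_Aint i pl (AX (l ^ (j - i))%N) Ay.
rewrite -exprM -expnD subnK ?(ltnW lt_ij) //.
by apply: (poD hP) => //; apply: (poMr hP) => //; apply: (po_l hP).
Qed.

Lemma Aint_inA x : x \in Aint -> inA P x.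
Proof. by exists 1; split; rewrite ?mul1r ?rpred1 //; apply: (po1 hP). Qed.

Lemma inA_D x y : inA P x -> inA P y -> inA P (x + y).
Proof.
move=> [u [Au nu Aux]] [v [Av nv Avy]]; exists (u * v).
split; [by rewrite rpredM|exact: (po_nM hP)|].
rewrite (_ : _ * _ = v * (u * x) + u * (v * y)); last by ring.
by rewrite rpredD // rpredM.
Qed.
Lemma inA_M x y : inA P x -> inA P y -> inA P (x * y).
Proof.
move=> [u [Au nu Aux]] [v [Av nv Avy]]; exists (u * v).
split; [by rewrite rpredM|exact: (po_nM hP)|].
rewrite (_ : _ * _ = (u * x) * (v * y)); last by ring.
by rewrite rpredM.
Qed.
Lemma inA_N x : inA P x -> inA P (- x).
Proof. by case=> u [Au nu Aux]; exists u; rewrite mulrN rpredN. Qed.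
Lemma subring_inA : subring (inA P).
Proof.
split; [by apply: Aint_inA; rewrite rpred1|move=> x y Ax Ay|exact: inA_M].
by apply/inA_D/inA_N.
Qed.
Lemma inM_D x y : inM P x -> inM P y -> inM P (x + y).
Proof.
move=> [u [Au nu Aux]] [v [Av nv Avy]]; exists (u * v).
split; [by rewrite rpredM|exact: (po_nM hP)|].
rewrite (_ : _ * _ = v * (u * x) + u * (v * y)); last by ring.
by apply: (poD hP); apply: (poMl hP).
Qed.
Lemma inM_Ml x y : inA P x -> inM P y -> inM P (x * y).
Proof.
move=> [u [Au nu Aux]] [v [Av nv Avy]]; exists (u * v).
split; [by rewrite rpredM|exact: (po_nM hP)|].
rewrite (_ : _ * _ = (u * x) * (v * y)); last by ring.
exact: (poMl hP).
Qed.
Lemma inM_Mr x y : inA P x -> inM P y -> inM P (y * x).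
Proof. by rewrite mulrC; apply: inM_Ml. Qed.
Lemma inM_A x : inM P x -> inA P x.
Proof. by case=> u [Au nu Px]; exists u; split=> //; apply: (po_Aint hP). Qed.
Lemma P_inM x : P x -> inM P x.
Proof. by move=> Px; exists 1; rewrite mul1r rpred1; split=> //; apply: (po1 hP). Qed.
Lemma inM_Aint x : x \in Aint -> inM P x -> P x.
Proof. by move=> Ax [u [Au nu /(poM hP Au Ax)[]]]. Qed.
Lemma inM1 : ~ inM P 1.
Proof. by move/(inM_Aint (rpred1 _)); apply: (po1 hP). Qed.
Lemma inM_prime x y : inA P x -> inA P y -> inM P (x * y) -> inM P x \/ inM P y.
Proof.
move=> [u [Au nu Aux]] [v [Av nv Avy]] Mxy.
have : inM P ((u * x) * (v * y)).
  rewrite (_ : _ * _ = (u * v) * (x * y)); last by ring.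
  by apply: inM_Ml => //; apply: Aint_inA; rewrite rpredM.
have AA : u * x * (v * y) \in Aint by rewrite rpredM.
by case/(inM_Aint AA)/(poM hP Aux Avy) => ?; [left; exists u|right; exists v].
Qed.
Lemma inA_VM z : ~ inA P z -> inM P z^-1.
Proof.
move=> nAz; have nzz : z != 0.
  by apply/eqP => z0; apply: nAz; rewrite z0; apply: Aint_inA; rewrite rpred0.
have [b [Ab Abz nPb _]] := local_denominator hP z.
have Pb : P b by apply: contrapT => nb; apply: nAz; exists b.
exists (b * z); rewrite mulfK //; split=> // Pbz; exact: nPb.
Qed.
Lemma inA_V z : inA P z -> ~ inM P z -> inA P z^-1.
Proof. by move=> Az nMz; apply: contrapT => /inA_VM; rewrite invrK. Qed.

Lemma inA_field F z : subfield F -> F z -> inA P z ->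
  exists u, [/\ u \in Aint, F u, ~ P u & u * z \in Aint].
Proof.
move=> hF Fz [u [Au nu Auz]].
have [b [Ab Abz nPb Fb]] := local_denominator hP z.
exists b; split=> //; first exact: Fb.
move=> Pb; apply: nPb; split=> //.
have : P (u * (b * z)) by rewrite mulrCA; apply: (poMr hP).
by case/(poM hP Au Abz).
Qed.

Lemma unitA_M x y : unitA P x -> unitA P y -> unitA P (x * y).
Proof.
move=> [nx Ax Vx] [ny Ay Vy].
by split; [rewrite mulf_neq0|exact: inA_M|rewrite invfM; apply: inA_M].
Qed.
Lemma unitA_V x : unitA P x -> unitA P x^-1.
Proof. by move=> [nx Ax Vx]; split; rewrite ?invrK ?invr_eq0. Qed.
Lemma unitA_div x y : unitA P x -> unitA P y -> unitA P (x / y).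
Proof. by move=> ux uy; apply/unitA_M/unitA_V. Qed.
Lemma unitA_1 : unitA P 1.
Proof. by split; rewrite ?oner_eq0 ?invr1 //; apply: (sr1 subring_inA). Qed.
Lemma unitA_X x n : unitA P x -> unitA P (x ^+ n).
Proof. by move=> ux; elim: n => [|n IHn]; rewrite ?exprS; [apply: unitA_1|apply: unitA_M]. Qed.
Lemma unitA_Xz x (n : int) : unitA P x -> unitA P (x ^ n).
Proof. by move=> ux; case: n => n; rewrite /exprz; [|apply: unitA_V]; apply: unitA_X. Qed.
Lemma unitA_nM x : unitA P x -> ~ inM P x.
Proof. by move=> [nx Ax Vx] Mx; apply: inM1; rewrite -(divff nx); apply: inM_Mr. Qed.
Lemma unitAI x : inA P x -> ~ inM P x -> unitA P x.
Proof.
move=> Ax nMx; split=> //; last exact: inA_V.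
by apply/eqP => x0; apply: nMx; rewrite x0; apply/P_inM/(po0 hP).
Qed.
Lemma inM_X x n : inM P x -> (0 < n)%N -> inM P (x ^+ n).
Proof.
move=> Mx; case: n => // n _; rewrite exprS; apply: inM_Mr => //.
exact/(srX subring_inA)/inM_A.
Qed.
Lemma unitA_root x n : (0 < n)%N -> unitA P (x ^+ n) -> unitA P x.
Proof.
move=> n0 uxn; have n_M y : inM P y -> ~ unitA P (y ^+ n).
  by move=> My /unitA_nM; apply; apply: inM_X.
have Ax : inA P x.
  apply: contrapT => /inA_VM /n_M; apply; rewrite exprVn; exact: unitA_V.
by apply: unitAI => // /n_M.
Qed.
End Local.

(** * Unramified extensions *)

(** The f-th power of Frobenius fixes the class of y modulo p T. If every y in T has such an f, then
    p divides, up to units at P, each element of T that lies in the maximal ideal; the condition is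
    multiplicative and additive, so it is checked on ring generators. *)
Definition good (l : nat) (T : set algC) (p : algC) (f : nat) (y : algC) : Prop :=
  exists2 t, T t & y ^+ (l ^ f) - y = p * t.

Section Good.
Variables (l : nat) (T : set algC) (p : algC).
Hypotheses (pl : prime l) (hT : subring T) (Tp : T p).
Hypothesis lp : exists2 t, T t & l%:R = p * t.

Lemma good_mul f m y : T y -> good l T p f y -> good l T p (f * m) y.
Proof.
move=> Ty [t Tt Dt]; elim: m => [|m [t1 Tt1 Dt1]].
  by exists 0; rewrite ?mulr0 ?muln0 ?expr1 ?subrr //; apply: (sr0 hT).
have Tpt1 : T (p * t1) by apply: (srM hT).
have [s Ts Ds] := frobeniusD hT f pl Ty Tpt1.
have [t0 Tt0 Dl] := lp.
have Dm : y ^+ (l ^ (f * m)) = y + p * t1 by rewrite -Dt1 addrC subrK.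
rewrite /good mulnSr expnD exprM Dm Ds Dl.
have lf : (0 < l ^ f)%N by rewrite expn_gt0 prime_gt0.
exists (t + p ^+ (l ^ f).-1 * t1 ^+ (l ^ f) + t0 * s).
  by do 2?apply: (srD hT) => //; apply: (srM hT) => //; apply: (srX hT).
have E : p ^+ (l ^ f) = p * p ^+ (l ^ f).-1 by rewrite -exprS prednK.
by rewrite exprMn E !mulrDr -Dt; ring.
Qed.

Lemma good_ring : subring [set y | T y /\ exists2 f, (0 < f)%N & good l T p f y].
Proof.
have [t0 Tt0 Dl] := lp.
split=> [|x y|x y] /=.
- split; first exact: (sr1 hT).
  by exists 1%N => //; exists 0; rewrite ?expr1n ?subrr ?mulr0 //; apply: (sr0 hT).
- move=> [Tx [f f0 Gx]] [Ty [g g0 Gy]]; split; first exact: (srB hT).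
  exists (f * g)%N; rewrite ?muln_gt0 ?f0 // /good.
  have [t Tt Dt] := good_mul g Tx Gx; have [u Tu] := good_mul f Ty Gy; rewrite mulnC => Du.
  have [s Ts ->] := frobeniusB hT (f * g) pl Tx Ty.
  exists (t - u + t0 * s); last by rewrite Dl mulrDr mulrBr -Dt -Du; ring.
  by apply: (srD hT); [apply: (srB hT)|apply: (srM hT)].
- move=> [Tx [f f0 Gx]] [Ty [g g0 Gy]]; split; first exact: (srM hT).
  exists (f * g)%N; rewrite ?muln_gt0 ?f0 // /good.
  have [t Tt Dt] := good_mul g Tx Gx; have [u Tu] := good_mul f Ty Gy; rewrite mulnC => Du.
  exists (t * y + x ^+ (l ^ (f * g)) * u).
    by apply: (srD hT); apply: (srM hT) => //; apply: (srX hT).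
  rewrite exprMn (_ : _ - _ = (x ^+ (l ^ (f * g)) - x) * y + x ^+ (l ^ (f * g)) * (y ^+ (l ^ (f * g)) - y)).
    by rewrite Dt Du; ring.
  by ring.
Qed.
End Good.

Definition ring_gen (S : set algC) : set algC := smallest subring S.

Lemma subring_gen S : subring (ring_gen S).
Proof.
split=> [|x y Sx Sy|x y Sx Sy] A [hA SA]; first exact: (sr1 hA).
  by apply: (srB hA); [apply: Sx|apply: Sy].
by apply: (srM hA); [apply: Sx|apply: Sy].
Qed.

Lemma sub_ring_gen (S : set algC) x : S x -> ring_gen S x.
Proof. by move=> Sx A [_ SA]; apply: SA. Qed.

Lemma ring_gen_sub (S T : set algC) : subring T -> S `<=` T -> ring_gen S `<=` T.
Proof. by move=> hT ST x; apply. Qed.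

Lemma good_gen l S p : prime l -> ring_gen S p ->
  (exists2 t, ring_gen S t & l%:R = p * t) ->
  (forall y, S y -> exists2 f, (0 < f)%N & good l (ring_gen S) p f y) ->
  forall y, ring_gen S y -> exists2 f, (0 < f)%N & good l (ring_gen S) p f y.
Proof.
move=> pl Tp lp Sgood y Ty.
suff [] : [set y | ring_gen S y /\ exists2 f, (0 < f)%N & good l (ring_gen S) p f y] y by [].
apply: (ring_gen_sub (good_ring pl (subring_gen S) Tp lp)) Ty => z Sz.
by split; [apply: sub_ring_gen|apply: Sgood].
Qed.

Definition frac (T : set algC) : set algC := [set z | exists x y, [/\ T x, T y & z = x / y]].

Lemma subfield_frac T : subring T -> subfield (frac T).
Proof.
move=> hT; have T0 := sr0 hT; have T1 := sr1 hT; split.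
- by exists 1, 1; rewrite divr1.
- move=> _ _ [a [b [Ta Tb ->]]] [c [d [Tc Td ->]]].
  have [->|nzb] := eqVneq b 0.
    by rewrite invr0 mulr0 sub0r -mulNr; exists (- c), d; split=> //; apply: (srN hT).
  have [->|nzd] := eqVneq d 0; first by rewrite invr0 mulr0 subr0; exists a, b.
  exists (a * d - c * b), (b * d); split; [apply: (srB hT)|..]; try exact: (srM hT).
  by field; rewrite nzb nzd.
- move=> _ _ [a [b [Ta Tb ->]]] [c [d [Tc Td ->]]].
  exists (a * d), (b * c); split; try exact: (srM hT).
  by rewrite !invfM invrK; ring.
Qed.

Lemma sub_frac (T : set algC) x : subring T -> T x -> frac T x.
Proof. by move=> hT Tx; exists x, 1; rewrite divr1; split=> //; apply: (sr1 hT). Qed.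

(** * Elements of T as powers of a uniformizer *)

Section Uniformizer.
Variables (l : nat) (P : set algC) (hP : prime_over l P) (T : set algC) (p : algC) (r : nat).
Let pl := po_prime hP.
Hypotheses (hT : subring T) (TA : T `<=` inA P) (Tp : T p) (Mp : inM P p) (nzp : p != 0).
Hypothesis pr : inA P (p ^+ r / l%:R).
Hypothesis Tgood : forall y, T y -> exists2 f, (0 < f)%N & good l T p f y.

(** Up to units at P, y divides an integer l^j c with c prime to l, and l divides p^r; so p divides
    y at most r j times. *)
Lemma ord_bounded y : inA P y -> y != 0 -> exists K, ~ inA P (y / p ^+ K).
Proof.
move=> [u [Au nu Auy]] nzy.
have nzu : u != 0 by apply/eqP => u0; apply: nu; rewrite u0; apply: (po0 hP).
have [m nzm [v Av Dm]] := Aint_dvd_int Auy (mulf_neq0 nzu nzy).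
have uA := Aint_inA hP.
have l1 := prime_gt1 pl.
have nzl : l%:R != 0 :> algC by rewrite pnatr_eq0 -lt0n prime_gt0.
have [j [c [Dmj ndc]]] : exists j c, m = (l ^ j)%:Z * c /\ ~~ (l %| c)%Z.
  have m0 : (0 < `|m|)%N by rewrite absz_gt0.
  have /dvdzP[c Dc] : ((l ^ logn l `|m|)%N %| m)%Z by rewrite dvdzE /= pfactor_dvdn.
  exists (logn l `|m|), c; split; first by rewrite mulrC.
  apply/negP => /dvdzP[c' Dc']; have : ((l ^ (logn l `|m|).+1)%N %| m)%Z.
    by apply/dvdzP; exists c'; rewrite {1}Dc Dc' expnS PoszM mulrA.
  by rewrite dvdzE /= pfactor_dvdn // ltnn.
have uc : unitA P c%:~R.
  apply: (unitAI hP); first by apply: uA; rewrite Aint_int.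
  by move/(inM_Aint hP (Aint_int _))/(po_int hP); apply/negP.
exists (r * j).+1 => AyK; apply: (inM1 hP).
have A1 : inA P ((l ^ j)%:R / p ^+ (r * j).+1).
  have -> : (l ^ j)%:R / p ^+ (r * j).+1 = c%:~R^-1 * v * u * (y / p ^+ (r * j).+1).
    have nzc : c%:~R != 0 :> algC by case: uc.
    have El : (l ^ j)%:R = v * (u * y) / c%:~R :> algC.
      by apply: (mulIf nzc); rewrite divfK // -Dm Dmj rmorphM.
    by rewrite El; ring.
  do 3?apply: (inA_M hP) => //; first by case: uc.
    exact: uA.
  exact: uA.
have A2 : inA P (p ^+ (r * j) / (l ^ j)%:R).
  by rewrite natrX exprM -expr_div_n; apply/(srX (subring_inA hP)).
rewrite -(mulVf nzp); apply: (inM_Ml hP) => //.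
have -> : p^-1 = (l ^ j)%:R / p ^+ (r * j).+1 * (p ^+ (r * j) / (l ^ j)%:R).
  have nzlj : (l ^ j)%:R != 0 :> algC by rewrite natrX expf_neq0.
  have nzpj : p ^+ (r * j) != 0 by rewrite expf_neq0.
  by rewrite exprS; move: (p ^+ _) nzpj ((l ^ j)%:R) nzlj => a na b nb; field; rewrite nzp na nb.
exact: (inA_M hP).
Qed.

(** With q = l^f, the relation y^q - y = p t reads (1 - y^(q-1)) y = - p t, and the bracket is a
    unit at P because y is in the maximal ideal. *)
Lemma uniformizer_step y : T y -> inM P y ->
  exists y' u, [/\ T y', T u, ~ inM P u & u * y = p * y'].
Proof.
move=> Ty My; have [f f0 [t Tt Dt]] := Tgood Ty.
have q1 : (1 < l ^ f)%N by rewrite -(exp1n f) ltn_exp2r // prime_gt1.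
exists (- t), (1 - y ^+ (l ^ f).-1); split.
- exact: (srN hT).
- by apply: (srB hT); [apply: (sr1 hT)|apply: (srX hT)].
- move=> Mu; apply: (inM1 hP); rewrite -(subrK (y ^+ (l ^ f).-1) 1).
  by apply: (inM_D hP) => //; apply: (inM_X hP) => //; rewrite -ltnS prednK // ltnW.
- have E : y ^+ (l ^ f) = y * y ^+ (l ^ f).-1 by rewrite -exprS prednK // ltnW.
  by rewrite mulrN -Dt E; ring.
Qed.

Lemma uniformizer_val y : T y -> y != 0 ->
  exists k a u, [/\ T a, T u, ~ inM P a, ~ inM P u & u * y = p ^+ k * a].
Proof.
move=> Ty nzy; have [K nK] := ord_bounded (TA Ty) nzy.
apply: contrapT => nex.
have all k : exists a u, [/\ T a, T u, ~ inM P u & u * y = p ^+ k * a].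
  elim: k => [|k [a [u [Ta Tu nu E]]]].
    by exists y, 1; split=> //; [exact: (sr1 hT)|exact: (inM1 hP)].
  have Ma : inM P a by apply: contrapT => na; apply: nex; exists k, a, u.
  have [a' [v [Ta' Tv nv Ev]]] := uniformizer_step Ta Ma.
  exists a', (v * u); split => //; first exact: (srM hT).
    by case/(inM_prime hP (TA Tv) (TA Tu)).
  by rewrite -mulrA E mulrCA Ev exprSr mulrA.
have [a [u [Ta Tu nu E]]] := all K; apply: nK.
have uu : unitA P u by apply: (unitAI hP) => //; apply: TA.
have -> : y / p ^+ K = a / u.
  have nzu : u != 0 by case: uu.
  have nzpK : p ^+ K != 0 by rewrite expf_neq0.
  by apply: (mulIf nzpK); apply: (mulfI nzu); rewrite divfK // E; field.
by apply: (inA_M hP); [apply: TA|case: uu].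
Qed.

Lemma uniformizer_frac z : frac T z -> z != 0 -> exists k : int, unitA P (z / p ^ k).
Proof.
have ord y : T y -> y != 0 -> exists k : nat, unitA P (y / p ^+ k).
  move=> Ty nzy; have [k [a [u [Ta Tu na nu E]]]] := uniformizer_val Ty nzy.
  exists k; have ua : unitA P a by apply: (unitAI hP) => //; apply: TA.
  have uu : unitA P u by apply: (unitAI hP) => //; apply: TA.
  have -> : y / p ^+ k = a / u; last exact: (unitA_div hP).
  have nzu : u != 0 by case: uu.
  have nzpk : p ^+ k != 0 by rewrite expf_neq0.
  by apply: (mulIf nzpk); apply: (mulfI nzu); rewrite divfK // E; field.
move=> [x [y [Tx Ty ->]]]; rewrite mulf_eq0 invr_eq0 negb_or => /andP[nzx nzy].
have [j uj] := ord x Tx nzx; have [k uk] := ord y Ty nzy.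
exists (j%:Z - k%:Z); rewrite expfzDr // -exprnP -invr_expz -exprnP.
rewrite (_ : _ / _ = (x / p ^+ j) / (y / p ^+ k)); first exact: (unitA_div hP).
have nzpj : p ^+ j != 0 by rewrite expf_neq0.
have nzpk : p ^+ k != 0 by rewrite expf_neq0.
by field; rewrite nzpj nzpk nzy.
Qed.
End Uniformizer.

(** Lying over, by Zorn's lemma: an ideal of all algebraic integers that is maximal among those
    disjoint from 1 + I is prime, and it contains I by integrality. *)
Lemma subring_ideal_prime (O I : set algC) : subring O -> (forall x, O x -> x \in Aint) ->
  (forall x, I x -> O x) -> (forall x y, I x -> I y -> I (x + y)) ->
  (forall a x, O a -> I x -> I (a * x)) -> ~ I 1 -> (exists2 x, I x & x != 0) ->
  exists l P, prime_over l P /\ I `<=` P.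
Proof.
move=> hO OA IO ID IM nI1 [x0 Ix0 nzx0].
have O1 := sr1 hO.
(* The empty set belongs to the family, being the union of the empty chain; hence the alternative q
   = 0 in [ext] until [Q0] is proved. *)
pose fam (J : set algC) := [/\ forall x, J x -> x \in Aint,
  forall x y, J x -> J y -> J (x + y), forall a x, a \in Aint -> J x -> J (a * x)
  & forall u, I (u - 1) -> ~ J u].
have [|Q [famQ maxQ]] := @Zorn_bigcup _ fam.
  move=> G Gfam totG; split.
  - by move=> x [J GJ Jx]; have [+ _ _ _] := Gfam _ GJ; apply.
  - move=> x y [J GJ Jx] [J' GJ' Jy].
    have [JJ'|J'J] := totG _ _ GJ GJ'.
      by exists J' => //; have [_ + _ _] := Gfam _ GJ'; apply=> //; apply: JJ'.
    by exists J => //; have [_ + _ _] := Gfam _ GJ; apply=> //; apply: J'J.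
  - by move=> a x Aa [J GJ Jx]; exists J => //; have [_ _ + _] := Gfam _ GJ; apply.
  - by move=> u Iu [J GJ]; have [_ _ _ +] := Gfam _ GJ; apply.
have [QA QD QM Qdisj] := famQ.
have OB u : I (u - 1) -> O u by move=> Iu; rewrite -(subrK 1 u); apply: (srD hO) => //; apply: IO.
have ext z : z \in Aint -> ~ Q z ->
    exists q a, [/\ Q q \/ q = 0, a \in Aint & I (q + a * z - 1)].
  move=> Az nQz; apply: contrapT => nex.
  pose B : set algC := [set x | exists q a, [/\ Q q \/ q = 0, a \in Aint & x = q + a * z]].
  apply: (maxQ B).
    split.
      by move=> q Qq; exists q, 0; rewrite mul0r addr0 rpred0; split=> //; left.
    by move=> BQ; apply: nQz; apply: BQ; exists 0, 1; rewrite mul1r add0r rpred1; split=> //; right.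
  have AQ q : Q q \/ q = 0 -> q \in Aint by case=> [/QA//|->]; rewrite rpred0.
  split.
  - by move=> _ [q [a [/AQ Aq Aa ->]]]; rewrite rpredD ?rpredM.
  - move=> _ _ [q [a [Qq Aa ->]]] [q' [a' [Qq' Aa' ->]]].
    exists (q + q'), (a + a'); split; [|by rewrite rpredD|by ring].
    case: Qq Qq' => [Qq|->] [Qq'|->]; rewrite ?addr0 ?add0r; try by left.
      by left; apply: QD.
    by right.
  - move=> b _ Ab [q [a [Qq Aa ->]]]; exists (b * q), (b * a); split; [|by rewrite rpredM|by ring].
    by case: Qq => [Qq|->]; [left; apply: QM|right; rewrite mulr0].
  - by move=> u Iu [q [a [Qq Aa Du]]]; apply: nex; exists q, a; rewrite -Du.
have Q0 : Q 0.
  apply: contrapT => /(ext _ (rpred0 _))[q [a [Qq _]]]; rewrite mulr0 addr0 => Iq.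
  case: Qq => [/(Qdisj _ Iq)//|q0]; apply: nI1; rewrite q0 sub0r in Iq.
  by rewrite -[1]opprK -mulN1r; apply: IM => //; apply: (srN hO).
have {}ext z : z \in Aint -> ~ Q z -> exists q a, [/\ Q q, a \in Aint & I (q + a * z - 1)].
  by move=> Az /(ext _ Az)[q [a [[Qq|->] Aa Iq]]]; [exists q, a|exists 0, a].
have I0 : I 0 by rewrite -(mul0r x0); apply: IM => //; apply: (sr0 hO).
have nQ1 : ~ Q 1 by apply: Qdisj; rewrite subrr.
have IX u n : I (u - 1) -> I (u ^+ n - 1).
  move=> Iu; elim: n => [|n IHn]; first by rewrite subrr.
  rewrite (_ : _ - _ = u * (u ^+ n - 1) + (u - 1)); last by rewrite exprS; ring.
  by apply: ID => //; apply: IM => //; apply: OB.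
have Qprime x y : x \in Aint -> y \in Aint -> Q (x * y) -> Q x \/ Q y.
  move=> Ax Ay Qxy; apply: contrapT => /not_orP[/(ext _ Ax)[q [a [Qq Aa Iu]]] /(ext _ Ay)[q' [a' [Qq' Aa' Iu']]]].
  set u := q + a * x in Iu; set u' := q' + a' * y in Iu'.
  apply: (Qdisj (u * u')).
    rewrite (_ : _ - _ = u * (u' - 1) + (u - 1)); last by ring.
    by apply: ID => //; apply: IM => //; apply: OB.
  rewrite (_ : u * u' = u' * q + (a * x) * q' + (a * a') * (x * y)); last by rewrite /u /u'; ring.
  have Au' : u' \in Aint by apply/OA/OB.
  by apply: (QD); [apply: (QD)|]; apply: QM => //; rewrite rpredM.
(* If z is outside Q, some u = q + a z with q in Q is 1 modulo I. Homogenising the monic equation of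
   a gives w, which is u^m = 1 modulo I, and also lies in Q because a z may replace u modulo Q: a
   contradiction. *)
have IQ z : I z -> Q z.
  move=> Iz; apply: contrapT => nQz; have Oz := IO _ Iz; have Az := OA _ Oz.
  have [q [a [Qq Aa Iu]]] := ext _ Az nQz.
  set u := q + a * z in Iu; have Ou := OB _ Iu.
  have [p Dp] : exists p : {poly int}, minCpoly a = map_poly intr p.
    by move: (Aa); rewrite unfold_in => /floorpP[p ->]; exists p.
  have /monicP := minCpoly_monic a; rewrite lead_coefE.
  have := size_minCpoly a; have /eqP := root_minCpoly a; rewrite horner_coef.
  set m := size (minCpoly a); set c := fun i => (minCpoly a)`_i.
  have Oc i : O (c i).
    rewrite /c Dp coef_map /=; have On := srnat hO; case: (p`_i) => n; rewrite ?NegzE ?rmorphN /=; first exact: On.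
    by apply: (srN hO); apply: On.
  case: m => // m rootc _ lcc.
  pose w := \sum_(i < m.+1) c i * z ^+ (m - i) * u ^+ i.
  apply: (Qdisj w).
    rewrite /w big_ord_recr /= subnn expr0 mulr1 [c m]lcc mul1r -addrA.
    apply: (ID); last exact: IX.
    apply: (big_ind I) => [|x y|i _]; [exact: I0|exact: ID|rewrite mulrAC; apply: (IM)].
      by apply: (srM hO) => //; apply: (srX hO).
    have -> : (m - i = (m - i).-1.+1)%N by rewrite prednK // subn_gt0.
    by rewrite exprSr; apply: IM => //; apply: (srX hO).
  have E : \sum_(i < m.+1) c i * z ^+ (m - i) * (a * z) ^+ i = 0.
    transitivity ((\sum_(i < m.+1) c i * a ^+ i) * z ^+ m); last by rewrite [X in X * _]rootc mul0r.
    rewrite mulr_suml; apply: eq_bigr => i _.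
    have -> : z ^+ m = z ^+ (m - i) * z ^+ i by rewrite -exprD subnK // leq_ord.
    by rewrite exprMn; ring.
  rewrite -[w]subr0 -E /w -sumrB; apply: (big_ind Q) => [|x y|i _]; [exact: Q0|exact: QD|].
  rewrite -mulrBr subrXX (_ : u - a * z = q); last by rewrite /u; ring.
  rewrite [q * _]mulrC mulrA; apply: QM => //.
  have AX x n : x \in Aint -> x ^+ n \in Aint by apply: rpredX.
  rewrite !rpredM ?AX //; first exact/OA/Oc.
  by apply: rpred_sum => j _; rewrite rpredM ?AX ?rpredM //; apply/OA.
have [m nzm [v Av Dm]] := Aint_dvd_int (OA _ (IO _ Ix0)) nzx0.
have Qm : Q m%:~R by rewrite Dm; apply: QM => //; apply: IQ.
have [l pl Ql] : exists2 l, prime l & Q l%:R.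
  have : Q (`|m|%N)%:R.
    have -> : (`|m|%N)%:R = (sgz m)%:~R * m%:~R :> algC.
      by rewrite -rmorphM /= -abszEsg.
    by apply: QM => //; apply: Aint_int.
  have : (0 < `|m|)%N by rewrite absz_gt0.
  elim/ltn_ind: `|m|%N => n IHn n0 Qn.
  have [n1|n1] := leqP n 1; first by case: nQ1; have -> : 1 = n%:R :> algC by case: n n0 n1 {IHn Qn} => [|[]].
  have := pdiv_dvd n; case/dvdnP=> k Dn; have pp := pdiv_prime n1.
  have : Q (k%:R * (pdiv n)%:R) by rewrite -natrM -Dn.
  case/(Qprime _ _ (rpred_nat _ k) (rpred_nat _ _)) => Qk; last by exists (pdiv n).
  apply: (IHn k) => //; last by rewrite lt0n; apply/eqP => k0; rewrite Dn k0 in n0.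
  have k0 : (0 < k)%N by rewrite lt0n; apply/eqP => k0; rewrite Dn k0 in n0.
  by rewrite Dn ltn_Pmulr // prime_gt1.
by exists l, Q; split=> //; split.
Qed.

(** * A uniformizer at an unramified prime *)

Lemma is_ideal_int_ring F : subfield F -> is_ideal F (int_ring F).
Proof.
move=> hF; split=> //; first by split; [apply: (sf0 hF)|rewrite rpred0].
  by move=> x y [Fx Ax] [Fy Ay]; split; [apply: (sfD hF)|rewrite rpredD].
by move=> x y [Fx Ax] [Fy Ay]; split; [apply: (sfM hF)|rewrite rpredM].
Qed.

Lemma is_ideal_span F S : subfield F -> S `<=` int_ring F -> is_ideal F (ideal_span F S).
Proof.
move=> hF SO; split=> [x Sx||x y Sx Sy|a x Oa Sx].
- by apply: Sx; split=> //; apply: is_ideal_int_ring.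
- by move=> J [[]].
- by move=> J idJ; have [[_ _ + _] _] := idJ; apply; [apply: Sx|apply: Sy].
- by move=> J idJ; have [[_ _ _ +] _] := idJ; apply=> //; apply: Sx.
Qed.

Section UnramifiedPrime.
Variables (l : nat) (P : set algC) (hP : prime_over l P) (K H : set algC).
Hypotheses (hK : subfield K) (hH : subfield H) (KH : K `<=` H).
Hypothesis unr : unramified K H.
Let pl := po_prime hP.
Let Q := P `&` H.

Let primeQ : prime_ideal H Q.
Proof.
split.
- split; first by move=> x [/(po_Aint hP) Ax Hx].
    by split; [exact: (po0 hP)|exact: (sf0 hH)].
    by move=> x y [Px Hx] [Py Hy]; split; [exact: (poD hP)|exact: (sfD hH)].
  by move=> a x [Ha Aa] [Px Hx]; split; [exact: (poMl hP)|exact: (sfM hH)].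
- apply/eqP => EQ; have : Q 1 by rewrite EQ; split; [exact: (sf1 hH)|rewrite rpred1].
  by case=> /(po1 hP).
- by move=> x y [Hx Ax] [Hy Ay] [/(poM hP Ax Ay)[] ? _]; [left|right].
Qed.

(** Ramification index one yields x in K and P outside Q^2. It divides each y in Q locally:
    otherwise x / y is in the maximal ideal, and a denominator u of it, invertible modulo P by a
    power of itself, exhibits x as an element of Q^2. *)
Lemma unramified_uniformizer : exists x, [/\ K x, P x, x != 0
  & forall y, H y -> inM P y -> inA P (y / x)].
Proof.
have idQ : is_ideal H Q by case: primeQ.
have idO := is_ideal_int_ring hH.
have mulO I J : is_ideal H I -> is_ideal H J -> is_ideal H (ideal_mul H I J).
  move=> [IO _ _ _] [JO _ _ _]; apply: is_ideal_span => // _ [x /IO[Hx Ax] [y /JO[Hy Ay] <-]].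
  by split; [apply: (sfM hH)|rewrite rpredM].
pose Q2 := ideal_pow H Q 2.
have idQ2 : is_ideal H Q2 by apply: (mulO) => //; apply: (mulO).
have Q2M x y : Q x -> Q y -> Q2 (x * y).
  move=> Qx Qy; apply: sub_gen_smallest; exists x => //; exists y => //.
  apply: sub_gen_smallest; exists y => //; exists 1; last by rewrite mulr1.
  by split; [exact: (sf1 hH)|rewrite rpred1].
have Ql : Q l%:R by split; [exact: (po_l hP)|exact: (sfnat hH)].
have nzl : l%:R != 0 :> algC by rewrite pnatr_eq0 -lt0n prime_gt0.
have nQ0 : Q != [set 0].
  by apply/eqP => Q0; move: Ql; rewrite Q0 => /= /eqP; rewrite (negPf nzl).
have [_ nram] := unr.1 Q primeQ nQ0.
have [x [Kx Qx nQ2x]] : exists x, [/\ K x, Q x & ~ Q2 x].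
  apply: contrapT => nex; apply: nram; apply: smallest_sub => // x [Qx Kx].
  by apply: contrapT => nQ2; apply: nex; exists x.
have [Px Hx] := Qx; have nzx : x != 0.
  by apply/eqP => x0; apply: nQ2x; rewrite x0; case: idQ2.
have base y : Q y -> inA P (y / x).
  move=> Qy; have [Py Hy] := Qy; apply: contrapT => nAyx; have := inA_VM hP nAyx.
  rewrite invf_div => Mz; have nzy : y != 0.
    by apply/eqP => y0; apply: nAyx; rewrite y0 mul0r; apply/(inM_A hP)/(P_inM hP)/(po0 hP).
  have [u [Au Hu nu Auz]] := inA_field hP hH (sfdiv hH Hx Hy) (inM_A hP Mz).
  have Puz : P (u * (x / y)).
    by apply: (inM_Aint hP) => //; apply: (inM_Ml hP) => //; apply: (Aint_inA hP).
  have [f f0] := residue_frobenius hP Au.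
  have q1 : (1 < l ^ f)%N by rewrite -(exp1n f) ltn_exp2r // prime_gt1.
  case: (l ^ f)%N q1 => [|[|q]] // _; rewrite !exprS.
  rewrite (_ : _ - _ = u * (u * u ^+ q - 1)); last by ring.
  have AuX : u ^+ q \in Aint by rewrite rpredX.
  have AuS : u * u ^+ q - 1 \in Aint by rewrite rpredB ?rpredM ?rpred1.
  case/(poM hP Au AuS) => // Pu1; apply: nQ2x.
  have -> : x = u ^+ q * ((u * (x / y)) * y) + (- 1) * ((u * u ^+ q - 1) * x) by field.
  have HuX : H (u ^+ q) by apply: (sfX hH).
  have [_ _ Q2D Q2Z] := idQ2; apply: Q2D; apply: Q2Z.
  - by [].
  - by apply: Q2M => //; split=> //; apply: (sfM hH) => //; apply: (sfdiv hH).
  - by split; rewrite ?rpredN ?rpred1 //; apply/(sfN hH)/(sf1 hH).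
  - apply: Q2M => //; split=> //; apply: (sfB hH); last exact: (sf1 hH).
    exact: (sfM hH).
exists x; split=> // y Hy My.
have [u [Au Hu nu Auy]] := inA_field hP hH Hy (inM_A hP My).
have uu : unitA P u by apply: (unitAI hP); [apply: (Aint_inA hP)|move/(inM_Aint hP Au)].
have -> : y / x = u^-1 * ((u * y) / x).
  by case: uu => nzu _ _; field; rewrite nzu nzx.
apply: (inA_M hP); first by case: uu.
apply: base; split; last exact: (sfM hH).
by apply: (inM_Aint hP) => //; apply: (inM_Ml hP) => //; apply: (Aint_inA hP).
Qed.
End UnramifiedPrime.

(** * The compositum of fields sharing a uniformizer *)

Section UnramifiedRing.
Variables (l : nat) (P : set algC) (hP : prime_over l P) (Ls : set (set algC)) (p zeta : algC) (f0 : nat).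
Let pl := po_prime hP.
Hypotheses (hLs : forall L, Ls L -> subfield L) (nLs : exists L, Ls L).
Hypotheses (Lp : forall L, Ls L -> L p) (nzp : p != 0) (Mp : inM P p).
Hypothesis (p2 : inA P (p ^+ 2 / l%:R)).
Hypothesis (unif : forall L, Ls L -> forall y, L y -> inM P y -> inA P (y / p)).
Hypotheses (Azeta : zeta \in Aint) (f0_gt0 : (0 < f0)%N) (zetaE : zeta ^+ (l ^ f0) = zeta).

(** Only P-integral elements are taken, so that [p] is a uniformizer of the ring T they generate;
    its fraction field still contains each L, because the inverse of a non-integral element is
    integral. *)
Definition unramified_gen : set algC :=
  [set z | z = zeta \/ exists2 L, Ls L & L z /\ inA P z].
Let T := ring_gen unramified_gen.

Let hT : subring T. Proof. exact: subring_gen. Qed.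

Let TA : T `<=` inA P.
Proof.
apply: ring_gen_sub; first exact: (subring_inA hP).
by move=> z [->|[L _ []]] //; apply: (Aint_inA hP).
Qed.

Let TL L z : Ls L -> L z -> inA P z -> T z.
Proof. by move=> LsL Lz Az; apply: sub_ring_gen; right; exists L. Qed.

Let Tp : T p.
Proof. by case: nLs => L LsL; apply: (TL LsL); [exact: (Lp LsL)|exact: (inM_A hP)]. Qed.

Let lp : exists2 t, T t & l%:R = p * t.
Proof.
case: nLs => L LsL; have hL := hLs LsL; have Ll : L l%:R by apply: (sfnat hL).
exists (l%:R / p); last by rewrite mulrC divfK.
apply: (TL LsL); first by apply: (sfdiv hL) => //; exact: (Lp LsL).
by apply: (unif LsL) => //; apply/(P_inM hP)/(po_l hP).
Qed.

Let residue_good y f m : y \in Aint -> P (y ^+ (l ^ f) - y) -> P (y ^+ (l ^ (f * m)) - y).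
Proof.
move=> Ay Py; elim: m => [|m IHm]; first by rewrite muln0 expr1 subrr; apply: (po0 hP).
rewrite mulnSr expnD exprM -(subrK (y ^+ (l ^ f)) (_ ^+ _)) -addrA.
apply: (poD hP) => //; have Ayf : y ^+ (l ^ (f * m)) \in Aint by rewrite rpredX.
have [s As E] := frobeniusB subring_Aint f pl Ayf Ay.
have -> : (y ^+ (l ^ (f * m))) ^+ (l ^ f) - y ^+ (l ^ f) = (y ^+ (l ^ (f * m)) - y) ^+ (l ^ f) - s * l%:R.
  by rewrite E; ring.
apply: (poB hP); last by apply: (poMl hP) => //; apply: (po_l hP).
have lf : (0 < l ^ f)%N by rewrite expn_gt0 prime_gt0.
by rewrite -(prednK lf) exprS; apply: (poMr hP) => //; rewrite rpredX // rpredB.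
Qed.

(** y is a quotient of algebraic integers u y and u, both fixed by a common Frobenius power modulo
    P. So y^q - y lies in L and in the maximal ideal, and [unif] divides it by p. *)
Let gen_good y : unramified_gen y -> exists2 f, (0 < f)%N & good l T p f y.
Proof.
case=> [->|[L LsL [Ly Ay]]].
  by exists f0 => //; exists 0; [apply: (sr0 hT)|rewrite zetaE subrr mulr0].
have hL := hLs LsL; have [u [Au Lu nu Auy]] := inA_field hP hL Ly Ay.
have [f fpos Pu] := residue_frobenius hP Au; have [g gpos Pw] := residue_frobenius hP Auy.
exists (f * g)%N; first by rewrite muln_gt0 fpos.
have {}Pu := residue_good g Au Pu; have := residue_good f Auy Pw; rewrite mulnC => {}Pw.
set q := (l ^ (f * g))%N in Pu Pw *; exists ((y ^+ q - y) / p); last by rewrite /good -/q mulrC divfK.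
have Lyq : L (y ^+ q - y) by apply: (sfB hL) => //; apply: (sfX hL).
have uu : unitA P u by apply: (unitAI hP); [apply: (Aint_inA hP)|move/(inM_Aint hP Au)].
have My : inM P (y ^+ q - y).
  have -> : y ^+ q - y = (u ^+ q * u)^-1 * (u * ((u * y) ^+ q - u * y) - (u * y) * (u ^+ q - u)).
    have nzu : u != 0 by case: uu.
    have nzuq : u ^+ q != 0 by rewrite expf_neq0.
    by rewrite exprMn; field; rewrite nzu nzuq.
  apply: (inM_Ml hP); first by have [] := unitA_M hP (unitA_X hP q uu) uu.
  by apply/(P_inM hP)/(poB hP); apply: (poMl hP).
apply: (TL LsL); first by apply: (sfdiv hL) => //; exact: (Lp LsL).
exact: (unif LsL).
Qed.

Definition unramified_field : set algC := frac T.

Lemma subfield_unramified_field : subfield unramified_field.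
Proof. exact: subfield_frac. Qed.

Lemma unramified_field_L L z : Ls L -> L z -> unramified_field z.
Proof.
move=> LsL Lz; have hF := subfield_unramified_field.
have [Az|nAz] := pselect (inA P z); first by apply: (sub_frac hT); apply: (TL LsL).
rewrite -[z]invrK; apply: (sfV hF); apply: (sub_frac hT); apply: (TL LsL).
  exact: (sfV (hLs LsL)).
exact/(inM_A hP)/(inA_VM hP).
Qed.

Lemma unramified_field_zeta : unramified_field zeta.
Proof. by apply: (sub_frac hT); apply: sub_ring_gen; left. Qed.

(* The square is needed because l may be ramified in the quadratic field. *)
Lemma unramified_field_val z : unramified_field z -> z != 0 ->
  exists k : int, unitA P (z ^+ 2 / l%:R ^ k).
Proof.
have Tgood y : T y -> exists2 f, (0 < f)%N & good l T p f y.
  by apply: good_gen => //; apply: gen_good.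
move=> Fz nzz; have [k uk] := uniformizer_frac hP hT TA Mp nzp p2 Tgood Fz nzz.
have nzl : l%:R != 0 :> algC by rewrite pnatr_eq0 -lt0n prime_gt0.
have [j [a [u [Ta Tu na nu E]]]] := uniformizer_val hP hT TA Mp nzp p2 Tgood (srnat hT l) nzl.
have ua : unitA P a by apply: (unitAI hP) => //; apply: TA.
have uu : unitA P u by apply: (unitAI hP) => //; apply: TA.
have nza : a != 0 by case: ua.
have nzu : u != 0 by case: uu.
have ulj : unitA P (p ^+ j / l%:R).
  have nzpj : p ^+ j != 0 by rewrite expf_neq0.
  have -> : p ^+ j / l%:R = u / a by apply: (mulIf nzl); rewrite divfK // mulrAC E; field.
  exact: (unitA_div hP).
have nzpk : p ^ k != 0 by rewrite expfz_neq0.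
have zE e : z ^+ 2 / e = (z / p ^ k) ^+ 2 * (p ^ (k * 2) / e).
  by rewrite -exprz_exp -[_ ^ 2]/(_ ^+ 2) expr_div_n mulrA divfK // expf_neq0.
(* l is p^j times a unit. The case j = 0 contradicts l in P, and j > 2 contradicts l dividing p^2;
   for j = 1 the exponent of z^2 is 2 k, for j = 2 it is k. *)
case: j {E} ulj => [|[|[|j]]] ulj.
- case: (unitA_nM hP (unitA_V ulj)); rewrite expr0 mul1r invrK.
  exact/(P_inM hP)/(po_l hP).
- exists (k * 2); rewrite zE; apply: (unitA_M hP); first exact: (unitA_X hP).
  suff -> : p ^ (k * 2) / l%:R ^ (k * 2) = (p ^+ 1 / l%:R) ^ (k * 2) by apply: (unitA_Xz hP).
  by rewrite expr1 expfzMl exprz_inv invr_expz.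
- exists k; rewrite zE; apply: (unitA_M hP); first exact: (unitA_X hP).
  suff -> : p ^ (k * 2) / l%:R ^ k = (p ^+ 2 / l%:R) ^ k by apply: (unitA_Xz hP).
  by rewrite expfzMl exprz_inv invr_expz -[p ^+ 2]/(p ^ 2) exprz_exp [2 * k]mulrC.
- case: (inM1 hP); have -> : 1 = ((p ^+ j.+3 / l%:R)^-1 * (p ^+ 2 / l%:R)) * p ^+ j.+1.
    have nzpj : p ^+ j != 0 by rewrite expf_neq0.
    by rewrite !exprS; field; rewrite nzp nzpj nzl.
  apply: (inM_Ml hP); last exact: (inM_X hP).
  by apply: (inA_M hP) => //; case: ulj.
Qed.
End UnramifiedRing.

(** * Quadratic fields *)

Section Quadratic.
Variables (a : algC) (Qa : a \in Crat) (nQ : sqrtC a \notin Crat).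

Lemma subfield_Qsqrt : subfield (Qsqrt a).
Proof. exact: subfield_smallest. Qed.

Lemma Qsqrt_sqrt : Qsqrt a (sqrtC a).
Proof. by apply: sub_smallest_in. Qed.

Lemma QsqrtP x : Qsqrt a x -> exists p q, [/\ p \in Crat, q \in Crat & x = p + q * sqrtC a].
Proof.
set w := sqrtC a; have w2 : w ^+ 2 = a by apply: sqrtCK.
pose F : set algC := [set x | exists p q, [/\ p \in Crat, q \in Crat & x = p + q * w]].
suff hF : subfield F.
  move=> Ax; apply: (Ax F); split=> // _ ->; exists 0, 1.
  by rewrite add0r mul1r rpred0 rpred1.
split.
- by exists 1, 0; rewrite mul0r addr0 rpred0 rpred1.
- move=> _ _ [p [q [Qp Qq ->]]] [p' [q' [Qp' Qq' ->]]].
  by exists (p - p'), (q - q'); rewrite !rpredB //; split=> //; ring.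
- move=> _ _ [p [q [Qp Qq ->]]] [p' [q' [Qp' Qq' ->]]].
  have [/eqP E|nz] := eqVneq (p' ^+ 2 - q' ^+ 2 * a) 0; last first.
    exists ((p * p' - q * q' * a) / (p' ^+ 2 - q' ^+ 2 * a)), ((q * p' - p * q') / (p' ^+ 2 - q' ^+ 2 * a)).
    rewrite !rpred_div ?rpredB ?rpredM ?rpredX //; split=> //.
    have nz2 : p' + q' * w != 0.
      apply: contra_neq nz => E; rewrite -w2 (_ : _ - _ = (p' + q' * w) * (p' - q' * w)); last by ring.
      by rewrite E mul0r.
    by move: nz; rewrite -w2 => nz; apply: (mulIf nz2); rewrite divfK //; field; rewrite exprMn.
  have q0 : q' = 0.
    apply/eqP; apply: contraNT nQ => nzq; rewrite -/w.
    have : (p' / q') ^+ 2 = w ^+ 2.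
      by apply/eqP; rewrite w2 expr_div_n -subr_eq0 -(mulrI_eq0 _ (mulfI (expf_neq0 2 nzq))) mulrBr mulrCA divff ?expf_neq0 // mulr1.
    move/eqP; rewrite eqf_sqr => /orP[/eqP<-|/eqP E']; first by rewrite rpred_div.
    by rewrite -[w]opprK -E' rpredN rpred_div.
  exists (p / p'), (q / p'); rewrite q0 mul0r addr0 !rpred_div //; split=> //; ring.
Qed.

Lemma Qsqrt_fix (s : Aut) x : s (sqrtC a) = sqrtC a -> Qsqrt a x -> s x = x.
Proof.
by move=> sw /QsqrtP[p [q [Qp Qq ->]]]; rewrite rmorphD rmorphM /= sw !(aut_Crat s).
Qed.

Lemma Qsqrt_stable (s : Aut) x : Qsqrt a x -> Qsqrt a (s x).
Proof.
have hF := subfield_Qsqrt; have sw : Qsqrt a (s (sqrtC a)).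
  have /eqP : s (sqrtC a) ^+ 2 = sqrtC a ^+ 2 by rewrite -rmorphXn sqrtCK aut_Crat.
  have Fw := Qsqrt_sqrt.
  rewrite eqf_sqr => /orP[/eqP E|/eqP E]; rewrite [s _]E; first exact: Fw.
  exact: (sfN hF Fw).
move=> /QsqrtP[p [q [Qp Qq ->]]]; rewrite rmorphD rmorphM /= (aut_Crat s Qp) (aut_Crat s Qq).
by apply: (sfD hF (sfCrat hF Qp)); apply: (sfM hF (sfCrat hF Qq)).
Qed.

Section Conjugation.
Variables (g : Aut) (gw : g (sqrtC a) = - sqrtC a).

Lemma Qsqrt_conjE p q : p \in Crat -> q \in Crat -> g (p + q * sqrtC a) = p - q * sqrtC a.
Proof. by move=> Qp Qq; rewrite rmorphD rmorphM /= gw !(aut_Crat g) // mulrN. Qed.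

Lemma Qsqrt_conjK x : Qsqrt a x -> g (g x) = x.
Proof.
move=> /QsqrtP[p [q [Qp Qq ->]]].
by rewrite Qsqrt_conjE // -mulNr Qsqrt_conjE ?rpredN // mulNr opprK.
Qed.

Lemma Qsqrt_fixed x : Qsqrt a x -> g x = x -> x \in Crat.
Proof.
move=> /QsqrtP[p [q [Qp Qq ->]]]; rewrite Qsqrt_conjE // => /addrI/eqP.
have nw : sqrtC a != 0 by apply: contraNneq nQ => ->; rewrite rpred0.
by rewrite eq_sym -addr_eq0 -mulr2n mulrn_eq0 /= mulf_eq0 (negPf nw) orbF => /eqP->; rewrite mul0r addr0.
Qed.

Lemma Qsqrt_trace x : Qsqrt a x -> x + g x \in Crat.
Proof.
move=> Fx; apply: Qsqrt_fixed.
  by apply: (sfD subfield_Qsqrt) => //; apply: Qsqrt_stable.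
by rewrite rmorphD /= Qsqrt_conjK // addrC.
Qed.

Lemma Qsqrt_norm x : Qsqrt a x -> x * g x \in Crat.
Proof.
move=> Fx; apply: Qsqrt_fixed.
  by apply: (sfM subfield_Qsqrt) => //; apply: Qsqrt_stable.
by rewrite rmorphM /= Qsqrt_conjK // mulrC.
Qed.

Lemma Qsqrt_itrace x : int_ring (Qsqrt a) x -> x + g x \in Num.int.
Proof.
by move=> [Fx Ax]; apply: Cint_rat_Aint; [apply: Qsqrt_trace|rewrite rpredD ?Aint_aut].
Qed.

Lemma Qsqrt_inorm x : int_ring (Qsqrt a) x -> x * g x \in Num.int.
Proof.
by move=> [Fx Ax]; apply: Cint_rat_Aint; [apply: Qsqrt_norm|rewrite rpredM ?Aint_aut].
Qed.

(** Ramification indices in a quadratic field are at most 2. In x^2 = t x - n the norm n is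
    divisible by l; when the trace t is not, g x is a unit at P and x^2 / l = x (n / l) / g x. *)
Lemma Qsqrt_ramification l P x : prime_over l P -> Qsqrt a x -> P x -> inA P (x ^+ 2 / l%:R).
Proof.
move=> hP Fx Px; have Ax := po_Aint hP Px.
have /intrP[t Dt] := Qsqrt_itrace (conj Fx Ax); have /intrP[n Dn] := Qsqrt_inorm (conj Fx Ax).
have E : x ^+ 2 = t%:~R * x - n%:~R by rewrite -Dt -Dn; ring.
have nzl : l%:R != 0 :> algC by rewrite pnatr_eq0 -lt0n (prime_gt0 (po_prime hP)).
have /dvdzP[n' Dn'] : (l %| n)%Z.
  by apply: (po_int hP); rewrite -Dn; apply: (poMr hP) => //; rewrite Aint_aut.
have En : n%:~R = n'%:~R * l%:R :> algC by rewrite Dn' rmorphM.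
have [/dvdzP[t' Dt']|ndt] := boolP (l %| t)%Z.
  have -> : x ^+ 2 / l%:R = t'%:~R * x - n'%:~R.
    by rewrite E En Dt' rmorphM /= -pmulrn; field.
  by apply: (Aint_inA hP); rewrite rpredB ?rpredM ?Aint_int.
have Ag : g x \in Aint by rewrite Aint_aut.
have ug : unitA P (g x).
  apply: (unitAI hP); first exact: (Aint_inA hP).
  move/(inM_Aint hP Ag) => Pg; move/negP: ndt; apply; apply: (po_int hP).
  by rewrite -Dt; apply: (poD hP).
have nzg : g x != 0 by case: ug.
have -> : x ^+ 2 / l%:R = x * n'%:~R * (g x)^-1.
  by apply: (mulIf nzg); apply: (mulIf nzl); rewrite divfK // mulrAC divfK // expr2 -mulrA Dn En mulrA.
by apply: (inA_M hP); [apply: (Aint_inA hP); rewrite rpredM ?Aint_int|case: ug].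
Qed.
End Conjugation.
End Quadratic.

(** * The prime 3 and split primes in quadratic fields *)

Lemma dvdz3_sqr (x : int) : (3 %| x ^+ 2)%Z -> (3 %| x)%Z.
Proof. by rewrite !dvdzE abszX /= (Euclid_dvdX _ 2 (isT : prime 3)) => /andP[]. Qed.

Lemma sqr_mod3 (x : int) : exists a : int, x ^+ 2 = 3 * a \/ x ^+ 2 = 3 * a + 1.
Proof.
have [y [->|[->|->]]] : exists y, x = 3 * y \/ x = 3 * y + 1 \/ x = 3 * y + 2.
  by exists (x %/ 3)%Z; lia.
- by exists (3 * y ^+ 2); left; ring.
- by exists (3 * y ^+ 2 + 2 * y); right; ring.
- by exists (3 * y ^+ 2 + 4 * y + 1); right; ring.
Qed.

(** For e = 2 modulo 3 this rests on squares being 0 or 1 modulo 3, for e = -3 on an odd 3-adic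
    valuation. It yields both the irrationality of sqrt d and the fact that 3 does not split. *)
Lemma sqrfree_mod3 (q : rat) (e m : int) : q ^+ 2 * e%:~R = m%:~R -> (m = 1 %[mod 3])%Z ->
  (e = 2 %[mod 3])%Z \/ e = - 3 -> False.
Proof.
move=> Em m1 he.
have {}Em : numq q ^+ 2 * e = denq q ^+ 2 * m.
  apply: (@intr_inj rat); rewrite !rmorphM /= -Em !numqE.
  by ring.
have cop : coprimez (numq q) (denq q) by rewrite coprimezE coprime_num_den.
have n3 : ~ ((3 %| numq q)%Z /\ (3 %| denq q)%Z).
  move=> [d1 d2]; have : (3 %| gcdz (numq q) (denq q))%Z by rewrite dvdz_gcd d1.
  by move: cop; rewrite /coprimez => /eqP->.
move: (numq q) (denq q) Em n3 => x y Em n3 {cop}.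
have [m' Dm] : exists m', m = 3 * m' + 1 by exists (m %/ 3)%Z; lia.
have dvd3 (z a : int) : z ^+ 2 = 3 * a -> (3 %| z)%Z.
  by move=> Dz; apply: dvdz3_sqr; apply/dvdzP; exists a; rewrite Dz mulrC.
have [a Da] := sqr_mod3 x; have [b Db] := sqr_mod3 y.
case: he => [e2|e3].
  have [e' De] : exists e', e = 3 * e' + 2 by exists (e %/ 3)%Z; lia.
  move: Em; rewrite Dm De; case: Da Db => [Da|Da] [Db|Db]; rewrite Da Db.
  - by move=> _; apply: n3; split; [apply: dvd3 Da|apply: dvd3 Db].
  - rewrite (_ : _ * (3 * e' + 2) = 3 * (a * (3 * e' + 2))); last by ring.
    rewrite (_ : _ * (3 * m' + 1) = 3 * (b * (3 * m' + 1) + m') + 1); last by ring.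
    lia.
  - rewrite (_ : _ * (3 * e' + 2) = 3 * (a * (3 * e' + 2) + e') + 2); last by ring.
    rewrite (_ : _ * (3 * m' + 1) = 3 * (b * (3 * m' + 1))); last by ring.
    lia.
  - rewrite (_ : _ * (3 * e' + 2) = 3 * (a * (3 * e' + 2) + e') + 2); last by ring.
    rewrite (_ : _ * (3 * m' + 1) = 3 * (b * (3 * m' + 1) + m') + 1); last by ring.
    lia.
case: Db => Db; last first.
  move: Em; rewrite Dm e3 Db (_ : _ * (3 * m' + 1) = 3 * (b * (3 * m' + 1) + m') + 1); last by ring.
  lia.
have y3 := dvd3 _ _ Db; apply: n3; split=> //.
case/dvdzP: y3 Em => y1 -> ; rewrite e3 => Em.
apply: (@dvd3 _ (- (y1 ^+ 2 * m))); apply: (@mulIf _ (- 3)) => //.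
by rewrite Em; ring.
Qed.

(** As w is in P and its conjugate is not, l divides the norm of w but not its trace t. Multiplying
    w by an inverse s of t modulo l makes it idempotent modulo l, the form in which the splitting of
    l is used. *)
Lemma split_prime (a : algC) (g : Aut) l P w : a \in Crat -> sqrtC a \notin Crat ->
  g (sqrtC a) = - sqrtC a -> prime_over l P -> int_ring (Qsqrt a) w -> P w -> ~ P (g w) ->
  exists w1 (i j : int), [/\ int_ring (Qsqrt a) w1, w1 \notin Crat
    & w1 ^+ 2 - w1 = l%:R * (i%:~R * w1 + j%:~R)].
Proof.
move=> Qa nQ gw hP Ow Pw nPgw; have pl := po_prime hP.
have [t Dt] := intrP (Qsqrt_itrace Qa nQ gw Ow); have [n Dn] := intrP (Qsqrt_inorm Qa nQ gw Ow).
have [Fw Aw] := Ow; have Agw : g w \in Aint by rewrite Aint_aut.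
have /dvdzP[n' Dn'] : (l %| n)%Z by apply: (po_int hP); rewrite -Dn; apply: (poMr hP).
have ndt : ~~ (l %| t)%Z.
  apply/negP => /(po_dvd hP); rewrite -Dt => Pt; apply: nPgw.
  by rewrite -[g w](addKr w) addrC; apply: (poB hP).
have /eqP cop : coprimez t l by rewrite coprimezE coprime_sym prime_coprime.
have [s [k E]] := Bezoutz t l; rewrite cop in E.
have E1 : s%:~R * t%:~R = 1 - k%:~R * l%:R :> algC.
  have := congr1 (intr : int -> algC) E; rewrite rmorphD !rmorphM /= -pmulrn => E'.
  by rewrite -[LHS](addrK (k%:~R * l%:R)) E'.
have nzs : s%:~R != 0 :> algC.
  rewrite intr_eq0; apply/eqP => s0; move: E; rewrite s0 mul0r add0r => E.
  have : (l %| 1)%Z by apply/dvdzP; exists k; rewrite E.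
  by rewrite dvdzE dvdn1 /= => /eqP l1; rewrite l1 in pl.
have hF := @subfield_Qsqrt a.
have wE : w ^+ 2 = t%:~R * w - n%:~R by rewrite -Dt -Dn; ring.
exists (s%:~R * w), (- k), (- (s ^+ 2 * n')); split.
- by split; [apply: (sfM hF) => //; apply: (sfint hF)|rewrite rpredM ?Aint_int].
- apply/negP => Qw; apply: nPgw; suff -> : g w = w by [].
  by rewrite -[w](mulKf nzs); apply: aut_Crat; rewrite rpredM // rpredV rpred_int.
- rewrite exprMn wE Dn' !rmorphN !rmorphM /= -pmulrn.
  rewrite (_ : _ ^+ 2 * (_ - _) = s%:~R * t%:~R * (s%:~R * w) - s%:~R ^+ 2 * (n'%:~R * l%:R)); last by ring.
  by rewrite E1; ring.
Qed.

(** For l = 3 the discriminant t^2 - 4 n of w would be 1 modulo 3, and it is e times a rational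
    square. *)
Lemma split_prime_neq3 (e : int) (g : Aut) l P w : sqrtC e%:~R \notin Crat ->
  (e = 2 %[mod 3])%Z \/ e = - 3 ->
  g (sqrtC e%:~R) = - sqrtC e%:~R -> prime_over l P ->
  int_ring (Qsqrt e%:~R) w -> P w -> ~ P (g w) -> l != 3.
Proof.
move=> nQ he gw hP Ow Pw nPgw; have Qe : e%:~R \in Crat by rewrite rpred_int.
apply/eqP => l3; rewrite {}l3 in hP.
have [t Dt] := intrP (Qsqrt_itrace Qe nQ gw Ow); have [n Dn] := intrP (Qsqrt_inorm Qe nQ gw Ow).
have [Fw Aw] := Ow; have Agw : g w \in Aint by rewrite Aint_aut.
have n3 : (3 %| n)%Z by apply: (po_int hP); rewrite -Dn; apply: (poMr hP).
have ndt : ~~ (3 %| t)%Z.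
  apply/negP => /(po_dvd hP); rewrite -Dt => Pt; apply: nPgw.
  by rewrite -[g w](addKr w) addrC; apply: (poB hP).
have [p' [q' [Qp /CratP[{}q Dq] {}Dw]]] := QsqrtP Qe nQ Fw.
apply: (@sqrfree_mod3 (2 * q) e (t ^+ 2 - 4 * n)) => //.
  suff E0 : ratr ((2 * q) ^+ 2 * e%:~R) = ratr (t ^+ 2 - 4 * n)%:~R :> algC by apply: fmorph_inj E0.
  have E1 : ratr ((2 * q) ^+ 2 * e%:~R) = (2 * ratr q) ^+ 2 * e%:~R :> algC.
    by rewrite rmorphM rmorphXn rmorphM rmorph_nat rmorph_int.
  have E2 : (t ^+ 2 - 4 * n)%:~R = t%:~R ^+ 2 - 4 * n%:~R :> algC.
    by rewrite rmorphB rmorphXn rmorphM.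
  rewrite E1 -Dq ratr_int E2 -Dt -Dn Dw Qsqrt_conjE //; last by rewrite Dq Crat_rat.
  by have := sqrtCK (e%:~R : algC); move: (sqrtC _) => r <-; ring.
have [b [Db|Db]] := sqr_mod3 t; last by rewrite Db; case/dvdzP: n3 => n' ->; lia.
by case/negP: ndt; apply: dvdz3_sqr; rewrite Db dvdz_mulr.
Qed.

(** A compatible system of 3^n-th roots of unity. Level 1 is explicit, which ties omega to sqrt -3;
    any cube root serves at the higher levels. *)
Fixpoint zroot (n : nat) : algC :=
  match n with
  | 0 => 1
  | 1 => (- 1 + sqrtC (- 3)%:~R) / 2
  | n'.+1 => 3.-root (zroot n')
  end.
Notation omega := (zroot 1).
Notation s3 := (sqrtC (- 3)%:~R : algC).

Lemma s3_sqr : s3 ^+ 2 = - 3. Proof. by rewrite sqrtCK rmorphN. Qed.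

Lemma omegaE : omega ^+ 2 + omega + 1 = 0.
Proof.
rewrite /= (_ : _ + _ + 1 = (s3 ^+ 2 + 3) / 4); last by field.
by rewrite s3_sqr addNr mul0r.
Qed.

Lemma s3_omega : s3 = 2 * omega + 1.
Proof. by rewrite /=; field. Qed.

Lemma omega3 : omega ^+ 3 = 1.
Proof.
have := omegaE; move: omega => w wE; apply/eqP; rewrite -subr_eq0.
by rewrite (_ : _ - 1 = (w - 1) * (w ^+ 2 + w + 1)); [rewrite wE mulr0|ring].
Qed.

Lemma omega_neq1 : omega != 1.
Proof.
by apply/eqP => w1; have /eqP := omegaE; rewrite w1 expr1n (_ : 1 + 1 + 1 = 3); [rewrite pnatr_eq0|ring].
Qed.

Lemma zroot3 n : zroot n.+1 ^+ 3 = zroot n.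
Proof. by case: n => [|n]; [rewrite omega3|apply: rootCK]. Qed.

Lemma zrootX n k : zroot (n + k) ^+ (3 ^ k) = zroot n.
Proof.
elim: k => [|k IHk]; first by rewrite addn0 expr1.
by rewrite addnS expnS exprM zroot3.
Qed.

Lemma zroot_prim n : (3 ^ n).-primitive_root (zroot n).
Proof.
case: n => [|n]; first by apply/andP; split=> //; apply/forallP => i; rewrite (ord1 i) unity_rootE expr1 eqxx.
have E : zroot n.+1 ^+ (3 ^ n) = omega by rewrite -add1n zrootX.
have E3 : zroot n.+1 ^+ (3 ^ n.+1) = 1 by rewrite expnSr exprM E omega3.
have [m pm /(dvdn_pfactor _ _ (isT : prime 3))[k le_k Dm]] := prim_order_exists (expn_gt0 3 n.+1) E3.
move: le_k; rewrite leq_eqVlt ltnS => /orP[/eqP Ek|le_k]; first by rewrite Ek in Dm; rewrite -Dm.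
case/negP: omega_neq1; rewrite -E -(prim_order_dvd pm) Dm.
exact: dvdn_exp2l.
Qed.

Lemma zroot_neq0 n : zroot n != 0.
Proof.
apply/eqP => z0; have := prim_expr_order (zroot_prim n).
by rewrite z0 expr0n expn_eq0 /= => /eqP; rewrite eq_sym oner_eq0.
Qed.

Lemma zroot_Aint n : zroot n \in Aint.
Proof. exact: Aint_prim_root (zroot_prim n). Qed.

Lemma aut_zroot (s : Aut) n : exists a, s (zroot n) = zroot n ^+ a.
Proof.
have [|a ->] := prim_rootP (zroot_prim n) (x := s (zroot n)); last by exists a.
by rewrite -rmorphXn (prim_expr_order (zroot_prim n)) rmorph1.
Qed.

Lemma aut_zroot_le (s : Aut) n m : (m <= n)%N -> s (zroot n) = zroot n -> s (zroot m) = zroot m.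
Proof. by move=> le sz; rewrite -(zrootX m (n - m)) subnKC // rmorphXn /= sz. Qed.

(** * Kummer theory of characters of 3-power order *)

Lemma subfield_preim (s : Aut) F : subfield F -> subfield [set x | F (s x)].
Proof.
move=> hF; split=> /= [|x y Fx Fy|x y Fx Fy]; first by rewrite rmorph1; apply: (sf1 hF).
  by rewrite rmorphB; apply: (sfB hF).
by rewrite fmorph_div; apply: (sfdiv hF).
Qed.

(* The Lagrange resolvent [\sum_z chi(s_z)^-1 z^j] over the conjugates [z = s_z y]. *)
Lemma resolvent_exists (G G' : Aut -> Prop) (chi : Aut -> algC) y :
  G aid -> (forall s t, G s -> G t -> G (acomp s t)) -> (forall s, G s -> G (ainv s)) ->
  (forall s, G' s -> G s) ->
  (forall s t, G s -> G t -> chi (acomp s t) = chi s * chi t) ->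
  (forall s, G s -> chi s != 0) -> (forall s, G s -> s y = y -> chi s = 1) ->
  (forall t s, G' t -> G s -> t (chi s) = chi s) ->
  exists R, [/\ R != 0, forall t, G' t -> t R = chi t * R
    & forall F, subfield F -> (forall s, G s -> F (s y)) -> (forall s, G s -> F (chi s)) -> F R].
Proof.
move=> G1 GM GV G'G chiM nzchi chiy chifix.
have chi1 : chi aid = 1 by apply: chiy.
have agree s t : G s -> G t -> s y = t y -> chi s = chi t.
  move=> Gs Gt Est; have Gi := GV _ Gt.
  have E1 : chi (ainv t) * chi s = 1 by rewrite -chiM //; apply: chiy; [apply: GM|rewrite acompE Est ainvKl].
  have E2 : chi (ainv t) * chi t = 1 by rewrite -chiM //; apply: chiy; [apply: GM|rewrite acompE ainvKl].
  by apply: (mulfI (nzchi _ Gi)); rewrite E1.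
have [rs Drs] := closed_field_poly_normal (minCpoly y).
rewrite (monicP (minCpoly_monic y)) scale1r in Drs.
pose Y := undup [seq z <- rs | `[< exists2 s, G s & s y = z >]].
have memY z : z \in Y <-> exists2 s : Aut, G s & s y = z.
  rewrite mem_undup mem_filter; split=> [/andP[/asboolP]//|ex].
  apply/andP; split; first exact/asboolP.
  case: ex => s _ <-; rewrite -root_prod_XsubC -Drs.
  by rewrite -(minCpoly_aut s) root_minCpoly.
pose sg z : Aut := if pselect (exists2 s : Aut, G s & s y = z) is left e then projT1 (cid2 e) else aid.
have sgP z : z \in Y -> G (sg z) /\ sg z y = z.
  by move=> /memY ez; rewrite /sg; case: pselect => // e; case: (cid2 e).
pose e z := (chi (sg z))^-1.
have Yy : y \in Y by apply/memY; exists aid.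
pose R j := \sum_(z <- Y) e z * z ^+ j.
have Gt t : G' t -> perm_eq (map t Y) Y.
  move=> G't; have uY : uniq (map t Y) by rewrite map_inj_uniq ?undup_uniq //; apply: fmorph_inj.
  apply: uniq_perm; rewrite ?undup_uniq //.
  have sY : {subset map t Y <= Y}.
    move=> _ /mapP[_ /memY[s Gs <-] ->]; apply/memY; exists (acomp t s) => //.
    by apply: GM => //; apply: G'G.
  by have [] := uniq_min_size uY sY _; rewrite ?size_map.
have Req j t : G' t -> t (R j) = chi t * R j.
  move=> G't; have Gt' := G'G _ G't; rewrite /R rmorph_sum -[in RHS](perm_big _ (Gt _ G't)) big_map mulr_sumr.
  rewrite !big_seq; apply: eq_bigr => z Yz; have [Gs sz] := sgP _ Yz.
  have Ytz : t z \in Y by apply/memY; exists (acomp t (sg z)); [apply: GM|rewrite acompE sz].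
  have [Gs' sz'] := sgP _ Ytz.
  rewrite rmorphM rmorphXn mulrA; congr (_ * _); rewrite /e fmorphV chifix //.
  have <- : chi (acomp t (sg z)) = chi (sg (t z)) by apply: agree; rewrite ?acompE ?sz ?sz' //; apply: GM.
  by rewrite chiM // invfM mulrA divff ?mul1r // nzchi.
(* If every R j vanished, the weights [e z] would annihilate the values of any polynomial on the
   orbit; a polynomial vanishing on all of Y except y contradicts this. *)
have [j nzR] : exists j, R j != 0.
  apply: contrapT => nex; have R0 j : R j = 0.
    by apply/eqP; apply: contrapT => /negP nz; apply: nex; exists j.
  pose p := \prod_(z <- rem y Y) ('X - z%:P).
  have : \sum_(z <- Y) e z * p.[z] = 0.
    under eq_bigr do rewrite horner_coef mulr_sumr.
    rewrite exchange_big /= big1 // => i _.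
    rewrite (eq_bigr (fun z => p`_i * (e z * z ^+ i))) => [|z _]; last by rewrite mulrCA.
    by rewrite -mulr_sumr [X in _ * X](R0 i) mulr0.
  rewrite (perm_big _ (perm_to_rem Yy)) big_cons /= big_seq big1 => [|z zr]; last first.
    suff /eqP -> : root p z by rewrite mulr0.
    by rewrite root_prod_XsubC.
  rewrite addr0 => /eqP; rewrite mulf_eq0 invr_eq0 (negPf (nzchi _ (sgP _ Yy).1)) /=.
  have := rem_filter y (undup_uniq _ : uniq Y) => remE.
  by rewrite -rootE root_prod_XsubC remE mem_filter /= eqxx.
exists (R j); split=> // [t|F hF Fy Fchi]; first exact: Req.
rewrite /R big_seq; apply: (sfsum hF) => z Yz; have [Gs sz] := sgP _ Yz.
apply: (sfM hF); first exact/(sfV hF)/Fchi.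
by apply: (sfX hF); rewrite -sz; apply: Fy.
Qed.

Section Characters.
Variable (d : int).
Local Notation sD := (sqrtC (- 3 * d)%:~R : algC).

Definition GK (s : Aut) : Prop := s sD = sD.
Definition GN (n : nat) (s : Aut) : Prop := GK s /\ s (zroot n) = zroot n.

Lemma GK_id : GK aid. Proof. by []. Qed.
Lemma GK_comp s t : GK s -> GK t -> GK (acomp s t).
Proof. by move=> Gs Gt; rewrite /GK acompE Gt Gs. Qed.
Lemma GK_inv s : GK s -> GK (ainv s).
Proof. by move=> Gs; rewrite /GK -{1}Gs ainvKl. Qed.
Lemma GN_GK n s : GN n s -> GK s. Proof. by case. Qed.
Lemma GN_le n m s : (m <= n)%N -> GN n s -> GN m s.
Proof. by move=> le [Gs sz]; split=> //; apply: aut_zroot_le sz. Qed.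

(* Characters are functions on automorphisms of algC, only meaningful on [GK]; *)
(* the last clause makes them continuous.                                     *)
Record gchar (chi : Aut -> algC) (n : nat) (S : seq algC) : Prop := GChar {
  gcM : forall s t, GK s -> GK t -> chi (acomp s t) = chi s * chi t;
  gcX : forall s, GK s -> chi s ^+ (3 ^ n) = 1;
  gcS : forall s, GK s -> (forall x, x \in S -> s x = x) -> chi s = 1 }.

Lemma gc_neq0 chi n S s : gchar chi n S -> GK s -> chi s != 0.
Proof.
move=> h Gs; apply/eqP => c0; have := gcX h Gs.
by rewrite c0 expr0n expn_eq0 /= => /eqP; rewrite eq_sym oner_eq0.
Qed.

Lemma gc_zroot chi n S s : gchar chi n S -> GK s -> exists a, chi s = zroot n ^+ a.
Proof. by move=> h Gs; have [a ->] := prim_rootP (zroot_prim n) (gcX h Gs); exists a. Qed.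

Lemma gc_inv chi n S s : gchar chi n S -> GK s -> chi (ainv s) = (chi s)^-1.
Proof.
move=> h Gs; have Gi := GK_inv Gs; apply: (mulfI (gc_neq0 h Gs)).
rewrite -(gcM h) // divff ?(gc_neq0 h Gs) //; apply: (gcS h) => [|x _]; first exact: GK_comp.
exact: ainvK.
Qed.

Lemma gcharM chi psi n m S T : gchar chi n S -> gchar psi m T ->
  gchar (fun s => chi s * psi s) (maxn n m) (S ++ T).
Proof.
move=> h k; split=> [s t Gs Gt|s Gs|s Gs fix_s].
- by rewrite (gcM h) // (gcM k) //; ring.
- rewrite exprMn -{1}(subnKC (leq_maxl n m)) -(subnKC (leq_maxr n m)) !expnD !exprM.
  by rewrite (gcX h) // (gcX k) // !expr1n mulr1.
- rewrite (gcS h) // ?(gcS k) ?mulr1 // => x Sx; apply: fix_s; rewrite mem_cat Sx ?orbT //.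
Qed.

Lemma gchar_exponent chi n m S : gchar chi n S ->
  (forall s, GK s -> chi s ^+ (3 ^ m) = 1) -> gchar chi m S.
Proof. by case=> hM _ hS hX; split. Qed.

Lemma gcharX chi n S k : gchar chi n S -> gchar (fun s => chi s ^+ k) n S.
Proof.
move=> h; split=> [s t Gs Gt|s Gs|s Gs fix_s].
- by rewrite (gcM h) // exprMn.
- by rewrite exprAC (gcX h) // expr1n.
- by rewrite (gcS h) // expr1n.
Qed.

Definition kummer (N : nat) (chi : Aut -> algC) (R : algC) : Prop :=
  R != 0 /\ forall s, GN N s -> s R = chi s * R.

(** The last clause allows R to be taken inside an unramified compositum when the character comes
    from H. *)
Lemma kummer_exists chi n S N : gchar chi n S -> (n <= N)%N ->
  exists R, kummer N chi R /\ forall F, subfield F ->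
    (forall s x, GK s -> x \in S -> F (s x)) -> F (zroot n) -> F R.
Proof.
move=> h le; have [y [Fy yS]] := primitive_element S.
have [|||||||t s [Gt tz] Gs|R [nzR tR FR]] := @resolvent_exists GK (GN N) chi y.
- exact: GK_id.
- exact: GK_comp.
- exact: GK_inv.
- exact: GN_GK.
- exact: (gcM h).
- by move=> s; apply: (gc_neq0 h).
- by move=> s Gs sy; apply: (gcS h) => // x /yS[p ->]; rewrite aut_ratpoly sy.
- by have [a ->] := gc_zroot h Gs; rewrite rmorphXn /= (aut_zroot_le le tz).
exists R; split=> // F hF FS Fz; apply: (FR F hF) => s Gs.
  by apply: (Fy _ (subfield_preim s hF)) => x Sx; apply: FS.
by have [a ->] := gc_zroot h Gs; apply: (sfX hF).
Qed.

Lemma kummerM N chi psi R R' : kummer N chi R -> kummer N psi R' ->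
  kummer N (fun s => chi s * psi s) (R * R').
Proof.
move=> [nzR sR] [nzR' sR']; split; first by rewrite mulf_neq0.
by move=> s Gs; rewrite rmorphM /= sR // sR' //; ring.
Qed.

Lemma kummerX N chi R k : kummer N chi R -> kummer N (fun s => chi s ^+ k) (R ^+ k).
Proof.
move=> [nzR sR]; split; first by rewrite expf_neq0.
by move=> s Gs; rewrite rmorphXn /= sR // exprMn.
Qed.

Lemma kummer_le M N chi R : (M <= N)%N -> kummer M chi R -> kummer N chi R.
Proof. by move=> le [nzR sR]; split=> // s /(GN_le le); apply: sR. Qed.

Lemma kummer_ext N chi psi R : (forall s, GK s -> chi s = psi s) -> kummer N chi R -> kummer N psi R.
Proof. by move=> E [nzR sR]; split=> // s Gs; rewrite sR // E //; case: Gs. Qed.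

Lemma GN_fixed F N x : subfield F -> F sD -> F (zroot N) ->
  (forall s, GN N s -> s x = x) -> F x.
Proof.
move=> hF FD Fz fixx; apply: (@galois_fixed F [:: sD; zroot N]) => // [a|t tS].
  by rewrite !inE => /orP[]/eqP->.
by apply: fixx; split; apply: tS; rewrite !inE eqxx ?orbT.
Qed.

Lemma kummer_uniq F N chi R R' : subfield F -> F sD -> F (zroot N) ->
  (forall s, GK s -> chi s != 0) -> kummer N chi R -> kummer N chi R' -> F (R / R').
Proof.
move=> hF FD Fz nzc [nzR sR] [nzR' sR']; apply: GN_fixed Fz _ => // s Gs.
have nz := nzc s (GN_GK Gs).
by rewrite fmorph_div /= sR // sR' //; field; rewrite nz nzR'.
Qed.

Lemma GN1_sqr s : GK s -> GN 1 (acomp s s).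
Proof.
move=> Gs; split; first exact: GK_comp.
have : s s3 ^+ 2 = s3 ^+ 2 by rewrite -rmorphXn s3_sqr rmorphN rmorph_nat.
move/eqP; rewrite eqf_sqr => E; have ss : s (s s3) = s3.
  by case/orP: E => /eqP E; rewrite !E // rmorphN /= E opprK.
have -> : zroot 1 = (- 1 + s3) / 2 by [].
by rewrite acompE !(fmorph_div, rmorphD, rmorphN, rmorph1, rmorph_nat) /= ss.
Qed.

(** K(omega) has degree at most 2 over K, which is prime to 3. *)
Lemma cubic_trivial chi S : gchar chi 1 S -> (forall s, GN 1 s -> chi s = 1) ->
  forall s, GK s -> chi s = 1.
Proof.
move=> h triv s Gs; have := triv _ (GN1_sqr Gs); rewrite (gcM h) // -expr2 => E2.
by have := gcX h Gs; rewrite expn1 exprS E2 mulr1.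
Qed.

End Characters.

Lemma prime_over_exists l : prime l -> exists P, prime_over l P.
Proof.
move=> pl; pose I : set algC := [set x | exists2 y, y \in Aint & x = l%:R * y].
have nzl : l%:R != 0 :> algC by rewrite pnatr_eq0 -lt0n prime_gt0.
have [|||||||l' [P [hP IP]]] := @subring_ideal_prime [set x | x \in Aint] I.
- exact: subring_Aint.
- by [].
- by move=> _ [y Ay ->] /=; rewrite rpredM ?rpred_nat.
- by move=> _ _ [x Ax ->] [y Ay ->]; exists (x + y); rewrite ?rpredD ?mulrDr.
- by move=> a _ Aa [x Ax ->]; exists (a * x); [rewrite rpredM|rewrite mulrCA].
- move=> [y Ay Ey]; have Dy : y = (l%:R)^-1 by apply: (mulfI nzl); rewrite -Ey divff.
  have Qy : y \in Crat by rewrite Dy rpredV rpred_nat.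
  have /intrP[m Dm] := Cint_rat_Aint Qy Ay.
  have /(@intr_inj algC) : (1 : int)%:~R = (l%:Z * m)%:~R :> algC by rewrite rmorphM /= -Dm -pmulrn -Ey.
  move=> E; have : (l %| 1)%Z by apply/dvdzP; exists m; rewrite mulrC -E.
  by rewrite dvdzE dvdn1 /= => /eqP l1; rewrite l1 in pl.
- by exists l%:R => //; exists 1; rewrite ?rpred1 ?mulr1.
exists P; have -> // : l = l'.
have Pl : P l%:R by apply: IP; exists 1; rewrite ?rpred1 ?mulr1.
have := po_int hP (m := l) Pl; rewrite dvdzE /= dvdn_prime2 ?(po_prime hP) //.
by move/eqP.
Qed.

Lemma Aint_denominator x : exists2 m : int, m != 0 & m%:~R * x \in Aint.
Proof.
have [P hP] := prime_over_exists (isT : prime 2).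
have [b [Ab Abx nP _]] := local_denominator hP x.
have nzb : b != 0.
  by apply/eqP => b0; apply: nP; rewrite b0 mul0r; split; apply: (po0 hP).
have [m nzm [v Av Dm]] := Aint_dvd_int Ab nzb.
by exists m => //; rewrite Dm -mulrA rpredM.
Qed.

(** * Descent of Kummer generators to a quadratic field *)

Section Descent.
Variables (d : int) (a : algC) (g tau : Aut) (chi : Aut -> algC).
Local Notation sD := (sqrtC (- 3 * d)%:~R : algC).
Hypotheses (nzD : sD != 0) (tauD : tau sD = - sD).
Hypothesis ka : forall x, (forall s, GN d 1 s -> s x = x) -> tau x = x -> Qsqrt a x.
Hypothesis tau_a : forall x, Qsqrt a x -> tau x = x.
Hypothesis g_a : forall x, Qsqrt a x -> Qsqrt a (g x).
Hypothesis chi3 : forall s, GN d 1 s -> chi s ^+ 3 = 1.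
Hypothesis tauR : forall R, kummer d 1 chi R -> forall s, GN d 1 s -> s (tau R) = chi s * tau R.
Hypothesis gR : forall R, kummer d 1 chi R -> forall s, GN d 1 s -> s (g R) = (chi s)^-1 * g R.
Hypothesis tau2 : GN d 1 (acomp tau tau).
Hypothesis tau_chi : tau (chi (acomp tau tau)) = chi (acomp tau tau).
Hypothesis tauN : forall s, GN d 1 s -> GN d 1 (acomp (ainv tau) (acomp s tau)).

(** One form for both signs of complex conjugation. [tau] acts on K(omega) with fixed field Q(sqrt
    a) and preserves the line of Kummer generators of chi, while [g] carries it to the line of the
    inverse character. So r = R (g R) lies in K(omega), with its cube in Q(sqrt a). *)
Lemma kummer_descent R1 : kummer d 1 chi R1 ->
  exists R n, [/\ kummer d 1 chi R, R ^+ 3 \in Aint, Qsqrt a (R ^+ 3), Qsqrt a n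
    & n ^+ 3 = R ^+ 3 * g (R ^+ 3)].
Proof.
move=> kR1; have [nzR1 sR1] := kR1; set lam := chi (acomp tau tau).
have lam3 : lam ^+ 3 = 1 by apply: chi3.
have tlam : tau lam = lam by apply: tau_chi.
have nzlam : lam != 0 by apply/eqP => l0; have /eqP := lam3; rewrite l0 expr0n /= eq_sym oner_eq0.
have tt : tau (tau R1) = lam * R1 by rewrite -acompE sR1.
have ttD : tau (tau sD) = sD by rewrite -acompE; case: tau2.
(* tau^2 acts on R1 by lam, so lam^2 is the eigenvalue to aim at: its square is lam and its cube is
   1, which puts R2^3 in Q(sqrt a). If the projection R1 + lam tau(R1) vanishes, the opposite one
   times sD works, as tau changes the sign of sD. *)
have [R2 [nzR2 sR2 tR2]] : exists R2, [/\ R2 != 0, forall s, GN d 1 s -> s R2 = chi s * R2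
    & tau R2 = lam ^+ 2 * R2].
  have lam4 : lam ^+ 4 = lam by rewrite exprSr lam3 mul1r.
  have slam s : GN d 1 s -> s lam = lam.
    have [k ->] := prim_rootP (zroot_prim 1) (lam3 : lam ^+ (3 ^ 1) = 1).
    by case=> _ sz; rewrite rmorphXn /= -/omega sz.
  have [E|nz] := eqVneq (R1 + lam * tau R1) 0.
    exists (sD * (R1 - lam * tau R1)); split.
    - rewrite mulf_neq0 //; apply/eqP => E'; case/eqP: nzR1.
      have : R1 *+ 2 = (R1 + lam * tau R1) + (R1 - lam * tau R1) by ring.
      by rewrite E E' addr0 => /eqP; rewrite mulrn_eq0 => /eqP.
    - move=> s Gs; have sDs : s sD = sD by case: Gs.
      by rewrite (rmorphM s) (rmorphB s) (rmorphM s) /= sDs (sR1 _ Gs) (tauR kR1 Gs) (slam _ Gs); ring.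
    - rewrite (rmorphM tau) (rmorphB tau) (rmorphM tau) /= tauD tlam tt.
      by transitivity (sD * (lam ^+ 2 * R1 - lam ^+ 3 * tau R1)); [rewrite lam3|]; ring.
  exists (R1 + lam * tau R1); split=> // [s Gs|].
    by rewrite rmorphD rmorphM /= (sR1 _ Gs) (tauR kR1 Gs) (slam _ Gs); ring.
  rewrite rmorphD rmorphM /= tlam tt.
  by transitivity (lam ^+ 3 * tau R1 + lam ^+ 2 * R1); [rewrite lam3|]; ring.
(* A rational integer clears the denominator without disturbing the eigenvalues. *)
have [m nzm AR] := Aint_denominator R2; set R := m%:~R * R2 in AR.
have kR : kummer d 1 chi R.
  split; first by rewrite mulf_neq0 ?intr_eq0.
  by move=> s Gs; rewrite rmorphM rmorph_int /= sR2 // mulrCA.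
have tR : tau R = lam ^+ 2 * R by rewrite rmorphM rmorph_int /= tR2 mulrCA.
have [nzR sR] := kR.
have Fa : Qsqrt a (R ^+ 3).
  apply: ka => [s Gs|]; first by rewrite rmorphXn /= sR // exprMn chi3 // mul1r.
  by rewrite rmorphXn /= tR exprMn exprAC lam3 expr1n mul1r.
set r := R * g R; have nzr : r != 0 by rewrite mulf_neq0 ?fmorph_eq0.
have sr s : GN d 1 s -> s r = r.
  move=> Gs; rewrite rmorphM /= sR // gR //.
  have nzc : chi s != 0 by apply/eqP => c0; have /eqP := chi3 Gs; rewrite c0 expr0n /= eq_sym oner_eq0.
  by rewrite /r; field.
have r3 : r ^+ 3 = R ^+ 3 * g (R ^+ 3) by rewrite exprMn rmorphXn.
have tr3 : (tau r) ^+ 3 = r ^+ 3.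
  by rewrite -rmorphXn /= r3 rmorphM /= !tau_a //; apply: g_a.
have ttr : tau (tau r) = r by rewrite -acompE sr.
have str s : GN d 1 s -> s (tau r) = tau r.
  by move=> Gs; rewrite -[LHS](ainvK tau) -[ainv tau _]/(acomp (ainv tau) (acomp s tau) r) sr //; apply: tauN.
have nztr : tau r != 0 by rewrite fmorph_eq0.
(* r and tau r have the same cube; this combination is fixed by tau and keeps that cube. *)
exists R, ((tau r) ^+ 2 / r); split=> //.
- by rewrite rpredX.
- apply: ka => [s Gs|]; first by rewrite fmorph_div rmorphXn /= (str _ Gs) (sr _ Gs).
  rewrite fmorph_div rmorphXn /= ttr; apply: (mulIf nzr); rewrite divfK //.
  by apply: (mulIf nztr); rewrite mulrAC divfK // -exprSr -exprSr tr3.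
- by rewrite expr_div_n -exprM mulnC exprM tr3 -r3 -[_ ^+ 2 in LHS]/(_ * _) mulfK // expf_neq0.
Qed.
End Descent.

Lemma conj_root_unity (x : algC) n : (0 < n)%N -> x ^+ n = 1 -> x^* = x^-1.
Proof.
move=> n0 xn; have : `|x| ^+ n = 1 by rewrite -normrX xn normr1.
by move/eqP; rewrite pexpr_eq1 // => /eqP x1; rewrite invC_norm x1 expr1n invr1 mul1r.
Qed.

Lemma aut_sqrt_int (s : Aut) (m : int) :
  s (sqrtC m%:~R) = sqrtC m%:~R \/ s (sqrtC m%:~R) = - sqrtC m%:~R.
Proof.
have /eqP : s (sqrtC m%:~R) ^+ 2 = sqrtC m%:~R ^+ 2 by rewrite -rmorphXn sqrtCK rmorph_int.
by rewrite eqf_sqr => /orP[]/eqP ->; [left|right].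
Qed.

Lemma conj_sqrt_neg (m : int) : m < 0 -> (sqrtC m%:~R : algC)^* = - sqrtC m%:~R.
Proof.
move=> m0; case: (aut_sqrt_int aconj m) => // E.
have : (sqrtC m%:~R : algC) \is Num.real by apply/CrealP.
by rewrite realEsqr sqrtCK ler0z leNgt m0.
Qed.

Lemma conj_sqrt_pos (m : int) : 0 < m -> (sqrtC m%:~R : algC)^* = sqrtC m%:~R.
Proof. by move=> m0; apply/CrealP/ger0_real; rewrite sqrtC_ge0 ler0z ltW. Qed.

(** * The biquadratic field Q(sqrt d, sqrt -3) *)

Section RealMirror.
Variables (d : int) (d_gt0 : 0 < d) (d_mod : (d = 2 %[mod 3])%Z).
Local Notation sD := (sqrtC (- 3 * d)%:~R : algC).
Local Notation sd := (sqrtC d%:~R : algC).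

Lemma sd_irrational : sd \notin Crat.
Proof.
apply/negP => /CratP[q Dq]; have E : ratr (q ^+ 2) = d%:~R :> algC by rewrite rmorphXn /= -Dq sqrtCK.
have E2 : ratr (q ^+ 2) = ratr d%:~R :> algC by rewrite E ratr_int.
have Eq : q ^+ 2 = d%:~R by apply: fmorph_inj E2.
have nzd : d%:~R != 0 :> rat by rewrite intr_eq0 gt_eqF.
apply: (@sqrfree_mod3 q^-1 d 1) => //; last by left.
by rewrite exprVn Eq mulVf.
Qed.

Lemma sqrt_neg_irrational (m : int) : m < 0 -> (sqrtC m%:~R : algC) \notin Crat.
Proof.
move=> m0; apply/negP => /conj_Crat; rewrite conj_sqrt_neg // => /eqP.
rewrite eq_sym -addr_eq0 -mulr2n mulrn_eq0 /= sqrtC_eq0 intr_eq0 => /eqP E.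
by rewrite E in m0.
Qed.

Lemma D_lt0 : - 3 * d < 0 :> int. Proof. by clear d_mod; lia. Qed.

Lemma sD_neq0 : sD != 0. Proof. by rewrite sqrtC_eq0 intr_eq0 lt_eqF // D_lt0. Qed.
Lemma s3_neq0 : s3 != 0. Proof. by rewrite sqrtC_eq0 intr_eq0. Qed.

Lemma sD_prod : sD = sd * s3 \/ sD = - (sd * s3).
Proof.
have /eqP : sD ^+ 2 = (sd * s3) ^+ 2 by rewrite exprMn !sqrtCK rmorphM mulrC.
by rewrite eqf_sqr => /orP[]/eqP; [left|right].
Qed.

Lemma aconj_sD : aconj sD = - sD. Proof. exact: (conj_sqrt_neg D_lt0). Qed.
Lemma aconj_sd : aconj sd = sd. Proof. exact: conj_sqrt_pos. Qed.
Lemma aconj_s3 : aconj s3 = - s3. Proof. exact: conj_sqrt_neg. Qed.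

Lemma aut_sD_prod (s : Aut) : s sD = sD <-> s sd * s s3 = sd * s3.
Proof.
by case: sD_prod => ->; rewrite ?rmorphN rmorphM /=; split=> // [/oppr_inj|->].
Qed.

(** sD is not in Q(sqrt -3): as complex conjugation changes its sign, it would be a rational
    multiple of sqrt -3, and sqrt d would be rational. *)
Lemma flip_exists : exists h : Aut, [/\ h s3 = s3, h sD = - sD & h sd = - sd].
Proof.
have [h [h3 hD]] : exists h : Aut, h s3 = s3 /\ h sD <> sD.
  apply: contrapT => nex; have Q3 : Qsqrt (- 3)%:~R sD.
    apply: (@galois_fixed _ [:: s3]) => [|b|t ts]; first exact: subfield_Qsqrt.
      by rewrite inE => /eqP->; apply: Qsqrt_sqrt.
    apply: contrapT => tD; apply: nex; exists t; split=> //.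
    by apply: ts; rewrite inE.
  have [p [q [Qp Qq E]]] := QsqrtP (rpred_int _ _) (sqrt_neg_irrational (isT : - 3 < 0 :> int)) Q3.
  have cE : - sD = p - q * s3.
    by rewrite -(conj_sqrt_neg D_lt0) E rmorphD rmorphM /= (conj_sqrt_neg (isT : - 3 < 0 :> int)) !conj_Crat // mulrN.
  have Dq : sD = q * s3.
    have -> : sD = (sD - - sD) / 2 by field.
    by rewrite cE [X in X - _]E; field.
  case/negP: sd_irrational; case: sD_prod => E'.
    have E1 : q * s3 = sd * s3 by rewrite -Dq.
    by rewrite -(mulIf s3_neq0 E1).
  have E1 : q * s3 = - sd * s3 by rewrite -Dq E' mulNr.
  by rewrite -rpredN -(mulIf s3_neq0 E1).
have {}hD : h sD = - sD by case: (aut_sqrt_int h (- 3 * d)).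
exists h; split=> //; case: (aut_sqrt_int h d) => // E.
have : h sD = sD by apply/aut_sD_prod; rewrite [h sd]E [h s3]h3.
move=> E'; move: hD; rewrite E' => /eqP; rewrite -addr_eq0 -mulr2n mulrn_eq0 /=.
by rewrite (negPf sD_neq0).
Qed.

Lemma GN1P s : GN d 1 s <-> s sD = sD /\ s s3 = s3.
Proof.
split=> [[sDs sz]|[sDs ss]]; split=> //.
  by rewrite s3_omega rmorphD rmorphM rmorph1 rmorph_nat /= sz.
rewrite (_ : zroot 1 = (- 1 + s3) / 2) //.
by rewrite fmorph_div rmorphD rmorphN rmorph1 rmorph_nat /= ss.
Qed.

Lemma GN_conjugate N (t s : Aut) : GN d N s -> GN d N (acomp (ainv t) (acomp s t)).
Proof.
move=> [sDs sz]; split.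
  rewrite /GK !acompE; have -> : s (t sD) = t sD by case: (aut_sqrt_int t (- 3 * d)) => ->; rewrite ?rmorphN [s _]sDs.
  exact: ainvKl.
rewrite !acompE; have -> : s (t (zroot N)) = t (zroot N).
  by have [b ->] := aut_zroot t N; rewrite rmorphXn [s _]sz.
exact: ainvKl.
Qed.

Lemma GK_conjugate (t s : Aut) : GK d s -> GK d (acomp (ainv t) (acomp s t)).
Proof.
move=> sDs; rewrite /GK !acompE.
have -> : s (t sD) = t sD by case: (aut_sqrt_int t (- 3 * d)) => ->; rewrite ?rmorphN [s _]sDs.
exact: ainvKl.
Qed.

Lemma gc_eq chi n S s t : gchar d chi n S -> GK d s -> GK d t -> (forall x, s x = t x) -> chi s = chi t.
Proof.
move=> h Gs Gt Est; have Gi := GK_inv Gt; apply: (mulfI (gc_neq0 h Gi)).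
rewrite -!(gcM h) // !(gcS h) //; try exact: GK_comp.
  by move=> x _; rewrite acompE ainvKl.
by move=> x _; rewrite acompE Est ainvKl.
Qed.

Lemma gc_conjugate chi n S s t : gchar d chi n S -> GK d s -> GK d t ->
  chi (acomp (ainv t) (acomp s t)) = chi s.
Proof.
move=> h Gs Gt; have Gst := GK_comp Gs Gt; have Gi := GK_inv Gt.
by rewrite (gcM h Gi Gst) (gcM h Gs Gt) (gc_inv h Gt) [chi s * _]mulrC mulKf ?(gc_neq0 h).
Qed.

Definition cconj (s : Aut) : Aut := acomp aconj (acomp s aconj).

Lemma cconjE s x : cconj s x = (s x^*)^*. Proof. by []. Qed.

Lemma GK_cconj s : GK d s -> GK d (cconj s).
Proof.
have cD := conj_sqrt_neg D_lt0; move=> Gs; have E : s sD^* = sD^* by rewrite cD (rmorphN s) [s _]Gs.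
by rewrite /GK cconjE E conjCK.
Qed.

Lemma GN_cconj N s : GN d N s -> GN d N (cconj s).
Proof.
move=> Gs; split; first exact/GK_cconj/(GN_GK Gs).
have [b E] := aut_zroot aconj N; rewrite cconjE -aconjE E rmorphXn /= (proj2 Gs) -E.
exact: conjCK.
Qed.

Lemma gc_val_conj chi n S s : gchar d chi n S -> GK d s -> (chi s)^* = (chi s)^-1.
Proof. by move=> h Gs; apply: (@conj_root_unity _ (3 ^ n)); rewrite ?expn_gt0 ?(gcX h). Qed.

Lemma aconjK x : aconj (aconj x) = x. Proof. exact: conjCK. Qed.

Lemma aut_omega_id (t : Aut) x : t s3 = s3 -> x ^+ 3 = 1 -> t x = x.
Proof.
move=> t3 x3; have [k ->] := prim_rootP (zroot_prim 1) (x3 : x ^+ (3 ^ 1) = 1).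
rewrite rmorphXn (_ : zroot 1 = (- 1 + s3) / 2) //=.
by rewrite fmorph_div rmorphD rmorphN rmorph1 rmorph_nat /= t3.
Qed.

Lemma aut_omega_inv (t : Aut) x : t s3 = - s3 -> x ^+ 3 = 1 -> t x = x^-1.
Proof.
move=> t3 x3; rewrite -(conj_root_unity (isT : (0 < 3)%N) x3) -[LHS]aconjK -[aconj (t x)]/(acomp aconj t x).
by rewrite (@aut_omega_id (acomp aconj t)) // acompE t3 (rmorphN aconj) /= aconj_s3 opprK.
Qed.

(** Complex conjugation inverts both chi and omega, so it keeps the line of Kummer generators and
    serves as tau. An automorphism fixing K and inverting omega leaves chi alone, hence maps that
    line to the inverse one. *)
Lemma kummer_descent_minus chi S : gchar d chi 1 S ->
  (forall s, GK d s -> chi (cconj s) = (chi s)^-1) ->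
  exists g : Aut, [/\ g sd = - sd, g sD = sD & exists R n, [/\ kummer d 1 chi R, R ^+ 3 \in Aint,
    Qsqrt d%:~R (R ^+ 3), Qsqrt d%:~R n & n ^+ 3 = R ^+ 3 * g (R ^+ 3)]].
Proof.
move=> h chic; have [hh [h3 hD hd]] := flip_exists.
have [R1 [kR1 _]] := kummer_exists h (leqnn 1).
pose g := acomp aconj hh; have gd : g sd = - sd by rewrite acompE hd (rmorphN aconj) /= aconj_sd.
have gD : g sD = sD by rewrite acompE hD (rmorphN aconj) /= aconj_sD opprK.
have g3 : g s3 = - s3 by rewrite acompE h3 aconj_s3.
clearbody g; exists g; split=> //; apply: (@kummer_descent d d%:~R g aconj chi _ _ _ _ _ _ _ _ _ _ _ R1 kR1).
- exact: sD_neq0.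
- exact: aconj_sD.
- move=> x fixx cx; apply: (@galois_fixed _ [:: sd]) => [|b|t td]; first exact: subfield_Qsqrt.
    by rewrite inE => /eqP->; apply: Qsqrt_sqrt.
  have {}td : t sd = sd by apply: td; rewrite inE.
  have tDP := aut_sD_prod t; case: (aut_sqrt_int t (- 3)) => t3.
    apply: fixx; apply/GN1P; split=> //; apply/tDP; by rewrite [t sd]td [t s3]t3.
  have : acomp aconj t x = x.
    apply: fixx; apply/GN1P; split; last by rewrite acompE [t s3]t3 (rmorphN aconj) /= aconj_s3 opprK.
    by apply/aut_sD_prod; rewrite !acompE td t3 (rmorphN aconj) /= aconj_s3 aconj_sd opprK.
  by rewrite acompE => E; rewrite -[LHS]aconjK E.
- move=> x Fx; apply: (Qsqrt_fix _ _ (s := aconj)) Fx; rewrite ?rpred_int ?sd_irrational //.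
  exact: aconj_sd.
- by move=> x; apply: Qsqrt_stable; rewrite ?rpred_int ?sd_irrational.
- by move=> s Gs; apply: (gcX h (GN_GK Gs)).
- move=> R [nzR sR] s Gs; have := GN_cconj Gs => Gc.
  have := sR _ Gc; rewrite cconjE (chic _ (GN_GK Gs)) => /(congr1 aconj).
  rewrite aconjE conjCK => E; rewrite -[aconj R]/(R^*) E rmorphM /=.
  have -> : aconj (chi s)^-1 = chi s by rewrite (fmorphV aconj) /= (gc_val_conj h (GN_GK Gs)) invrK.
  by [].
- move=> R [nzR sR] s Gs; have Gc := GN_conjugate g Gs.
  have : g (ainv g (s (g R))) = g (chi (acomp (ainv g) (acomp s g)) * R) by rewrite -(sR _ Gc).
  rewrite ainvK => ->; rewrite (rmorphM g) /=.
  have GKg := gD : GK d g; have GKs := GN_GK Gs.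
  rewrite (gc_conjugate h) //.
  by rewrite (aut_omega_inv g3 (gcX h GKs)).
- by split; rewrite /GK acompE aconjK.
- rewrite (gcS h) ?rmorph1 //; first by rewrite /GK acompE aconjK.
  by move=> x _; rewrite acompE aconjK.
- by move=> s; apply: GN_conjugate.
Qed.
End RealMirror.

Section DescentPlus.
Variables (d : int) (d_gt0 : 0 < d) (d_mod : (d = 2 %[mod 3])%Z).
Local Notation sD := (sqrtC (- 3 * d)%:~R : algC).

(** The roles are exchanged: [hh] fixes omega and acts on chi like complex conjugation up to an
    element of [GK], so it serves as tau, while complex conjugation leads to the inverse line. *)
Lemma kummer_descent_plus chi S : gchar d chi 1 S ->
  (forall s, GK d s -> chi (cconj s) = chi s) ->
  exists R n, [/\ kummer d 1 chi R, R ^+ 3 \in Aint,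
    Qsqrt (- 3)%:~R (R ^+ 3), Qsqrt (- 3)%:~R n & n ^+ 3 = R ^+ 3 * aconj (R ^+ 3)].
Proof.
move=> h chic; have [hh [h3 hD hd]] := flip_exists d_gt0 d_mod.
have [R1 [kR1 _]] := kummer_exists h (leqnn 1).
have cD := aconj_sD d_gt0; have n3 := sqrt_neg_irrational (isT : - 3 < 0 :> int).
have Gch : GK d (acomp aconj hh) by rewrite /GK acompE hD -cD aconjK.
have Ghh : GN d 1 (acomp hh hh).
  by apply/GN1P; rewrite !acompE h3 hD (rmorphN hh) /= hD opprK.
apply: (@kummer_descent d (- 3)%:~R aconj hh chi _ _ _ _ _ _ _ _ _ _ _ R1 kR1).
- exact: sD_neq0.
- exact: hD.
- move=> x fixx hx; apply: (@galois_fixed _ [:: s3]) => [|b|t t3]; first exact: subfield_Qsqrt.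
    by rewrite inE => /eqP->; apply: Qsqrt_sqrt.
  have {}t3 : t s3 = s3 by apply: t3; rewrite inE.
  case: (aut_sqrt_int t (- 3 * d)) => tD; first by apply: fixx; apply/GN1P.
  have : acomp hh t x = x.
    apply: fixx; apply/GN1P; rewrite !acompE t3 h3; split=> //.
    have -> : t sD = - sD by [].
    by rewrite (rmorphN hh) /= hD opprK.
  by rewrite acompE => E; apply: (fmorph_inj hh); rewrite hx.
- by move=> x Fx; apply: (Qsqrt_fix _ _ (s := hh)) Fx; rewrite ?rpred_int.
- by move=> x; apply: Qsqrt_stable; rewrite ?rpred_int.
- by move=> s Gs; apply: (gcX h (GN_GK Gs)).
- move=> R [nzR sR] s Gs; have Gc := GN_conjugate hh Gs.
  have : hh (ainv hh (s (hh R))) = hh (chi (acomp (ainv hh) (acomp s hh)) * R) by rewrite -(sR _ Gc).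
  rewrite ainvK => ->; rewrite (rmorphM hh) /=; have GKs := GN_GK Gs.
  have <- : chi s = chi (acomp (ainv hh) (acomp s hh)).
    have Gcs : GK d (cconj s) by apply: GK_cconj.
    rewrite -(chic _ GKs) -(gc_conjugate h Gcs Gch).
    apply: (gc_eq h); first exact: GK_conjugate.
      exact: GK_conjugate.
    move=> x; rewrite !acompE !aconjK; apply: (fmorph_inj hh); rewrite ainvK.
    apply: (fmorph_inj aconj); rewrite -[LHS]/(acomp aconj hh _) ainvK.
    by [].
  by rewrite (aut_omega_id h3 (gcX h GKs)).
- move=> R [nzR sR] s Gs; have Gc := GN_cconj d_gt0 Gs; have GKs := GN_GK Gs.
  have := sR _ Gc; rewrite cconjE (chic _ GKs) => /(congr1 aconj).
  rewrite aconjE conjCK => E; rewrite -[aconj R]/(R^*) E (rmorphM aconj) /=.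
  by rewrite (gc_val_conj h GKs).
- exact: Ghh.
- by apply: (aut_omega_id h3); apply: (gcX h); apply: GN_GK Ghh.
- by move=> s; apply: GN_conjugate.
Qed.
End DescentPlus.

(** At a split prime alpha^2 is locally a cube, and so is alpha, because (alpha / l^k)^3 / alpha =
    alpha^2 / l^(3k). Otherwise g preserves the prime below P and inverts alpha / g alpha, which is
    therefore a unit, and equals (alpha / n)^3 / alpha. *)
Lemma local_cube (e : int) (g : Aut) (alpha n : algC) l P : sqrtC e%:~R \notin Crat ->
  g (sqrtC e%:~R) = - sqrtC e%:~R -> prime_over l P ->
  alpha != 0 -> Qsqrt e%:~R alpha -> Qsqrt e%:~R n -> n ^+ 3 = alpha * g alpha ->
  (forall w, int_ring (Qsqrt e%:~R) w -> P w -> ~ P (g w) ->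
     exists k : int, unitA P (alpha ^+ 2 / l%:R ^ (k * 3))) ->
  exists x, [/\ x != 0, Qsqrt e%:~R x & unitA P (x ^+ 3 / alpha)].
Proof.
move=> nQ gw hP nza Fa Fn n3 split_case; have Qe : e%:~R \in Crat by rewrite rpred_int.
have hF := @subfield_Qsqrt e%:~R.
have nzl : l%:R != 0 :> algC by rewrite pnatr_eq0 -lt0n (prime_gt0 (po_prime hP)).
have [[w [Ow Pw nPgw]]|nex] := pselect (exists w, [/\ int_ring (Qsqrt e%:~R) w, P w & ~ P (g w)]).
  have [k uk] := split_case w Ow Pw nPgw.
  exists (alpha / l%:R ^ k); split; first by rewrite mulf_neq0 ?invr_eq0 ?expfz_neq0.
    by apply: (sfdiv hF) => //; apply: (sfexpz hF) => //; apply: (sfnat hF).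
  suff -> : (alpha / l%:R ^ k) ^+ 3 / alpha = alpha ^+ 2 / l%:R ^ (k * 3) by [].
  have nzlk : l%:R ^ k != 0 :> algC by rewrite expfz_neq0.
  by rewrite -exprz_exp -[(_ ^ k) ^ 3]/(_ ^+ 3); field; rewrite nza nzlk.
have stab w : int_ring (Qsqrt e%:~R) w -> P w -> P (g w).
  by move=> Ow Pw; apply: contrapT => nP; apply: nex; exists w.
have nzga : g alpha != 0 by rewrite fmorph_eq0.
have nzn : n != 0 by apply: contra_neq (mulf_neq0 nza nzga) => n0; rewrite -n3 n0 expr0n.
exists (alpha / n); split; [by rewrite mulf_neq0 ?invr_eq0|exact: (sfdiv hF)|].
have -> : (alpha / n) ^+ 3 / alpha = alpha / g alpha.
  by rewrite expr_div_n n3; field; rewrite nza nzga.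
have inv z : Qsqrt e%:~R z -> inA P z -> inA P (g z).
  move=> Fz Az; have [u [Au Fu nu Auz]] := inA_field hP hF Fz Az.
  exists (g u); rewrite Aint_aut; split=> //; last by rewrite -rmorphM Aint_aut.
  have Fgu : Qsqrt e%:~R (g u) by apply: Qsqrt_stable.
  by move=> Pgu; apply: nu; rewrite -(Qsqrt_conjK Qe nQ gw Fu); apply: stab => //; rewrite /int_ring /= Aint_aut.
have Fga : Qsqrt e%:~R (g alpha) by apply: Qsqrt_stable.
set rho := alpha / g alpha; have Frho : Qsqrt e%:~R rho by apply: (sfdiv hF).
have grho : g rho = rho^-1 by rewrite /rho fmorph_div /= (Qsqrt_conjK Qe nQ gw Fa) invf_div.
have nzrho : rho != 0 by rewrite mulf_neq0 ?invr_eq0.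
have Arho : inA P rho.
  apply: contrapT => nA; apply: (nA); have /(inM_A hP) := inA_VM hP nA.
  have FV := sfV hF Frho.
  by move/(inv _ FV); rewrite fmorphV grho invrK.
by split=> //; rewrite -grho; apply: inv.
Qed.

(* [alpha] generates the cube of the fractional ideal of the x with x^3/alpha integral. *)
Lemma cube_ideal_invertible (F : set algC) (alpha : algC) (W : set algC) v :
  subfield F -> int_ring F alpha -> alpha != 0 ->
  (forall l P, prime_over l P -> exists x, [/\ x != 0, F x & unitA P (x ^+ 3 / alpha)]) ->
  (forall x y, W x -> W y -> W (x + y)) -> (forall o x, int_ring F o -> W x -> W (o * x)) ->
  (forall x z, F x -> F z -> x ^+ 3 / alpha \in Aint -> z ^+ 3 * alpha \in Aint -> W (x * z * v)) ->
  W v.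
Proof.
move=> hF [Fa Aa] nza local WD WM Wxz.
(* The ideal of multipliers carrying v into W. Were it proper, some P would contain it, but the
   local cube x at P yields u y in I outside P, as the product of u x and y / x. *)
pose I : set algC := [set y | int_ring F y /\ W (y * v)].
apply: contrapT => nWv; have [] : False => //.
have Oalpha : I alpha.
  split=> //; rewrite -[alpha]mulr1; apply: Wxz => //; first exact: (sf1 hF).
    by rewrite exprSr mulfK // rpredX.
  by rewrite expr1n mul1r.
have [|||||||l [P [hP IP]]] := @subring_ideal_prime (int_ring F) I.
- split; first by split; [exact: (sf1 hF)|exact: rpred1].
    by move=> x y [Fx Ax] [Fy Ay]; split; [exact: (sfB hF)|exact: rpredB].
  by move=> x y [Fx Ax] [Fy Ay]; split; [exact: (sfM hF)|exact: rpredM].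
- by move=> x [].
- by move=> x [].
- move=> x y [[Fx Ax] Wx] [[Fy Ay] Wy]; split; first by split; [exact: (sfD hF)|exact: rpredD].
  by rewrite mulrDl; apply: WD.
- move=> a x [Fa' Aa'] [[Fx Ax] Wx]; split; first by split; [exact: (sfM hF)|exact: rpredM].
  by rewrite -mulrA; apply: WM.
- by case=> _; rewrite mul1r.
- by exists alpha.
have [x [nzx Fx ux]] := local l P hP; have [nz0 Ax _] := ux.
have Fxa : F (x ^+ 3 / alpha) by apply: (sfdiv hF) => //; apply: (sfX hF).
have [u [Au Fu nu Auy]] := inA_field hP hF Fxa Ax.
set y := u * (x ^+ 3 / alpha) in Auy.
have Fy : F y by apply: (sfM hF).
have nPy : ~ P y.
  move/(P_inM hP)/(inM_prime hP (Aint_inA hP Au) Ax) => -[/(inM_Aint hP Au)//|].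
  exact: (unitA_nM hP).
have : P (u * y).
  apply: IP; split; first by split; [exact: (sfM hF)|exact: rpredM].
  have -> : u * y * v = (u * x) * (y / x) * v by field.
  apply: Wxz; [exact: (sfM hF)|exact: (sfdiv hF)|..].
    have -> : (u * x) ^+ 3 / alpha = u ^+ 2 * y by rewrite /y; field.
    by rewrite rpredM ?rpredX.
  have -> : (y / x) ^+ 3 * alpha = y ^+ 2 * u by rewrite /y; field; rewrite nza nzx.
  by rewrite rpredM ?rpredX.
by case/(poM hP Au Auy).
Qed.

(** * Class numbers and units *)

(** Counts ideal classes by orbits: multiplication by an ideal with principal cube must fix a class
    when the class number is prime to 3. *)
Lemma card_free_cycle3 (A : finType) (f : A -> A) :
  (forall x, f (f (f x)) = x) -> (forall x, f x <> x) -> (3 %| #|A|)%N.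
Proof.
move=> f3 nfix; have finj : injective f by move=> x y E; rewrite -(f3 x) E f3.
pose s := perm finj; pose G := <[s]>%G.
have s3 : (s ^+ 3 = 1)%g by apply/permP => x; rewrite perm1 !expgS expg0 mulg1 !permM !permE f3.
have pG : (3.-group G)%g.
  by apply: (@pnat_dvd _ 3) => //; rewrite -orderE order_dvdn s3.
pose X : {set A} := finset.setTfor A.
have aG : [acts G, on X | 'P]%g by apply/actsP => x _ y; rewrite !inE.
have := pgroup_fix_mod pG aG; rewrite cardsT.
suff -> : ('Fix_(X | 'P)(G))%g = finset.set0.
  by rewrite cards0 => /eqP; rewrite eqn_mod_dvd // subn0.
apply/finset.setP => x; rewrite finset.in_setI finset.in_set0; apply/negP => /andP[_ /afixP fx].
by have := fx s (cycle_id s); rewrite /= apermE permE; apply: nfix.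
Qed.

Lemma rat_power_int (q : rat) (c : int) : c != 0 -> (forall n, c%:~R * q ^+ n \in Num.int) -> q \in Num.int.
Proof.
move=> nzc cq; have dvd n : (denq q ^+ n %| c)%Z.
  have /intrP[m Dm] := cq n.
  have E : c * numq q ^+ n = m * denq q ^+ n.
    apply: (@intr_inj rat); rewrite !rmorphM !rmorphXn /= numqE -Dm exprMn.
    by rewrite mulrA.
  have cop : coprimez (denq q ^+ n) (numq q ^+ n).
    by apply: coprimezXl; apply: coprimezXr; rewrite coprimez_sym coprimezE coprime_num_den.
  by rewrite -(Gauss_dvdzl _ cop) E dvdz_mull.
have d1 : denq q = 1.
  have : (0 < denq q)%R := denq_gt0 q.
  case: (denq q) dvd => // -[|[|k]] // dvd _.
  have := dvd `|c|%N; rewrite dvdzE abszX /= => /dvdn_leq; rewrite absz_gt0 nzc => /(_ isT).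
  by rewrite leqNgt ltn_expl.
by apply/intrP; exists (numq q); rewrite -[q in LHS]divq_num_den d1 divr1.
Qed.

(** Powers of rho keep j in J, so N(j) N(rho)^n is an integer for all n, and N(rho) has no
    denominator. The same for 1 + rho makes the trace integral. *)
Lemma Qsqrt_stabilizer (a : algC) (g : Aut) J rho : a \in Crat -> sqrtC a \notin Crat ->
  g (sqrtC a) = - sqrtC a -> nonzero_ideal (Qsqrt a) J -> Qsqrt a rho ->
  (forall x, J x -> J (rho * x)) -> rho \in Aint.
Proof.
move=> Qa nQ gw [[JO J0 JD JM] nJ] Frho rJ; have hF := @subfield_Qsqrt a.
have [j Jj nzj] : exists2 j, J j & j != 0.
  apply: contrapT => nex; case/eqP: nJ; apply/seteqP; split=> [x Jx|_ -> //] /=.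
  by apply/eqP; apply: contrapT => /negP nz; apply: nex; exists x.
have [Fj Aj] := JO _ Jj.
have norm_int r : Qsqrt a r -> (forall x, J x -> J (r * x)) -> r * g r \in Num.int.
  move=> Fr sr; have Jn n : J (r ^+ n * j).
    by elim: n => [|n IHn]; rewrite ?mul1r // exprS -mulrA; apply: sr.
  have /intrP[c Dc] := Qsqrt_inorm Qa nQ gw (conj Fj Aj).
  have nzc : c != 0 by rewrite -(intr_eq0 algC) -Dc mulf_neq0 ?fmorph_eq0.
  have /CratP[q Dq] := Qsqrt_norm Qa nQ gw Fr.
  rewrite Dq Cint_rat; apply: (rat_power_int nzc) => n.
  rewrite -Cint_rat rmorphM rmorph_int rmorphXn /= -Dq -Dc.
  have -> : j * g j * (r * g r) ^+ n = (r ^+ n * j) * g (r ^+ n * j).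
    by rewrite rmorphM rmorphXn /= exprMn; ring.
  exact/(Qsqrt_inorm Qa nQ gw)/JO.
have /intrP[n Dn] := norm_int _ Frho rJ.
have /intrP[m Dm] : (1 + rho) * g (1 + rho) \in Num.int.
  apply: norm_int => [|x Jx]; first by apply: (sfD hF) => //; apply: (sf1 hF).
  by rewrite mulrDl mul1r; apply: JD => //; apply: rJ.
pose t := m - n - 1; have Et : t%:~R = rho + g rho :> algC.
  by rewrite !rmorphB /= -Dm -Dn rmorphD rmorph1; ring.
apply: (@Aint_root_monic ('X^2 - t%:~R *: 'X + n%:~R%:P)).
- by rewrite -addrA monicE lead_coefDl ?lead_coefXn // size_polyXn -scaleNr;
    rewrite (leq_ltn_trans (size_polyD _ _)) // gtn_max (leq_ltn_trans (size_scale_leq _ _)) ?size_polyX //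
            (leq_ltn_trans (size_polyC_leq1 _)).
- by rewrite rootE !hornerE Et -Dn; apply/eqP; ring.
- move=> i; rewrite !coefD coefN coefZ coefXn coefX coefC.
  by rewrite rpredD ?rpredB ?rpredM ?rpred_nat ?Aint_int //; case: ifP; rewrite ?Aint_int ?rpred0.
Qed.

(** * The cube root of an ideal acting on ideal classes *)

Section IdealClasses.
Variable (F : set algC) (hF : subfield F).

Lemma same_class_refl I : same_ideal_class F I I.
Proof.
have O1 : int_ring F 1 by split; [exact: (sf1 hF)|exact: rpred1].
by exists 1, 1; split=> //; apply: oner_neq0.
Qed.
Lemma same_class_sym I J : same_ideal_class F I J -> same_ideal_class F J I.
Proof. by move=> [a [b [Oa Ob nza nzb E]]]; exists b, a. Qed.
Lemma same_class_trans I J K :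
  same_ideal_class F I J -> same_ideal_class F J K -> same_ideal_class F I K.
Proof.
move=> [a [b [[Fa Aa] [Fb Ab] nza nzb E]]] [a' [b' [[Fa' Aa'] [Fb' Ab'] nza' nzb' E']]].
exists (a' * a), (b * b'); split; try (split; [exact: (sfM hF)|exact: rpredM]); try exact: mulf_neq0.
have imM (c c' : algC) (S : set algC) : [set c * c' * x | x in S] = [set c * x | x in [set c' * x | x in S]].
  apply/seteqP; split=> [_ [x Sx <-]|_ [_ [x Sx <-] <-]].
    by exists (c' * x); [exists x|rewrite mulrA].
  by exists x => //; rewrite mulrA.
by rewrite (imM a' a I) E -(imM a' b J) mulrC (imM b a' J) E' -(imM b b' K).
Qed.

Lemma ideal_class_eq I J : nonzero_ideal F J ->
  ideal_class F I = ideal_class F J <-> same_ideal_class F I J.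
Proof.
move=> nJ; split=> [E|S].
  have : ideal_class F J J by split=> //; apply: same_class_refl.
  by rewrite -E => -[].
apply/seteqP; split=> C [nC SC]; split=> //.
  by apply: same_class_trans SC; apply: same_class_sym.
exact: same_class_trans SC.
Qed.

Variables (alpha : algC) (Oalpha : int_ring F alpha) (nza : alpha != 0).
Hypothesis local : forall l P, prime_over l P ->
  exists x, [/\ x != 0, F x & unitA P (x ^+ 3 / alpha)].
Hypothesis stab : forall J rho, nonzero_ideal F J -> F rho ->
  (forall x, J x -> J (rho * x)) -> rho \in Aint.

(* Multiplication of J by the ideal with cube (alpha), written as a colon ideal. *)
Definition cube_mul (J : set algC) : set algC :=
  [set x | F x /\ forall z, F z -> z ^+ 3 * alpha \in Aint -> J (x * z)].

Let invertible W v := @cube_ideal_invertible F alpha W v hF Oalpha nza local.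

Lemma cube_mul_ideal J : nonzero_ideal F J -> nonzero_ideal F (cube_mul J).
Proof.
move=> [[JO J0 JD JM] nJ]; have [Fa Aa] := Oalpha.
split; last first.
  have [j Jj nzj] : exists2 j, J j & j != 0.
    apply: contrapT => nex; case/eqP: nJ; apply/seteqP; split=> [x Jx|_ -> //] /=.
    by apply/eqP; apply: contrapT => /negP nz; apply: nex; exists x.
  have [Fj Aj] := JO _ Jj.
  apply/eqP => E; have : cube_mul J (alpha * j).
    split=> [|z Fz Az]; first exact: (sfM hF).
    rewrite mulrAC; apply: JM => //; split; first exact: (sfM hF).
    apply: (@Aint_exp _ 3) => //.
    rewrite (_ : _ ^+ 3 = alpha ^+ 2 * (z ^+ 3 * alpha)); last by ring.
    by rewrite rpredM ?rpredX.
  by rewrite E => /eqP; rewrite mulf_eq0 (negPf nza) (negPf nzj).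
split.
- move=> x [Fx xJ]; split=> //.
  apply: (@invertible [set y | y \in Aint] x) => /= [y z|o y [_ Ao]|y z Fy Fz Ay Az].
  - exact: rpredD.
  - exact: rpredM.
  - have [_ Axz] := JO _ (xJ z Fz Az).
    rewrite (_ : _ * x = y * (x * z)); last by ring.
    rewrite rpredM //; apply: (@Aint_exp _ 3) => //.
    by rewrite -(divfK nza (y ^+ 3)) rpredM.
- by split=> [|z _ _]; [exact: (sf0 hF)|rewrite mul0r].
- move=> x y [Fx xJ] [Fy yJ]; split=> [|z Fz Az]; first exact: (sfD hF).
  by rewrite mulrDl; apply: JD; [apply: xJ|apply: yJ].
- move=> o x [Fo Ao] [Fx xJ]; split=> [|z Fz Az]; first exact: (sfM hF).
  by rewrite -mulrA; apply: JM => //; apply: xJ.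
Qed.

Lemma cube_mul_same I J : same_ideal_class F I J -> same_ideal_class F (cube_mul I) (cube_mul J).
Proof.
move=> [a [b [[Fa' Aa'] [Fb Ab] nza' nzb E]]]; exists a, b; split=> //.
have half (c e : algC) (U V : set algC) : F c -> F e -> c != 0 -> e != 0 ->
    [set c * x | x in U] = [set e * y | y in V] ->
    [set c * x | x in cube_mul U] `<=` [set e * y | y in cube_mul V].
  move=> Fc Fe nzc nze EUV _ [x [Fx xU] <-]; exists (c * x / e); last by rewrite mulrC divfK.
  split=> [|z Fz Az]; first by apply: (sfdiv hF) => //; apply: (sfM hF).
  have : [set e * y | y in V] (c * (x * z)) by rewrite -EUV; exists (x * z) => //; apply: xU.
  by move=> [y Vy Ey]; have -> : c * x / e * z = y by apply: (mulfI nze); rewrite Ey; field.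
by apply/seteqP; split; apply: half => //.
Qed.

Lemma cube_mul3 J : nonzero_ideal F J ->
  cube_mul (cube_mul (cube_mul J)) = [set x | F x /\ J (x / alpha)].
Proof.
move=> [[JO J0 JD JM] nJ]; have [Fa Aa] := Oalpha.
have cubeA z : z ^+ 3 \in Aint -> z \in Aint by apply: Aint_exp.
apply/seteqP; split=> x.
  move=> [Fx xJ]; split=> //; pose W : set algC := [set y | J (y / alpha)].
  have WD y z : W y -> W z -> W (y + z) by rewrite /W /= mulrDl; apply: JD.
  have WM o y : int_ring F o -> W y -> W (o * y) by rewrite /W /= -mulrA; apply: JM.
  apply: (@invertible W x) => // x1 z1 Fx1 Fz1 Ax1 Az1.
  apply: (@invertible W _) => // x2 z2 Fx2 Fz2 Ax2 Az2.
  apply: (@invertible W _) => // x3 z3 Fx3 Fz3 Ax3 Az3.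
  have [_ /(_ z2 Fz2 Az2)[_ /(_ z3 Fz3 Az3) Jx]] := xJ z1 Fz1 Az1.
  rewrite /W /= (_ : _ / alpha = (x1 * x2 * x3 / alpha) * (x * z1 * z2 * z3)); last by field.
  apply: JM => //; split; first by apply: (sfdiv hF) => //; do 2?apply: (sfM hF).
  apply: cubeA; rewrite (_ : _ ^+ 3 = (x1 ^+ 3 / alpha) * (x2 ^+ 3 / alpha) * (x3 ^+ 3 / alpha)); last by field.
  by rewrite rpredM // rpredM.
move=> [Fx Jx]; split=> // z1 Fz1 Az1; split=> [|z2 Fz2 Az2]; first exact: (sfM hF).
split=> [|z3 Fz3 Az3]; first by do 2?apply: (sfM hF).
rewrite (_ : x * _ * _ * _ = (alpha * z1 * z2 * z3) * (x / alpha)); last by field.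
apply: JM => //; split; first by do 3?apply: (sfM hF).
apply: cubeA; rewrite (_ : _ ^+ 3 = (z1 ^+ 3 * alpha) * (z2 ^+ 3 * alpha) * (z3 ^+ 3 * alpha)); last by ring.
by rewrite rpredM // rpredM.
Qed.

Lemma cube_mul_class3 J : nonzero_ideal F J ->
  same_ideal_class F (cube_mul (cube_mul (cube_mul J))) J.
Proof.
move=> nJ; have [[JO _ _ _] _] := nJ; have [Fa Aa] := Oalpha.
exists 1, alpha; split=> //; [by split; [exact: (sf1 hF)|exact: rpred1]|exact: oner_neq0|].
rewrite cube_mul3 //; apply/seteqP; split=> [_ [x [Fx Jx] <-]|_ [x Jx <-]].
  by exists (x / alpha) => //; rewrite mul1r mulrC divfK.
exists (alpha * x); rewrite ?mul1r //; split; last by rewrite mulrC mulKf.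
by apply: (sfM hF) => //; case: (JO _ Jx).
Qed.

(** In a fixed class, multiplication by the cube root of (alpha) carries J to rho J. Three
    iterations give alpha J = rho^3 J, and field elements stabilising J are integral. *)
Lemma cube_of_class_number : ~~ (3 %| class_number F)%N ->
  exists b, [/\ F b, b != 0, b ^+ 3 / alpha \in Aint & alpha / b ^+ 3 \in Aint].
Proof.
move=> ndvd; pose X := ideal_classes F.
(* With infinitely many classes [class_number] would be 0, which 3 divides. *)
have finX : finite_set X.
  apply: contrapT => ninf; move: ndvd; rewrite /class_number /fset_set.
  by case: pselect => // _; rewrite cardfs0.
have repX C : X C -> exists2 J, nonzero_ideal F J & ideal_class F J = C by move=> [J nJ <-]; exists J.
pose T C : set (set algC) := if pselect (X C) is left XC
  then ideal_class F (cube_mul (projT1 (cid2 (repX C XC)))) else C.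
have TE J : nonzero_ideal F J -> T (ideal_class F J) = ideal_class F (cube_mul J).
  move=> nJ; rewrite /T; case: pselect => [XC|[]]; last by exists J.
  case: cid2 => J' nJ' E' /=; apply/(ideal_class_eq _ (cube_mul_ideal nJ)).
  by apply: cube_mul_same; apply/(ideal_class_eq _ nJ).
have XT C : X C -> X (T C).
  by move=> [J nJ <-]; rewrite TE //; exists (cube_mul J) => //; apply: cube_mul_ideal.
have T3 C : X C -> T (T (T C)) = C.
  move=> [J nJ <-]; have n1 := cube_mul_ideal nJ; have n2 := cube_mul_ideal n1.
  by rewrite !TE //; apply/(ideal_class_eq _ nJ); apply: cube_mul_class3.
have [C XC TC] : exists2 C, X C & T C = C.
  apply: contrapT => nex; case/negP: ndvd; rewrite /class_number -/X.
  have memX C : C \in fset_set X <-> X C.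
    by rewrite in_fset_set //; split=> [/set_mem|/mem_set].
  have TA (x : fset_set X) : T (val x) \in fset_set X by apply/memX/XT/memX/valP.
  rewrite cardfE; apply: (@card_free_cycle3 _ (fun x => [` TA x]%fset)) => x.
    by apply: val_inj => /=; apply/T3/memX/valP.
  by move/(congr1 val) => /= E; apply: nex; exists (val x) => //; apply/memX/valP.
have [J nJ DC] := XC; move: TC; rewrite -DC TE // => /(ideal_class_eq _ nJ).
move=> [a [b [[Fa Aa] [Fb Ab] nza' nzb E]]].
pose rho := b / a; have Frho : F rho by apply: (sfdiv hF).
have nzr : rho != 0 by rewrite mulf_neq0 ?invr_eq0.
have JF x : J x -> F x by have [[JO _ _ _] _] := nJ; move=> /JO[].
have TJ : cube_mul J = [set x | F x /\ J (x / rho)].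
  apply/seteqP; split=> [x Tx|x [Fx Jx]].
    have [Fx _] := Tx; split=> //; have : [set a * y | y in cube_mul J] (a * x) by exists x.
    by rewrite E => -[y Jy Ey]; have -> : x / rho = y by apply: (mulfI nzb); rewrite Ey /rho; field; rewrite nza' nzb.
  have : [set b * y | y in J] (b * (x / rho)) by exists (x / rho).
  rewrite -E => -[y Ty Ey]; suff -> : x = y by [].
  by apply: (mulfI nza'); rewrite Ey /rho; field; rewrite nza' nzb.
have Tscale c (J' : set algC) : F c -> c != 0 ->
    cube_mul [set x | F x /\ J' (x / c)] = [set x | F x /\ cube_mul J' (x / c)].
  move=> Fc nzc; apply/seteqP; split=> x [Fx xJ]; split=> //.
    split=> [|z Fz Az]; first exact: (sfdiv hF).
    by rewrite mulrAC; have [] := xJ z Fz Az.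
  move=> z Fz Az; split; first exact: (sfM hF).
  by rewrite mulrAC; have [_] := xJ; apply.
have TT : cube_mul (cube_mul J) = [set x | F x /\ cube_mul J (x / rho)].
  by rewrite {1}TJ Tscale.
have TTT : cube_mul (cube_mul (cube_mul J)) = [set x | F x /\ cube_mul (cube_mul J) (x / rho)].
  by rewrite {1}TT Tscale.
have key x : F x -> J (x / alpha) <-> J (x / rho ^+ 3).
  move=> Fx; have E3 : x / rho ^+ 3 = x / rho / rho / rho by field.
  have E0 y : cube_mul (cube_mul (cube_mul J)) y = (F y /\ J (y / alpha)) by rewrite cube_mul3.
  have Fx1 := sfdiv hF Fx Frho; have Fx2 := sfdiv hF Fx1 Frho.
  have := E0 x; rewrite TTT /= TT /= TJ /= E3 => E'; split=> H.
    by have [_ [_ [_ +]]] : F x /\ F (x / rho) /\ F (x / rho / rho) /\ J (x / rho / rho / rho) by rewrite E'.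
  by have [] : F x /\ J (x / alpha) by rewrite -E'.
exists rho; split=> //.
- apply: (stab nJ) => [|x Jx]; first by apply: (sfdiv hF); [apply: (sfX hF)|case: Oalpha].
  have Fx := JF _ Jx; have Fr3 : F (rho ^+ 3) by apply: (sfX hF).
  rewrite mulrAC; apply: (key _ (sfM hF Fr3 Fx)).2.
  by rewrite [_ * x]mulrC mulfK ?expf_neq0.
- apply: (stab nJ) => [|x Jx]; first by apply: (sfdiv hF); [case: Oalpha|apply: (sfX hF)].
  have Fx := JF _ Jx; have [Fal _] := Oalpha.
  rewrite mulrAC; apply: (key _ (sfM hF Fal Fx)).1.
  by rewrite [_ * x]mulrC mulfK.
Qed.
End IdealClasses.

(** * The Eisenstein integers *)

Notation K3 := (Qsqrt (- 3)%:~R).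

Lemma s3_irrational : s3 \notin Crat.
Proof. exact: (sqrt_neg_irrational (isT : - 3 < 0 :> int)). Qed.

Lemma s3_conj : aconj s3 = - s3. Proof. exact: (conj_sqrt_neg (isT : - 3 < 0 :> int)). Qed.

Lemma omega_K3 : K3 omega.
Proof.
have hF := @subfield_Qsqrt (- 3)%:~R; rewrite (_ : omega = (- 1 + s3) / 2) //.
apply: (sfdiv hF); last exact: (sfnat hF 2).
by apply: (sfD hF); [exact: (sfN hF (sf1 hF))|exact: Qsqrt_sqrt].
Qed.

Lemma K3_round x : K3 x -> exists q, [/\ K3 q, q \in Aint & (x - q) * (x - q)^* < 1].
Proof.
move=> Fx; have [_ [_ [/CratP[p ->] /CratP[r ->] Dx]]] := QsqrtP (rpred_int _ _) s3_irrational Fx.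
have hF := @subfield_Qsqrt (- 3)%:~R.
(* In the basis 1, omega the coordinates of x are p + r and 2 r; m and n are their nearest integers,
   so the remainder has norm u^2 - u v + v^2, at most 3/4. *)
have [m Hm] : exists m : int, m%:~R <= p + r + 1 / 2 < (m + 1)%:~R.
  by exists (Num.floor (p + r + 1 / 2)); apply: floor_itv.
have [n Hn] : exists n : int, n%:~R <= 2 * r + 1 / 2 < (n + 1)%:~R.
  by exists (Num.floor (2 * r + 1 / 2)); apply: floor_itv.
exists (m%:~R + n%:~R * omega); split.
- by apply: (sfD hF); [exact: (sfint hF)|apply: (sfM hF); [exact: (sfint hF)|exact: omega_K3]].
- by apply: rpredD; [|apply: rpredM]; rewrite ?Aint_int //; apply: (zroot_Aint 1).
have nE : (x - (m%:~R + n%:~R * omega)) * (x - (m%:~R + n%:~R * omega))^*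
    = ratr ((p + r - m%:~R) ^+ 2 - (p + r - m%:~R) * (2 * r - n%:~R) + (2 * r - n%:~R) ^+ 2).
  have [a Da] : exists a : rat, a = p - m%:~R + n%:~R / 2 by eexists.
  have [b Db] : exists b : rat, b = r - n%:~R / 2 by eexists.
  have Ea : ratr a = ratr p - m%:~R + n%:~R / 2 :> algC.
    by rewrite Da rmorphD rmorphB fmorph_div !rmorph_int rmorph_nat.
  have Eb : ratr b = ratr r - n%:~R / 2 :> algC.
    by rewrite Db rmorphB fmorph_div !rmorph_int rmorph_nat.
  have -> : x - (m%:~R + n%:~R * omega) = ratr a + ratr b * s3.
    by rewrite Dx Ea Eb (_ : omega = (- 1 + s3) / 2) //; field.
  have -> : (ratr a + ratr b * s3)^* = ratr a - ratr b * s3.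
    exact: (Qsqrt_conjE s3_conj (Crat_rat a) (Crat_rat b)).
  have -> : (ratr a + ratr b * s3) * (ratr a - ratr b * s3) = ratr a ^+ 2 - ratr b ^+ 2 * s3 ^+ 2 by ring.
  rewrite s3_sqr; transitivity (ratr (a ^+ 2 + b ^+ 2 * 3) : algC); last by congr ratr; rewrite Da Db; field.
  by rewrite rmorphD (rmorphM _ (b ^+ 2)) !rmorphXn /= ratr_nat; ring.
rewrite nE; have <- : ratr 1 = 1 :> algC by rewrite rmorph1.
rewrite ltr_rat.
move: Hm Hn; rewrite !intrD => /andP[m1 m2] /andP[n1 n2].
have hu : (p + r - m%:~R) ^+ 2 <= 1 / 4 by nra.
have hv : (2 * r - n%:~R) ^+ 2 <= 1 / 4 by nra.
move: hu hv; move: (p + r - _) (2 * r - _) => u v hu hv; nra.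
Qed.

(** The mixed terms of the cube are integral because their own cubes are products of the given
    integers. *)
Lemma cube_integral_D (b x y : algC) : b != 0 -> x ^+ 3 / b \in Aint -> y ^+ 3 / b \in Aint ->
  (x + y) ^+ 3 / b \in Aint.
Proof.
move=> nzb Ax Ay.
have Axy : x ^+ 2 * y / b \in Aint.
  apply: (@Aint_exp _ 3) => //.
  rewrite (_ : _ ^+ 3 = (x ^+ 3 / b) ^+ 2 * (y ^+ 3 / b)); last by field.
  by rewrite rpredM ?rpredX.
have Ayx : x * y ^+ 2 / b \in Aint.
  apply: (@Aint_exp _ 3) => //.
  rewrite (_ : _ ^+ 3 = (x ^+ 3 / b) * (y ^+ 3 / b) ^+ 2); last by field.
  by rewrite rpredM ?rpredX.
rewrite (_ : _ / b = x ^+ 3 / b + 3 * (x ^+ 2 * y / b) + 3 * (x * y ^+ 2 / b) + y ^+ 3 / b); last by field.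
by rewrite !rpredD // rpredM ?rpred_nat.
Qed.

Lemma K3_norm_nat x : int_ring K3 x -> exists n : nat, x * x^* = n%:R.
Proof.
move=> Ox; have := Qsqrt_inorm (rpred_int _ _) s3_irrational s3_conj Ox.
rewrite aconjE => /intrP[m Dm]; have : 0 <= m by rewrite -(ler0z algC) -Dm mul_conjC_ge0.
by case: m Dm => // n Dn _; exists n.
Qed.

Section Eisenstein.
Variable alpha : algC.
Hypotheses (Oalpha : int_ring K3 alpha) (nza : alpha != 0).
Hypothesis local : forall l P, prime_over l P ->
  exists x, [/\ x != 0, K3 x & unitA P (x ^+ 3 / alpha)].
Let hF := @subfield_Qsqrt (- 3)%:~R.

(** The x with x^3 / alpha integral form an ideal, generated by an element b of least norm by
    Euclidean division. The inverse ideal then contains 1 / b, which is the second divisibility. *)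
Lemma eisenstein_cube :
  exists b, [/\ K3 b, b != 0, b ^+ 3 / alpha \in Aint & alpha / b ^+ 3 \in Aint].
Proof.
have [Fa Aa] := Oalpha.
have integral x : x ^+ 3 / alpha \in Aint -> x \in Aint.
  by move=> Ax; apply: (@Aint_exp _ 3) => //; rewrite -(divfK nza (x ^+ 3)) rpredM.
pose pn (n : nat) := `[< exists x, [/\ K3 x, x != 0, x ^+ 3 / alpha \in Aint & x * x^* = n%:R] >].
have exn : exists n, pn n.
  have [n Dn] := K3_norm_nat Oalpha; exists n; apply/asboolP; exists alpha; split=> //.
  by rewrite exprSr mulfK // rpredX.
case: (ex_minnP exn) => n /asboolP[b [Fb nzb Ab Dn]] minn.
have div x : K3 x -> x ^+ 3 / alpha \in Aint -> exists q, [/\ K3 q, q \in Aint & x = q * b].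
  move=> Fx Ax; have [q [Fq Aq ltq]] := K3_round (sfdiv hF Fx Fb).
  exists q; split=> //; apply/eqP; rewrite -subr_eq0; apply: contraTT ltq => nzy.
  set y := x - q * b in nzy.
  have Fy : K3 y by apply: (sfB hF) => //; apply: (sfM hF).
  have Ay : y ^+ 3 / alpha \in Aint.
    apply: cube_integral_D => //.
    rewrite (_ : _ / alpha = (- q) ^+ 3 * (b ^+ 3 / alpha)); last by field.
    by rewrite rpredM ?rpredX ?rpredN.
  have [k Dk] := K3_norm_nat (conj Fy (integral _ Ay)).
  have le_nk : (n <= k)%N by apply: minn; apply/asboolP; exists y.
  have -> : x / b - q = y / b by rewrite /y; field.
  have nzcb : b^* != 0 by rewrite fmorph_eq0.
  rewrite fmorph_div mulrACA Dk -invfM Dn -real_leNgt ?rpred1 ?rpred_div ?rpred_nat //.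
  have n0 : (0 < n)%N.
    by rewrite lt0n; apply/eqP => n0; have /eqP := Dn; rewrite n0 mulf_eq0 (negPf nzb) (negPf nzcb).
  by rewrite ler_pdivlMr ?ltr0n // mul1r ler_nat.
exists b; split=> //.
pose W : set algC := [set y | K3 y /\ y ^+ 3 * alpha \in Aint].
suff [_] : W b^-1 by rewrite exprVn mulrC.
apply: (@cube_ideal_invertible K3 alpha W b^-1 hF Oalpha nza local) => [x y [Fx Ax] [Fy Ay]|o x [Fo Ao] [Fx Ax]|x z Fx Fz Ax Az].
- split; first exact: (sfD hF).
  by have := @cube_integral_D alpha^-1 x y; rewrite invrK; apply; rewrite ?invr_eq0.
- split; first exact: (sfM hF).
  by rewrite exprMn -mulrA rpredM ?rpredX.
- have [q [Fq Aq ->]] := div x Fx Ax; have -> : q * b * z / b = q * z by field.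
  split; first exact: (sfM hF).
  by rewrite exprMn -mulrA rpredM ?rpredX.
Qed.
End Eisenstein.

(** A unit has norm 1, so its trace t satisfies t^2 <= 4. The traces 0, 2 and -2 lead to cubes, 1
    and -1 to primitive cube roots of unity up to sign. *)
Lemma K3_unit u : K3 u -> u \in Aint -> u^-1 \in Aint ->
  (exists2 v, K3 v & u = v ^+ 3) \/ (exists e : bool, ((-1) ^+ e * u) ^+ 2 + (-1) ^+ e * u + 1 = 0).
Proof.
move=> Fu Au AVu; have hF := @subfield_Qsqrt (- 3)%:~R.
have [->|nzu] := eqVneq u 0; first by left; exists 0; [exact: (sf0 hF)|rewrite expr0n].
have [n Dn] := K3_norm_nat (conj Fu Au); have [m Dm] := K3_norm_nat (conj (sfV hF Fu) AVu).
have nzcu : u^* != 0 by rewrite fmorph_eq0.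
have N1 : u * u^* = 1.
  have : (n * m)%:R = 1%:R :> algC by rewrite natrM -Dn -Dm fmorphV; field; rewrite nzu nzcu.
  by move/eqP; rewrite eqr_nat muln_eq1 => /andP[/eqP n1 _]; rewrite Dn n1.
have /intrP[t Dt] := Qsqrt_itrace (rpred_int _ _) s3_irrational s3_conj (conj Fu Au).
rewrite aconjE in Dt.
have Eu : u ^+ 2 = t%:~R * u - 1 by rewrite -Dt -N1; ring.
have t2 : t ^+ 2 <= 4.
  rewrite -(ler_int algC) rmorphXn /= -Dt -subr_ge0.
  rewrite (_ : 4%:~R - _ = (u - u^*) * (u - u^*)^*); first exact: mul_conjC_ge0.
  rewrite rmorphB /= conjCK; transitivity (4 * (u * u^*) - (u + u^*) ^+ 2); last by ring.
  by rewrite N1 mulr1.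
have : - 2 <= t <= 2 by apply/andP; split; nia.
case: t Dt Eu t2 => [[|[|[|t]]]|[|[|t]]] // _ Eu _ _.
- left; exists (- u); first exact: (sfN hF).
  by rewrite (_ : (- u) ^+ 3 = - (u * u ^+ 2)); [rewrite Eu; ring|ring].
- by right; exists true; rewrite expr1 mulN1r sqrrN Eu; ring.
- left; exists 1; first exact: (sf1 hF).
  rewrite expr1n; apply/eqP; rewrite -subr_eq0 -sqrf_eq0; apply/eqP.
  by rewrite (_ : _ ^+ 2 = u ^+ 2 - 2 * u + 1); [rewrite Eu; ring|ring].
- by right; exists false; rewrite expr0 mul1r Eu; ring.
- left; exists (- 1); first exact: (sfN hF (sf1 hF)).
  rewrite (_ : (- 1) ^+ 3 = - 1 :> algC); last by ring.
  apply/eqP.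
  rewrite -subr_eq0 opprK -sqrf_eq0; apply/eqP.
  by rewrite (_ : _ ^+ 2 = u ^+ 2 + 2 * u + 1); [rewrite Eu; ring|ring].
Qed.

(** Makes the trace v + v^-1, a natural number, measure the size of a unit v > 1 of norm 1. *)
Lemma trace_monotone (x y : algC) : 1 <= x -> x < y -> x + x^-1 < y + y^-1.
Proof.
move=> x1 xy; have x0 : 0 < x by apply: lt_le_trans x1.
have y0 : 0 < y by apply: lt_trans xy.
have xy1 : 1 < x * y.
  by rewrite -[1]mulr1; apply: (le_lt_trans (ler_pM _ _ x1 (lexx 1))) => //; rewrite mulr1 -[x in x < _]mulr1 ltr_pM2l // (le_lt_trans x1).
rewrite -subr_gt0 (_ : _ - _ = (y - x) * (x * y - 1) / (x * y)).
  by rewrite divr_gt0 ?mulr_gt0 ?subr_gt0.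
by field; rewrite !gt_eqF.
Qed.

Lemma mod3_dependence (a b : int) : exists i j : nat,
  [/\ (i < 3)%N, (j < 3)%N, (0 < i + j)%N & exists c : int, i%:Z * a + j%:Z * b = c * 3].
Proof.
have [a' Da] : exists a', a = 3 * a' \/ a = 3 * a' + 1 \/ a = 3 * a' + 2 by exists (a %/ 3)%Z; lia.
have [b' Db] : exists b', b = 3 * b' \/ b = 3 * b' + 1 \/ b = 3 * b' + 2 by exists (b %/ 3)%Z; lia.
case: Da => [->|[->|->]]; first by exists 1%N, 0%N; split=> //; exists a'; ring.
  case: Db => [->|[->|->]]; first by exists 0%N, 1%N; split=> //; exists b'; ring.
    by exists 1%N, 2%N; split=> //; exists (a' + 2 * b' + 1); ring.
  by exists 1%N, 1%N; split=> //; exists (a' + b' + 1); ring.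
case: Db => [->|[->|->]]; first by exists 0%N, 1%N; split=> //; exists b'; ring.
  by exists 1%N, 1%N; split=> //; exists (a' + b' + 1); ring.
by exists 1%N, 2%N; split=> //; exists (a' + 2 * b' + 2); ring.
Qed.

(** * Units of a real quadratic field modulo cubes *)

Section RealUnits.
Variables (d : int) (d_gt0 : 0 < d) (nQ : (sqrtC d%:~R : algC) \notin Crat).
Variables (g : Aut) (gw : g (sqrtC d%:~R) = - sqrtC d%:~R).
Local Notation F := (Qsqrt d%:~R).
Let hF := @subfield_Qsqrt d%:~R.
Let Qd : (d%:~R : algC) \in Crat. Proof. exact: rpred_int. Qed.

(** Squares of units land in this torsion-free group, and since 2 is prime to 3, squaring loses
    nothing modulo cubes. *)
Definition norm1_unit (v : algC) : Prop := [/\ F v, 0 < v, v \in Aint & g v = v^-1].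

Lemma norm1_unitM u v : norm1_unit u -> norm1_unit v -> norm1_unit (u * v).
Proof.
move=> [Fu u0 Au gu] [Fv v0 Av gv]; split; [exact: (sfM hF)|exact: mulr_gt0|exact: rpredM|].
by rewrite rmorphM /= gu gv invfM.
Qed.

Lemma norm1_unitV v : norm1_unit v -> norm1_unit v^-1.
Proof.
move=> [Fv v0 Av gv]; split; [exact: (sfV hF)|by rewrite invr_gt0|by rewrite -gv Aint_aut|].
by rewrite fmorphV gv.
Qed.

Lemma norm1_unit_trace v : norm1_unit v -> exists n : nat, v + v^-1 = n%:R.
Proof.
move=> [Fv v0 Av gv]; have /intrP[t Dt] := Qsqrt_itrace Qd nQ gw (conj Fv Av).
rewrite gv in Dt; have : 0 <= t by rewrite -(ler0z algC) -Dt addr_ge0 ?invr_ge0 ?ltW.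
by case: t Dt => // n Dn _; exists n.
Qed.

Lemma Qsqrt_real x : F x -> x \is Num.real.
Proof.
move=> Fx; apply/CrealP; apply: (Qsqrt_fix Qd nQ (s := aconj)) Fx.
exact: conj_sqrt_pos.
Qed.

Lemma unit_square u : F u -> u \in Aint -> u^-1 \in Aint -> u != 0 -> norm1_unit (u ^+ 2).
Proof.
move=> Fu Au AVu nzu; split; [exact: (sfX hF)| |exact: rpredX|].
  by rewrite lt_def expf_neq0 // -realEsqr Qsqrt_real.
have /intrP[n Dn] := Qsqrt_inorm Qd nQ gw (conj Fu Au).
have /intrP[m Dm] := Qsqrt_inorm Qd nQ gw (conj (sfV hF Fu) AVu).
have nzg : g u != 0 by rewrite fmorph_eq0.
have nm : n * m = 1.
  apply: (@intr_inj algC); rewrite rmorphM /= -Dn -Dm fmorphV; field.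
  by rewrite nzu nzg.
have n2 : n ^+ 2 = 1.
  have /eqP := congr1 absz nm; rewrite abszM muln_eq1 => /andP[/eqP n1 _].
  have : (n == 1) || (n == -1) by clear -n1; lia.
  by case/orP => /eqP->.
have nz2 : u ^+ 2 != 0 by rewrite expf_neq0.
apply: (mulfI nz2); rewrite divff // rmorphXn /= -exprMn Dn -rmorphXn /= n2.
by [].
Qed.

(** The unit e > 1 of least trace generates, since dividing by e lowers the trace; if 1 is the only
    unit of this kind, then e = 1. *)
Lemma norm1_units_cyclic : exists e, norm1_unit e /\ forall v, norm1_unit v -> exists n : int, v = e ^ n.
Proof.
have U1 : norm1_unit 1.
  by split; [exact: (sf1 hF)|exact: ltr01|exact: rpred1|rewrite rmorph1 invr1].
have ge1 v : norm1_unit v -> v != 1 -> exists2 w, norm1_unit w & 1 < w /\ (v = w \/ v = w^-1).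
  move=> Uv nv1; have [Fv v0 _ _] := Uv.
  have [lt1|gt1|/eqP] := real_ltgtP (Qsqrt_real Fv) (rpred1 _); last by rewrite (negPf nv1).
    by exists v^-1; [apply: norm1_unitV|rewrite invrK invf_gt1 //; split=> //; right].
  by exists v => //; split=> //; left.
have [all1|[v [Uv nv1]]] : (forall v, norm1_unit v -> v = 1) \/ exists v, norm1_unit v /\ v != 1.
  have [ex|nex] := pselect (exists v, norm1_unit v /\ v != 1); [by right|left=> v Uv].
  by apply/eqP; apply: contrapT => /negP nv; apply: nex; exists v.
  by exists 1; split=> // v /all1->; exists 0.
pose pn (n : nat) := `[< exists v, [/\ norm1_unit v, 1 < v & v + v^-1 = n%:R] >].
have exn : exists n, pn n.
  have [w Uw [w1 _]] := ge1 v Uv nv1; have [n Dn] := norm1_unit_trace Uw.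
  by exists n; apply/asboolP; exists w.
case: (ex_minnP exn) => n /asboolP[e [Ue e1 De]] minn.
have e0 : 0 < e by case: Ue.
have pow (w : algC) : norm1_unit w -> 1 <= w -> exists k : nat, w = e ^+ k.
  move=> Uw w1; have [m Dm] := norm1_unit_trace Uw.
  elim/ltn_ind: m w Uw w1 Dm => m IHm w Uw w1 Dm.
  have [->|nw1] := eqVneq w 1; first by exists 0%N.
  have w_gt1 : 1 < w by rewrite lt_def nw1.
  have le_nm : (n <= m)%N by apply: minn; apply/asboolP; exists w.
  have le_ew : e <= w.
    have [Fe _ _ _] := Ue; have [Fw _ _ _] := Uw.
    rewrite real_leNgt ?Qsqrt_real //; apply/negP => /(trace_monotone w1).
    by rewrite De Dm ltr_nat ltnNge le_nm.
  have Uwe : norm1_unit (w / e) by apply/norm1_unitM/norm1_unitV.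
  have we1 : 1 <= w / e by rewrite ler_pdivlMr // mul1r.
  have [k Dk] := norm1_unit_trace Uwe.
  have lt_km : (k < m)%N.
    rewrite -(ltr_nat algC) -Dk -Dm; apply: trace_monotone => //.
    by rewrite ltr_pdivrMr // -[X in X < _]mulr1 ltr_pM2l // (lt_le_trans e0).
  have [j Dj] := IHm k lt_km _ Uwe we1 Dk.
  by exists j.+1; rewrite exprSr -Dj divfK // gt_eqF.
exists e; split=> // w Uw; have [->|nw1] := eqVneq w 1; first by exists 0.
have [x Ux [x1 [->|->]]] := ge1 w Uw nw1; have [k ->] := pow x Ux (ltW x1).
  by exists k.
by exists (- k%:Z); rewrite -invr_expz.
Qed.

Lemma real_units_dependent u1 u2 : F u1 -> F u2 -> u1 != 0 -> u2 != 0 ->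
  u1 \in Aint -> u1^-1 \in Aint -> u2 \in Aint -> u2^-1 \in Aint ->
  exists i j : nat, [/\ (i < 3)%N, (j < 3)%N, (0 < i + j)%N
    & exists2 v, F v & u1 ^+ i * u2 ^+ j = v ^+ 3].
Proof.
move=> F1 F2 nz1 nz2 A1 V1 A2 V2.
have [e [Ue cyc]] := norm1_units_cyclic.
have [a Da] := cyc _ (unit_square F1 A1 V1 nz1); have [b Db] := cyc _ (unit_square F2 A2 V2 nz2).
have [i [j [i3 j3 ij [c Dc]]]] := mod3_dependence a b.
have nze : e != 0 by case: Ue => _ /gt_eqF->.
(* With x = u1^i u2^j and y = e^c, the relation x^2 = y^3 gives x = (x / y)^3. *)
exists i, j; split=> //; exists (u1 ^+ i * u2 ^+ j / e ^ c).
  have [Fe _ _ _] := Ue; apply: (sfdiv hF); last exact: (sfexpz hF).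
  by apply: (sfM hF); apply: (sfX hF).
have E : (u1 ^+ i * u2 ^+ j) ^+ 2 = (e ^ c) ^+ 3.
  rewrite exprMn -!exprM ![(_ * 2)%N]mulnC !exprM Da Db.
  rewrite -[(e ^ a) ^+ i]/((e ^ a) ^ i) -[(e ^ b) ^+ j]/((e ^ b) ^ j) -[(e ^ c) ^+ 3]/((e ^ c) ^ 3).
  by rewrite !exprz_exp -expfzDr // -Dc; congr (_ ^ _); ring.
have nzc : e ^ c != 0 by rewrite expfz_neq0.
by rewrite expr_div_n -E exprS mulfK // expf_neq0 // mulf_neq0 ?expf_neq0.
Qed.
End RealUnits.

(** * Tame characters at split primes *)

Lemma coprime_pow3 l N : prime l -> l != 3 -> coprime l (3 ^ N).
Proof. by move=> pl l3; rewrite coprimeXr // prime_coprime // dvdn_prime2. Qed.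

Lemma zroot_frobenius l N : prime l -> l != 3 -> exists2 f, (0 < f)%N & zroot N ^+ (l ^ f) = zroot N.
Proof.
move=> pl l3; exists (totient (3 ^ N)); first by rewrite totient_gt0 expn_gt0.
have := Euler_exp_totient (coprime_pow3 N pl l3) => E.
by apply/eqP; rewrite -[X in _ == X]expr1 (eq_prim_root_expr (zroot_prim N)); apply/eqP.
Qed.

Section Tame.
Variables (d : int) (d_gt0 : 0 < d) (d_mod : (d = 2 %[mod 3])%Z).
Local Notation sD := (sqrtC (- 3 * d)%:~R : algC).
Local Notation sd := (sqrtC d%:~R : algC).
Variables (l : nat) (P : set algC) (hP : prime_over l P) (l3 : l != 3).
Variables (w : algC) (i j : int).
Hypotheses (Ow : int_ring (Qsqrt d%:~R) w) (nQw : w \notin Crat).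
Hypothesis wE : w ^+ 2 - w = l%:R * (i%:~R * w + j%:~R).
Variable N : nat.
Let pl := po_prime hP.
Let nzl : l%:R != 0 :> algC. Proof. by rewrite pnatr_eq0 -lt0n prime_gt0. Qed.
Let nQ := sd_irrational d_gt0 d_mod.

(** As l is prime to 3 and w is idempotent modulo l, Frobenius powers fix both generators modulo l,
    so l itself is a uniformizer of T. *)
Let T := ring_gen [set x | x = zroot N \/ x = w].
Let hT : subring T. Proof. exact: subring_gen. Qed.
Let Tz : T (zroot N). Proof. by apply: sub_ring_gen; left. Qed.
Let Tw : T w. Proof. by apply: sub_ring_gen; right. Qed.
Let Tl : T l%:R. Proof. exact: (srnat hT). Qed.
Let Tint (m : int) : T m%:~R.
Proof. by case: m => n; rewrite ?NegzE ?rmorphN /=; [|apply: (srN hT)]; apply: (srnat hT). Qed.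

Let TA : T `<=` inA P.
Proof.
apply: ring_gen_sub; first exact: (subring_inA hP).
by move=> x [->|->]; apply: (Aint_inA hP); [apply: zroot_Aint|case: Ow].
Qed.

Let wX n : exists2 t, T t & w ^+ n.+1 - w = l%:R * t.
Proof.
elim: n => [|n [t Tt E]]; first by exists 0; [exact: (sr0 hT)|rewrite expr1 subrr mulr0].
exists (w * t + (i%:~R * w + j%:~R)).
  by apply: (srD hT); [apply: (srM hT)|apply: (srD hT) => //; apply: (srM hT)].
by rewrite mulrDr -wE mulrCA -E exprS; ring.
Qed.

Let Tgood y : T y -> exists2 f, (0 < f)%N & good l T l%:R f y.
Proof.
apply: good_gen => //; first by exists 1; [exact: (sr1 hT)|rewrite mulr1].
move=> x [->|->].
  have [f f0 E] := zroot_frobenius N pl l3; exists f => //.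
  by exists 0; [exact: (sr0 hT)|rewrite E subrr mulr0].
exists 1%N => //; have [t Tt E] := wX l.-1; exists t => //.
by rewrite expn1 -E prednK // prime_gt0.
Qed.

Let Ml : inM P l%:R. Proof. exact/(P_inM hP)/(po_l hP). Qed.
Let lr : inA P (l%:R ^+ 1 / l%:R). Proof. by rewrite expr1 divff //; apply: (sr1 (subring_inA hP)). Qed.

(** The square of a lift of Frobenius fixes all square roots of integers, hence K and w; this is
    where l^2 comes from. On T it is the l^2-power map modulo l. *)
Lemma split_frobenius : exists s : Aut, GK d s /\
  (forall y, T y -> T (s y) /\ exists2 t, T t & s y - y ^+ (l ^ 2) = l%:R * t) /\
  s (zroot N) = zroot N ^+ (l ^ 2).
Proof.
have [s0 Ds0] := Qn_aut_exists (coprime_pow3 N pl l3).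
have z0 : s0 (zroot N) = zroot N ^+ l by apply: Ds0; apply: (prim_expr_order (zroot_prim N)).
pose s := acomp s0 s0; have sz : s (zroot N) = zroot N ^+ (l ^ 2).
  by rewrite acompE z0 rmorphXn /= z0 -exprM expnS expn1.
have sq m : s (sqrtC m%:~R) = sqrtC m%:~R.
  by rewrite acompE; case: (aut_sqrt_int s0 m) => E; rewrite !E // rmorphN /= E opprK.
exists s; split; first exact: sq.
split=> //; have sw : s w = w by apply: (Qsqrt_fix _ nQ (s := s)) (proj1 Ow); rewrite ?rpred_int.
pose G : set algC := [set y | T y /\ (T (s y) /\ exists2 t, T t & s y - y ^+ (l ^ 2) = l%:R * t)].
suff hG : T `<=` G by move=> y /hG[].
apply: ring_gen_sub; last first.
  move=> x [->|->]; split=> //; rewrite ?sz ?sw; split=> //; first exact: (srX hT).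
    by exists 0; [exact: (sr0 hT)|rewrite subrr mulr0].
  have [t Tt E] := wX (l ^ 2).-1; exists (- t); first exact: (srN hT).
  by rewrite mulrN -E prednK ?opprB // expn_gt0 prime_gt0.
split=> [|x y [Tx [Tsx [t Tt Et]]] [Ty [Tsy [u Tu Eu]]]|x y [Tx [Tsx [t Tt Et]]] [Ty [Tsy [u Tu Eu]]]].
- split; first exact: (sr1 hT); rewrite rmorph1; split; first exact: (sr1 hT).
  by exists 0; [exact: (sr0 hT)|rewrite expr1n subrr mulr0].
- split; first exact: (srB hT); rewrite rmorphB; split; first exact: (srB hT).
  have [r Tr ->] := frobeniusB hT 2 pl Tx Ty; exists (t - u - r).
    by apply: (srB hT) => //; apply: (srB hT).
  by rewrite !mulrBr -Et -Eu; ring.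
- split; first exact: (srM hT); rewrite rmorphM; split; first exact: (srM hT).
  exists (t * s y + x ^+ (l ^ 2) * u).
    by apply: (srD hT); apply: (srM hT) => //; apply: (srX hT).
  by rewrite mulrDr mulrA -Et mulrCA -Eu exprMn /=; ring.
Qed.

Let hF := subfield_frac hT.

Lemma split_frac : (0 < N)%N -> frac T sD /\ frac T (zroot N).
Proof.
move=> N0; have Fz := sub_frac hT Tz; split=> //.
have Fw := sub_frac hT Tw; have [p [q [Qp Qq Dw]]] := QsqrtP (rpred_int _ _) nQ (proj1 Ow).
have nzq : q != 0 by apply: contraNneq nQw => q0; rewrite Dw q0 mul0r addr0.
have Fsd : frac T sd.
  have -> : sd = (w - p) / q by rewrite Dw; field.
  by apply: (sfdiv hF); [apply: (sfB hF) => //|]; apply: (sfCrat hF).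
have Fs3 : frac T s3.
  rewrite s3_omega -(zrootX 1 N.-1) add1n prednK //.
  by apply: (sfD hF (sfM hF (sfnat hF 2) (sfX hF _ Fz)) (sf1 hF)).
by case: (sD_prod d) => ->; [|apply: (sfN hF)]; apply: (sfM hF).
Qed.

Let unit_lX (n : int) : unitA P (l%:R ^ n) -> n = 0.
Proof.
case: n => [[|n]|n] //; rewrite ?NegzE /exprz.
  by move/(unitA_nM hP); case; apply: (inM_X hP).
by move/unitA_V; rewrite invrK => /(unitA_nM hP); case; apply: (inM_X hP).
Qed.

(* At a prime split in Q(sqrt d), the decomposition group forces the valuation of the *)
(* Kummer generator of a 3^N-character to be divisible by 3^N/gcd(3^N, l^2-1). *)
Lemma tame_kummer phi S n c : gchar d phi N S -> N = (n + c)%N -> (0 < N)%N ->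
  ~~ (3 ^ c.+1 %| l ^ 2 - 1)%N ->
  exists R, kummer d N (fun s => phi s ^+ (3 ^ c)) R /\ exists k : int, unitA P (R / l%:R ^ k).
Proof.
move=> hphi DN N0 nd; have [rho [[nzr sr] _]] := kummer_exists hphi (leqnn N).
exists (rho ^+ (3 ^ c)); split; first exact: kummerX.
have [s [Gs [sT sz]]] := split_frobenius.
have [FD Fz] := split_frac N0.
set q := (l ^ 2)%N in sT sz nd; have q1 : (1 < q)%N by rewrite /q expnS expn1 (leq_trans (prime_gt1 pl)) // leq_pmulr // prime_gt0.
(* [s] acts on T modulo l as a power map, so it sends elements that are units at P to such elements
   and preserves the exponent of l. *)
have val y : frac T y -> y != 0 -> exists k : int, unitA P (y / l%:R ^ k) /\ unitA P (s y / l%:R ^ k).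
  have val0 x : T x -> x != 0 -> exists k : nat, unitA P (x / l%:R ^+ k) /\ unitA P (s x / l%:R ^+ k).
    move=> Tx nzx; have [k [a [u [Ta Tu na nu E]]]] := uniformizer_val hP hT TA Ml nzl lr Tgood Tx nzx.
    have unitT b : T b -> ~ inM P b -> unitA P b by move=> Tb nb; apply: (unitAI hP) => //; apply: TA.
    have nsM b : T b -> ~ inM P b -> ~ inM P (s b).
      move=> Tb nb Msb; have [_ [t Tt Et]] := sT _ Tb.
      have : inM P (b ^+ q).
        rewrite (_ : b ^+ q = s b - l%:R * t); last by rewrite -Et; ring.
        apply: (inM_D hP) => //; rewrite -mulrN; apply: (inM_Mr hP) => //.
        exact/(inA_N)/TA.
      by move/(unitA_nM hP (unitA_X hP q (unitT _ Tb nb))).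
    have nzlk : l%:R ^+ k != 0 :> algC by rewrite expf_neq0.
    have div a' u' x' : unitA P a' -> unitA P u' -> u' * x' = l%:R ^+ k * a' -> unitA P (x' / l%:R ^+ k).
      move=> ua uu E'; have nzu : u' != 0 by case: uu.
      have -> : x' / l%:R ^+ k = a' / u' by apply: (mulIf nzlk); apply: (mulfI nzu); rewrite divfK // E'; field.
      exact: (unitA_div hP).
    exists k; split; first by apply: (div a u) => //; apply: unitT.
    have [Tsa _] := sT _ Ta; have [Tsu _] := sT _ Tu.
    apply: (div (s a) (s u)); try by apply: unitT => //; apply: nsM.
    by rewrite -!rmorphM E rmorphM rmorphXn rmorph_nat.
  move=> [x [x' [Tx Tx' ->]]]; rewrite mulf_eq0 invr_eq0 negb_or => /andP[nzx nzx'].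
  have [k [k1 k2]] := val0 x Tx nzx; have [k' [k1' k2']] := val0 x' Tx' nzx'.
  have nzlk (e : nat) : l%:R ^+ e != 0 :> algC by rewrite expf_neq0.
  have E (b b' : algC) : b' != 0 -> b / b' / l%:R ^ (k%:Z - k'%:Z) = (b / l%:R ^+ k) / (b' / l%:R ^+ k').
    move=> nzb; rewrite expfzDr // -exprnP -invr_expz -exprnP.
    by have := nzlk k; have := nzlk k'; move: (l%:R ^+ k) (l%:R ^+ k') => A B nA nB; field; rewrite nA nB nzb.
  exists (k%:Z - k'%:Z); rewrite fmorph_div /= !E ?fmorph_eq0 //.
  by split; apply: (unitA_div hP).
have nzphi t : GK d t -> phi t != 0 by apply: (gc_neq0 hphi).
(* Conjugation by s leaves phi unchanged, while s raises its values to the power q. *)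
have ksr : kummer d N (fun t => phi t ^+ q) (s rho).
  split=> [|t Gt]; first by rewrite fmorph_eq0.
  have Gc := GN_conjugate s Gt; have GKt := GN_GK Gt.
  have : s (ainv s (t (s rho))) = s (phi (acomp (ainv s) (acomp t s)) * rho) by rewrite -(sr _ Gc).
  rewrite ainvK (gc_conjugate hphi GKt Gs) => ->; rewrite (rmorphM s) /=; congr (_ * _).
  have [a ->] := gc_zroot hphi GKt; rewrite (rmorphXn s) /= sz -!exprM; congr (_ ^+ _).
  by rewrite mulnC.
have kpr : kummer d N (fun t => phi t ^+ q) (rho ^+ q) by apply: kummerX.
set m := s rho / rho ^+ q.
have Fm : frac T m.
  by apply: (kummer_uniq hF FD Fz _ ksr kpr) => t /nzphi nz; rewrite expf_neq0.
have nzm : m != 0 by rewrite mulf_neq0 ?fmorph_eq0 // invr_eq0 expf_neq0.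
set b := rho ^+ (3 ^ N); have nzb : b != 0 by rewrite expf_neq0.
have Fb : frac T b.
  apply: (GN_fixed hF FD Fz) => t Gt; rewrite rmorphXn /= sr // exprMn (gcX hphi) ?mul1r //.
  exact: GN_GK Gt.
have sb : s b = m ^+ (3 ^ N) * b ^+ q.
  rewrite /b rmorphXn /= -exprM mulnC exprM -exprMn; congr (_ ^+ _).
  by rewrite /m divfK // expf_neq0.
have [k [ub usb]] := val b Fb nzb; have [e [um _]] := val m Fm nzm.
clearbody m.
(* Compares exponents of l in s b = m^(3^N) b^q, where s b has the same exponent k as b. *)
have Ek : k = e * (3 ^ N)%N + k * q.
  apply/eqP; rewrite -subr_eq0; apply/eqP/unit_lX.
  have nzX (r : int) : l%:R ^ r != 0 :> algC by rewrite expfz_neq0.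
  have -> : l%:R ^ (k - (e * (3 ^ N)%N + k * q)) =
      (m / l%:R ^ e) ^+ (3 ^ N) * (b / l%:R ^ k) ^+ q / (s b / l%:R ^ k).
    rewrite !expr_div_n -[(l%:R ^ e) ^+ _]/((l%:R ^ e) ^ (3 ^ N)%N) -[(l%:R ^ k) ^+ _]/((l%:R ^ k) ^ q).
    rewrite !exprz_exp opprD !expfzDr // -!invr_expz sb.
    have nA := nzX (e * (3 ^ N)%N); have nB := nzX (k * q); have nC := nzX k.
    have nD : m ^+ (3 ^ N) != 0 by rewrite expf_neq0.
    have nE : b ^+ q != 0 by rewrite expf_neq0.
    move: (l%:R ^ (e * _)) (l%:R ^ (k * _)) (l%:R ^ k) (m ^+ _) (b ^+ q) nA nB nC nD nE => A B C D E nA nB nC nD nE.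
    by field; rewrite nA nB nC nD nE.
  by apply: (unitA_div hP) => //; apply: (unitA_M hP); apply: (unitA_X hP).
(* 3^(n+c) divides k (q - 1), and q - 1 absorbs at most 3^c of it. *)
have [k' Dk] : exists k' : int, k = k' * (3 ^ n)%N%:Z.
  apply/dvdzP.
  rewrite dvdzE /=; have [->|k0] := posnP `|k|%N; first exact: dvdn0.
  have q0 : (0 < q - 1)%N by rewrite subn_gt0.
  have : (3 ^ (n + c) %| `|k| * (q - 1))%N.
    have -> : (`|k| * (q - 1))%N = absz (k * (q%:Z - 1))%R by rewrite abszM subzn // ltnW.
    rewrite -DN; suff : ((3 ^ N)%N %| (k * (q%:Z - 1))%R)%Z by rewrite dvdzE.
    apply/dvdzP; exists (- e).
    by rewrite mulNr -[e * _](addrK (k * q)) -Ek; ring.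
  rewrite pfactor_dvdn ?muln_gt0 ?k0 // lognM // => le.
  move: nd; rewrite !pfactor_dvdn // -leqNgt => le'.
  by rewrite -(leq_add2r c) (leq_trans le) // leq_add2l.
exists k'; apply: (unitA_root hP (n := (3 ^ n)%N)); first by rewrite expn_gt0.
rewrite expr_div_n -exprM -expnD addnC -DN -/b.
by rewrite -[(l%:R ^ k') ^+ _]/((l%:R ^ k') ^ (3 ^ n)%N) exprz_exp -Dk.
Qed.
End Tame.

(** * Unramified characters *)

Lemma Aint_conj (x : algC) : (x^* \in Aint) = (x \in Aint).
Proof. by rewrite -aconjE Aint_aut. Qed.

Lemma kummer_cube_trivial d chi S (R z : algC) : gchar d chi 1 S -> kummer d 1 chi R ->
  R ^+ 3 = z ^+ 3 -> (forall s, GN d 1 s -> s z = z) -> forall s, GK d s -> chi s = 1.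
Proof.
move=> h [nzR sR] E fixz; have nzz : z != 0.
  by apply: contra_eq_neq E => ->; rewrite expr0n expf_neq0.
apply: (cubic_trivial h) => s Gs; have [_ s3s] := (GN1P d s).1 Gs.
have rz : (R / z) ^+ 3 = 1 by rewrite expr_div_n E divff // expf_neq0.
have := aut_omega_id s3s rz; rewrite fmorph_div /= fixz // sR // => /(mulIf (invr_neq0 nzz)).
by rewrite -[RHS]mul1r => /(mulIf nzR).
Qed.

Section Unramified.
Variables (d : int) (d_gt0 : 0 < d) (d_mod : (d = 2 %[mod 3])%Z).
Local Notation sD := (sqrtC (- 3 * d)%:~R : algC).
Local Notation K := (Qsqrt (- 3 * d)%:~R).
Variable H : set algC.
Hypotheses (galH : is_galois K H) (unrH : unramified K H).
Let hK := @subfield_Qsqrt (- 3 * d)%:~R.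
Let hH : subfield H. Proof. by case: galH. Qed.
Let KH : K `<=` H. Proof. by case: galH. Qed.
Let nQ := sqrt_neg_irrational (D_lt0 d_gt0).
Let QD : ((- 3 * d)%:~R : algC) \in Crat. Proof. exact: rpred_int. Qed.

Lemma GK_fixK s x : GK d s -> K x -> s x = x.
Proof. by move=> Gs; apply: (Qsqrt_fix QD nQ). Qed.

Lemma GK_normal s x : GK d s -> H x -> H (s x).
Proof. by move=> Gs; apply: (galois_normal galH) => y; apply: GK_fixK. Qed.

Lemma prime_over_conj l P : prime_over l P -> prime_over l [set x | P x^*].
Proof.
move=> hP; split=> /= [||x|x y|a x|//|x y].
- exact: (po_prime hP).
- by rewrite rmorph_nat; apply: (po_l hP).
- by move/(po_Aint hP); rewrite Aint_conj.
- by rewrite rmorphD; apply: (poD hP).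
- by move=> Aa; rewrite rmorphM; apply: (poMl hP); rewrite Aint_conj.
- by rewrite rmorph1; apply: (po1 hP).
- by move=> Ax Ay; rewrite rmorphM; apply: (poM hP); rewrite Aint_conj.
Qed.

Lemma inA_conj P x : inA [set x | P x^*] x <-> inA P x^*.
Proof.
split=> -[u [Au nu Aux]]; exists u^*; rewrite ?Aint_conj; split=> //.
- by rewrite -rmorphM Aint_conj.
- by rewrite /= conjCK.
- by rewrite -Aint_conj rmorphM /= !conjCK.
Qed.

Lemma inM_conj P x : inM P x^* -> inM [set x | P x^*] x.
Proof.
move=> [u [Au nu Pux]]; exists u^*; split; first by rewrite Aint_conj.
  by rewrite /= conjCK.
by rewrite /= rmorphM /= conjCK.
Qed.

(** A character of H and its conjugate under c involve both H and its complex conjugate.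
    Uniformizers x at P and y at the conjugate prime lie in K, and x serves for both fields because
    it divides y^* at P. *)
Lemma unramified_compositum l P zeta f : prime_over l P -> zeta \in Aint -> (0 < f)%N ->
  zeta ^+ (l ^ f) = zeta ->
  exists F, [/\ subfield F, H `<=` F, forall x, H x^* -> F x, F zeta
    & forall z, F z -> z != 0 -> exists k : int, unitA P (z ^+ 2 / l%:R ^ k)].
Proof.
move=> hP Az f0 zE; have hPc := prime_over_conj hP.
have [x [Kx Px nzx xH]] := unramified_uniformizer hP hH unrH.
have [y [Ky Py nzy yH]] := unramified_uniformizer hPc hH unrH.
have Kc z : K z -> K z^* by rewrite -aconjE; apply: Qsqrt_stable.
pose cH : set algC := [set z | H z^*].
have hcH : subfield cH := subfield_preim aconj hH.
pose Ls := [set L | L = H \/ L = cH].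
have hLs L : Ls L -> subfield L by case=> ->.
have Lx L : Ls L -> L x by case=> ->; [apply: KH|apply: (KH (Kc _ Kx))].
have Mx : inM P x by apply: (P_inM hP).
have cD := aconj_sD d_gt0.
have x2 : inA P (x ^+ 2 / l%:R) by apply: (Qsqrt_ramification QD nQ cD hP).
have unif L : Ls L -> forall z, L z -> inM P z -> inA P (z / x).
  case=> -> z Lz Mz; first exact: xH.
  have nzcy : y^* != 0 by rewrite fmorph_eq0.
  have -> : z / x = z / y^* * (y^* / x) by field; rewrite nzx nzcy.
  apply: (inA_M hP); last by apply: xH; [exact: (KH (Kc _ Ky))|exact: (P_inM hP)].
  rewrite -[z / _]conjCK; apply/inA_conj; rewrite fmorph_div /= conjCK; apply: yH => //.
  by apply: inM_conj; rewrite conjCK.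
exists (unramified_field P Ls zeta).
have LsH : Ls H by left.
have nLs : exists L, Ls L by exists H.
split.
- exact: subfield_unramified_field.
- by move=> z; apply: (unramified_field_L hP zeta hLs LsH).
- by move=> z Hz; apply: (unramified_field_L hP zeta hLs (or_intror erefl : Ls cH)).
- exact: unramified_field_zeta.
- exact: (unramified_field_val hP hLs nLs Lx nzx Mx x2 unif Az f0 zE).
Qed.

Lemma gchar_cconj chi n S : gchar d chi n S -> gchar d (fun s => chi (cconj s)) n (map aconj S).
Proof.
move=> h; have Gc := GK_cconj d_gt0; split=> [s t Gs Gt|s Gs|s Gs fix_s].
- rewrite -(gcM h (Gc _ Gs) (Gc _ Gt)); apply: (gc_eq h).
  + by apply: Gc; apply: GK_comp.
  + by apply: GK_comp; apply: Gc.
  + by move=> x; rewrite !acompE aconjK.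
- exact: (gcX h (Gc _ Gs)).
- apply: (gcS h); first exact: Gc.
  move=> x Sx; rewrite cconjE -!aconjE [s _]fix_s ?aconjK //.
  exact: map_f.
Qed.

Lemma cubic_plus_trivial chi S : gchar d chi 1 S -> (forall x, x \in S -> H x \/ H x^*) ->
  (forall s, GK d s -> chi (cconj s) = chi s) -> forall s, GK d s -> chi s = 1.
Proof.
move=> h SH chic; have [R [n [kR AR FR Fn n3]]] := kummer_descent_plus d_gt0 d_mod h chic.
have [nzR sR] := kR; set alpha := R ^+ 3 in AR FR n3.
have nza : alpha != 0 by rewrite expf_neq0.
have gen F : subfield F -> H `<=` F -> (forall x, H x^* -> F x) ->
    (forall s x, GK d s -> x \in S -> F (s x)) /\ F sD.
  move=> hF HF cHF; split; last by apply: HF; apply: KH; apply: Qsqrt_sqrt.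
  move=> s x Gs /SH[Hx|Hx]; first by apply: HF; apply: GK_normal.
  apply: cHF; have -> : (s x)^* = cconj s x^* by rewrite cconjE conjCK.
  by apply: GK_normal => //; apply: GK_cconj.
have local l P : prime_over l P -> exists x, [/\ x != 0, K3 x & unitA P (x ^+ 3 / alpha)].
  move=> hP; apply: (local_cube s3_irrational s3_conj hP nza FR Fn n3) => w Ow Pw nPcw.
  have l3 := split_prime_neq3 s3_irrational (or_intror erefl) s3_conj hP Ow Pw nPcw.
  have [f f0 zE] := zroot_frobenius 1 (po_prime hP) l3.
  have [F [hF HF cHF Fz valF]] := unramified_compositum hP (zroot_Aint 1) f0 zE.
  have [FS FD] := gen F hF HF cHF.
  have [R' [kR' FR']] := kummer_exists h (leqnn 1).
  have {}FR' := FR' F hF FS Fz; have nzR' : R' != 0 by case: kR'.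
  have FRR : F (R / R') by apply: (kummer_uniq hF FD Fz _ kR kR') => s; apply: (gc_neq0 h).
  have FRR' : F R by rewrite -(divfK nzR' R); apply: (sfM hF).
  have [k uk] := valF R FRR' nzR; exists k.
  have -> : alpha ^+ 2 / l%:R ^ (k * 3) = (R ^+ 2 / l%:R ^ k) ^+ 3.
    by rewrite expr_div_n -exprz_exp -!exprM.
  exact: (unitA_X hP).
have [b [Fb nzb Ab AVb]] := eisenstein_cube (conj FR AR) nza local.
have fixK3 s x : GN d 1 s -> K3 x -> s x = x.
  by move=> /GN1P[_ s3s]; apply: (Qsqrt_fix _ s3_irrational); rewrite ?rpred_int.
have done_if z : K3 z -> R ^+ 3 = z ^+ 3 -> forall s, GK d s -> chi s = 1.
  by move=> Fz E; apply: (kummer_cube_trivial h kR E) => s Gs; apply: fixK3.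
have hF3 := @subfield_Qsqrt (- 3)%:~R.
set u := alpha / b ^+ 3 in AVb; have nzu : u != 0 by rewrite mulf_neq0 ?invr_eq0 ?expf_neq0.
have Fu : K3 u by apply: (sfdiv hF3) => //; apply: (sfX hF3).
have AVu : u^-1 \in Aint by rewrite invf_div.
have Ealpha : R ^+ 3 = u * b ^+ 3 by rewrite divfK // expf_neq0.
case: (K3_unit Fu AVb AVu) => [[v Fv Ev]|[e Ee]].
  by apply: (done_if (v * b)); [exact: (sfM hF3)|rewrite exprMn -Ev].
exfalso.
set eps : algC := (-1) ^+ e in Ee; have eps2 : eps ^+ 2 = 1 by rewrite /eps -exprM mulnC exprM sqrrN !expr1n.
have nzeps : eps != 0 by rewrite signr_eq0.
(* A primitive ninth root of unity: chi would belong to the real cubic field of conductor 9, which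
   is ramified at 3. *)
pose theta := eps * R / b; have nzt : theta != 0 by rewrite !mulf_neq0 ?invr_eq0.
have t3 : theta ^+ 3 = eps * u.
  by rewrite /theta expr_div_n exprMn Ealpha mulrA mulfK ?expf_neq0 // exprS eps2 mulr1.
have tE : theta ^+ 6 + theta ^+ 3 + 1 = 0 by rewrite -Ee -t3 -exprM.
have t9 : (theta ^+ 3) ^+ 3 = 1.
  apply/eqP; rewrite -subr_eq0 (_ : _ - 1 = (theta ^+ 3 - 1) * (theta ^+ 6 + theta ^+ 3 + 1)); last by ring.
  by rewrite tE mulr0.
have At : theta \in Aint by apply: (@Aint_exp _ 9) => //; rewrite (exprM _ 3 3) t9 rpred1.
have AVt : theta^-1 \in Aint by apply: (@Aint_exp _ 9) => //; rewrite exprVn (exprM _ 3 3) t9 invr1 rpred1.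
(* The shift by 1 makes the cubic equation Eisenstein at 3. *)
pose delta := theta + theta^-1 + 1.
have dE : delta ^+ 3 = 3 * (delta ^+ 2 - 1).
  apply/eqP; rewrite -subr_eq0; apply/eqP.
  transitivity ((theta ^+ 6 + theta ^+ 3 + 1) / theta ^+ 3); last by rewrite tE mul0r.
  by rewrite /delta; field.
have Ad : delta \in Aint by rewrite !rpredD.
have [P hP] := prime_over_exists (isT : prime 3).
have [F [hF HF cHF _ valF]] := unramified_compositum hP (rpred1 _) (isT : (0 < 1)%N) (expr1n _ _).
have [FS FD] := gen F hF HF cHF.
(* An automorphism t fixing K and S has chi t = 1, so it fixes theta if it fixes omega. Otherwise
   theta times its image is a cube root of unity both fixed and inverted by t, hence 1, and t
   inverts theta; delta is fixed either way. *)
have Fd : F delta.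
  apply: (@galois_fixed F (sD :: S)) => // [x|t tS].
    by rewrite inE => /orP[/eqP->//|Sx]; apply: (FS aid).
  have Gt : GK d t by apply: tS; rewrite mem_head.
  have ct : chi t = 1 by apply: (gcS h) => // x Sx; apply: tS; rewrite inE Sx orbT.
  have seps (s : Aut) : s eps = eps by rewrite /eps rmorphXn rmorphN1.
  have fixt s : GN d 1 s -> chi s = 1 -> s theta = theta.
    move=> Gs cs; rewrite /theta fmorph_div rmorphM /= seps (fixK3 s b Gs Fb).
    by rewrite sR // cs mul1r.
  have tt : t (t theta) = theta.
    rewrite -acompE; apply: fixt; first exact: GN1_sqr.
    by rewrite (gcM h) // ct mulr1.
  case: (aut_sqrt_int t (- 3)) => t3s.
    have tth : t theta = theta by apply: fixt => //; apply/GN1P.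
    by rewrite /delta !rmorphD fmorphV rmorph1 /= tth.
  pose rho := t theta * theta.
  have r3 : rho ^+ 3 = 1.
    rewrite exprMn -rmorphXn /= (aut_omega_inv t3s t9) mulVf //.
    by rewrite expf_neq0.
  have tr : t rho = rho by rewrite rmorphM /= tt mulrC.
  have r1 : rho = 1.
    have nzr : rho != 0 by apply/eqP => r0; have /eqP := r3; rewrite r0 expr0n /= eq_sym oner_eq0.
    have := aut_omega_inv t3s r3; rewrite tr => Er.
    have r2 : rho ^+ 2 = 1 by rewrite expr2 {2}Er divff.
    by have := r3; rewrite exprSr r2 mul1r.
  have tth : t theta = theta^-1 by apply: (mulIf nzt); rewrite mulVf.
  by rewrite /delta !rmorphD fmorphV rmorph1 /= tth invrK [theta^-1 + _]addrC.
have nzd : delta != 0.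
  apply/eqP => d0; have /eqP := dE; rewrite d0 !expr0n /= sub0r mulrN1 eq_sym oppr_eq0.
  by rewrite pnatr_eq0.
have [k uk] := valF delta Fd nzd.
have Pd : P delta.
  apply: (po_X hP (n := 3)) => //; rewrite dE; apply: (poMr hP); last exact: (po_l hP).
  by rewrite rpredB ?rpredX ?rpred1.
have ud : unitA P (delta ^+ 2 - 1).
  apply: (unitAI hP); first by apply: (Aint_inA hP); rewrite rpredB ?rpredX ?rpred1.
  move=> M1; apply: (inM1 hP); rewrite (_ : 1 = delta * delta + - 1 * (delta ^+ 2 - 1)); last by ring.
  apply: (inM_D hP); first by apply: (inM_Ml hP); [exact: (Aint_inA hP)|exact: (P_inM hP)].
  by apply: (inM_Ml hP) => //; apply: (Aint_inA hP); rewrite rpredN rpred1.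
have nz3 : (3%:R : algC) != 0 by rewrite pnatr_eq0.
(* Cubing the unit delta^2 / 3^k and inserting delta^3 = 3 (delta^2 - 1) makes 3^(3k-2) a unit, but
   3 k = 2 is impossible. *)
have u3 : unitA P (3%:R ^ (k * 3 - 2)).
  have -> : 3%:R ^ (k * 3 - 2) = (delta ^+ 2 - 1) ^+ 2 / (delta ^+ 2 / 3%:R ^ k) ^+ 3 :> algC.
    have nz3k : (3%:R ^ k : algC) != 0 by rewrite expfz_neq0.
    have nzd2 : delta ^+ 2 - 1 != 0 by case: ud.
    rewrite expfzDr // -exprz_exp -[(_ ^ k) ^ 3]/((_ ^ k) ^+ 3) -invr_expz -[3%:R ^ 2]/(3%:R ^+ 2).
    have -> : (delta ^+ 2 / 3%:R ^ k) ^+ 3 = (delta ^+ 3) ^+ 2 / (3%:R ^ k) ^+ 3.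
      by rewrite expr_div_n -!exprM.
    by rewrite dE; move: (3%:R ^ k) nz3k (delta ^+ 2 - 1) nzd2 => A nA B nB; field; rewrite nA nB.
  by apply: (unitA_div hP); apply: (unitA_X hP).
have M3 : inM P 3%:R by apply/(P_inM hP)/(po_l hP).
have : k * 3 - 2 != 0 by clear; lia.
move: (k * 3 - 2) u3 => [[|m]|m] // u3 _.
  by apply: (unitA_nM hP u3); apply: (inM_X hP).
by move: u3; rewrite NegzE /exprz => /unitA_V; rewrite invrK => /(unitA_nM hP); apply; apply: (inM_X hP).
Qed.
End Unramified.

(** * Unramified characters times powers of phi_m *)

Section UnramifiedCharacters.
Variables (d : int) (d_gt0 : 0 < d) (d_mod : (d = 2 %[mod 3])%Z).
Local Notation sD := (sqrtC (- 3 * d)%:~R : algC).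
Local Notation sd := (sqrtC d%:~R : algC).
Local Notation K := (Qsqrt (- 3 * d)%:~R).
Local Notation Kd := (Qsqrt d%:~R).
Variable H : set algC.
Hypotheses (galH : is_galois K H) (unrH : unramified K H).
Hypothesis class_number_Kd : ~~ (3 %| class_number Kd)%N.
Let KH : K `<=` H. Proof. by case: galH. Qed.
Let nQd := sd_irrational d_gt0 d_mod.
Let Qd : (d%:~R : algC) \in Crat. Proof. exact: rpred_int. Qed.
Let hKd := @subfield_Qsqrt d%:~R.

Lemma plus_trivial psi n S : gchar d psi n S -> (forall x, x \in S -> H x \/ H x^*) ->
  (forall s, GK d s -> psi (cconj s) = psi s) -> forall s, GK d s -> psi s = 1.
Proof.
move=> h SH psic; elim: n h => [|n IHn] h.
  by move=> s Gs; rewrite -(gcX h Gs) expn0 expr1.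
have hn : gchar d (fun s => psi s ^+ (3 ^ n)) 1 S.
  by apply: (gchar_exponent (gcharX _ h)) => s Gs; rewrite expn1 -exprM -expnSr (gcX h).
apply: IHn; apply: (gchar_exponent h).
by apply: (cubic_plus_trivial d_gt0 d_mod galH unrH hn) => // t Gt; rewrite psic.
Qed.

(** psi times its conjugate is fixed by c, and is trivial on automorphisms fixing finitely many
    elements of H and of its complex conjugate. *)
Lemma unramified_dihedral psi n S : gchar d psi n S -> (forall x, x \in S -> H x) ->
  forall s, GK d s -> psi (cconj s) = (psi s)^-1.
Proof.
move=> h SH s Gs; have h' := gcharM h (gchar_cconj d_gt0 h).
have cc t : GK d t -> psi (cconj (cconj t)) = psi t.
  move=> Gt; have Gc := GK_cconj d_gt0; apply: (gc_eq h) => //; first by do 2!apply: (Gc).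
  by move=> x; rewrite !cconjE !conjCK.
have triv : psi s * psi (cconj s) = 1.
  apply: (plus_trivial h') => // [x|t Gt]; last by rewrite cc // mulrC.
  by rewrite mem_cat => /orP[/SH|/mapP[y /SH Hy ->]]; [left|right; rewrite aconjE conjCK].
by rewrite -[LHS]mul1r -[in LHS](mulVf (gc_neq0 h Gs)) -mulrA triv mulr1.
Qed.

Section Dihedral.
Variables (phi : nat -> Aut -> algC) (T : nat -> seq algC).
Hypothesis gphi : forall n, gchar d (phi n) n (T n).
Hypothesis phiX : forall n c s, GK d s -> phi (n + c)%N s ^+ (3 ^ c) = phi n s.
Hypothesis phic : forall n s, GK d s -> phi n (cconj s) = (phi n s)^-1.

(** The shape psi phi_m^i covers both uses: characters coming from H, and phi_1 itself with psi =
    1. *)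
Lemma cubic_unit psi m S i chi U : (0 < m)%N -> gchar d psi m S -> (forall x, x \in S -> H x) ->
  gchar d chi 1 U -> (forall s, GK d s -> chi s = psi s * phi m s ^+ i) ->
  exists R u b, [/\ kummer d 1 chi R, R ^+ 3 = u * b ^+ 3, b != 0, Kd b
    & [/\ Kd u, u \in Aint, u^-1 \in Aint & u != 0]].
Proof.
move=> m0 h SH hc chiE.
have chic s : GK d s -> chi (cconj s) = (chi s)^-1.
  move=> Gs; have Gc := GK_cconj d_gt0 Gs.
  by rewrite !chiE // (unramified_dihedral h SH) // phic // invfM exprVn.
have [g [gd gD [R [n [kR AR FR Fn n3]]]]] := kummer_descent_minus d_gt0 d_mod hc chic.
have [nzR sR] := kR; set alpha := R ^+ 3 in AR FR n3.
have nza : alpha != 0 by rewrite expf_neq0.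
have local l P : prime_over l P -> exists x, [/\ x != 0, Kd x & unitA P (x ^+ 3 / alpha)].
  move=> hP; apply: (local_cube nQd gd hP nza FR Fn n3) => w Ow Pw nPgw.
  have pl := po_prime hP.
  have l3 := split_prime_neq3 nQd (or_introl d_mod) gd hP Ow Pw nPgw.
  have [w1 [i1 [j1 [Ow1 nQw1 w1E]]]] := split_prime Qd nQd gd hP Ow Pw nPgw.
  (* [tame_kummer] loses exactly this much divisibility by 3, so a generator of phi_(m+c) is used to
     get one of phi_m with integral valuation. *)
  pose c := logn 3 (l ^ 2 - 1); pose N := (m + c)%N.
  have c3 : ~~ (3 ^ c.+1 %| l ^ 2 - 1)%N.
    by rewrite pfactor_dvdn ?ltnn // subn_gt0 -{1}(exp1n 2) ltn_exp2r // prime_gt1.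
  have N0 : (0 < N)%N by rewrite addn_gt0 m0.
  have [R1 [kR1 [k1 uk1]]] := tame_kummer d_gt0 d_mod hP l3 Ow1 nQw1 w1E (gphi N) erefl N0 c3.
  have [f f0 zE] := zroot_frobenius N pl l3.
  have [F [hF HF _ Fz valF]] := unramified_compositum d_gt0 galH unrH hP (zroot_Aint N) f0 zE.
  have FD : F sD by apply: HF; apply: KH; apply: Qsqrt_sqrt.
  have Fzm : F (zroot m) by rewrite -(zrootX m c); apply: (sfX hF).
  have [R0 [kR0 FR0]] := kummer_exists h (leq_addr c m).
  have {}FR0 : F R0.
    by apply: FR0 => // s x Gs /SH Hx; apply: HF; apply: (GK_normal d_gt0 galH).
  have [nzR0 _] := kR0; have [nzR1 _] := kR1.
  pose R' := R0 * R1 ^+ i; have nzR' : R' != 0 by rewrite mulf_neq0 ?expf_neq0.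
  have kR' : kummer d N chi R'.
    apply: kummer_ext (kummerM kR0 (kummerX i kR1)) => s Gs.
    by rewrite chiE // phiX.
  have FRR : F (R / R').
    apply: (kummer_uniq hF FD Fz _ (kummer_le N0 kR) kR') => s; exact: (gc_neq0 hc).
  (* Thus R = z R1^i with z in the compositum F; R1 itself need not lie in F, but its valuation is
     integral. *)
  pose z := R / R' * R0; have Fzz : F z by apply: (sfM hF).
  have nzz : z != 0 by rewrite !mulf_neq0 ?invr_eq0.
  have [k uk] := valF z Fzz nzz; exists (k + k1 * (i * 2)%:Z).
  have nzl : l%:R != 0 :> algC by rewrite pnatr_eq0 -lt0n (prime_gt0 pl).
  have nzlk1 : l%:R ^ k1 != 0 :> algC by rewrite expfz_neq0.
  have nzlk : l%:R ^ k != 0 :> algC by rewrite expfz_neq0.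
  have RE : R = z * R1 ^+ i by rewrite /z /R' ; field; rewrite expf_neq0.
  rewrite -exprz_exp -[(_ ^ _) ^ 3]/(_ ^+ 3) expfzDr // -exprz_exp -[(_ ^ _) ^ _]/(_ ^+ (i * 2)%N).
  have -> : alpha ^+ 2 / (l%:R ^ k * (l%:R ^ k1) ^+ (i * 2)) ^+ 3
      = (z ^+ 2 / l%:R ^ k * (R1 / l%:R ^ k1) ^+ (i * 2)) ^+ 3.
    have -> : alpha ^+ 2 = (z ^+ 2 * R1 ^+ (i * 2)) ^+ 3 by rewrite /alpha {1}RE !exprM; ring.
    by rewrite expr_div_n mulf_div expr_div_n.
  apply: (unitA_X hP); apply: (unitA_M hP) => //; exact: (unitA_X hP).
have stab J rho : nonzero_ideal Kd J -> Kd rho -> (forall x, J x -> J (rho * x)) -> rho \in Aint.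
  exact: (Qsqrt_stabilizer Qd nQd gd).
have [b [Fb nzb Ab AVb]] := cube_of_class_number hKd (conj FR AR) nza local stab class_number_Kd.
exists R, (alpha / b ^+ 3), b; split=> //; first by rewrite divfK // expf_neq0.
split; [|exact: AVb|by rewrite invf_div|by rewrite mulf_neq0 ?invr_eq0 ?expf_neq0].
by apply: (sfdiv hKd) => //; apply: (sfX hKd).
Qed.

Hypothesis phi1_neq1 : exists2 s, GK d s & phi 1 s != 1.

(* The units of [Kd] modulo cubes form a group of order three. *)
Lemma cubic_power psi m S i chi U : (0 < m)%N -> gchar d psi m S -> (forall x, x \in S -> H x) ->
  gchar d chi 1 U -> (forall s, GK d s -> chi s = psi s * phi m s ^+ i) ->
  exists j, forall s, GK d s -> chi s = phi 1 s ^+ j.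
Proof.
move=> m0 h SH hc chiE.
have h1 : gchar d (fun=> 1) 1 [::] by split=> *; rewrite ?mulr1 ?expr1n.
have [R1 [u1 [b1 [kR1 E1 nzb1 Fb1 [Fu1 Au1 AVu1 nzu1]]]]] := cubic_unit m0 h SH hc chiE.
have E2 s : GK d s -> phi 1 s = 1 * phi 1 s ^+ 1 by rewrite mul1r expr1.
have S0 x : x \in [::] -> H x by [].
have [R2 [u2 [b2 [kR2 {}E2 nzb2 Fb2 [Fu2 Au2 AVu2 nzu2]]]]] := cubic_unit (isT : (0 < 1)%N) h1 S0 (gphi 1) E2.
have [g [_ _ gd]] := flip_exists d_gt0 d_mod.
have [a1 [a2 [a1l a2l a0 [v Fv vE]]]] :=
  real_units_dependent d_gt0 nQd gd Fu1 Fu2 nzu1 nzu2 Au1 AVu1 Au2 AVu2.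
pose lam := fun s => chi s ^+ a1 * phi 1 s ^+ a2.
have hl : gchar d lam 1 (U ++ T 1) by exact: (gcharM (gcharX a1 hc) (gcharX a2 (gphi 1))).
have kl : kummer d 1 lam (R1 ^+ a1 * R2 ^+ a2) by exact: (kummerM (kummerX a1 kR1) (kummerX a2 kR2)).
have laml s : GK d s -> lam s = 1.
  pose z := v * b1 ^+ a1 * b2 ^+ a2; apply: (kummer_cube_trivial hl kl (z := z)) => [|{}s Gs].
    by rewrite /z !exprMn -vE -!exprM ![(_ * 3)%N]mulnC !exprM E1 E2 !exprMn; ring.
  have [sDD s33] := (GN1P d s).1 Gs; apply: (Qsqrt_fix Qd nQd).
    by have := (aut_sD_prod d s).1 sDD; rewrite s33 => /(mulIf s3_neq0).
  by apply: (sfM hKd); [apply: (sfM hKd)|]; rewrite ?Fv //; apply: (sfX hKd).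
(* In chi^a1 phi_1^a2 = 1 the exponent a1 is nonzero, or phi_1 would be trivial. So a1^2 = 1 modulo
   3, and chi = phi_1^(- a1 a2) = phi_1^(2 a1 a2). *)
exists (a1 * a2 * 2)%N => s Gs; have := laml s Gs; have := gcX hc Gs; have := gcX (gphi 1) Gs.
rewrite /lam !expn1 => p3 c3 /(congr1 (fun x => x ^+ a1)); rewrite expr1n exprMn -!exprM [(a2 * a1)%N]mulnC => E.
have a1_neq0 : a1 != 0.
  apply/eqP => a10; have [t Gt /eqP] := phi1_neq1; apply.
  move: a10 a2l a0 (laml t Gt) (gcX (gphi 1) Gt); rewrite /lam expn1 => ->; rewrite expr0 mul1r.
  case: a2 {vE lam hl kl laml E} => [|[|[|k]]] // _ _.
  by move=> E2'; rewrite exprSr E2' mul1r.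
have aa : chi s ^+ (a1 * a1) = chi s.
  by move: a1_neq0 a1l; case: (a1) => [|[|[|]]] // _ _; rewrite (exprD _ 3 1) c3 mul1r.
rewrite aa in E; move: E p3; set q := phi 1 s => E p3.
have qq : (q ^+ (a1 * a2)) ^+ 3 = 1 by rewrite exprAC p3 expr1n.
by rewrite exprM -[LHS]mulr1 -qq exprS mulrA E mul1r.
Qed.
End Dihedral.
End UnramifiedCharacters.

(** * Characters of the Hilbert class field and of the anticyclotomic extension *)

Section FiniteAbelian.
Variables (d : int) (H : set algC) (h : nat).
Local Notation K := (Qsqrt (- 3 * d)%:~R).
Hypothesis nQ : (sqrtC (- 3 * d)%:~R : algC) \notin Crat.
Hypotheses (galH : is_galois K H) (abH : forall s t, Gal H K s -> Gal H K t -> s \o t = t \o s).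
Hypothesis cardH : (Gal H K #= `I_(3 ^ h)%N)%card.
Let hH : subfield H. Proof. by case: galH. Qed.
Let QD : ((- 3 * d)%:~R : algC) \in Crat. Proof. exact: rpred_int. Qed.

(* Cayley's embedding makes [Gal H K] a finite group, whose irreducible characters are linear. *)
Lemma characters_separate (t : Aut) : GK d t ->
  (forall psi S, gchar d psi h S -> (forall x, x \in S -> H x) -> psi t = 1) ->
  forall x, H x -> t x = x.
Proof.
move=> Gt triv.
pose n := (3 ^ h)%N.
have [r [rS rI rR]] : exists r : (algC -> algC) -> nat, set_bij (Gal H K) `I_n r by exact: (elimT card_set_bijP cardH).
have inv_r (i : 'I_n) : exists g, Gal H K g /\ r g = i by have [g Gg] := rR i (ltn_ord i); exists g.
pose e i := projT1 (cid (inv_r i)).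
have eG i : Gal H K (e i) by case: (projT2 (cid (inv_r i))).
have re i : r (e i) = i by case: (projT2 (cid (inv_r i))).
have eI i j : e i = e j -> i = j by move=> E; apply: val_inj; rewrite /= -!re E.
have eR g : Gal H K g -> exists i, e i = g.
  by move=> Gg; exists (Ordinal (rS g Gg)); apply: rI; rewrite ?inE // re.
have mul_ex i j : exists k, e k = e i \o e j by apply: eR; apply: Gal_comp.
pose mul i j := projT1 (cid (mul_ex i j)).
have mulE i j : e (mul i j) = e i \o e j := projT2 (cid (mul_ex i j)).
have mulI i : injective (mul i).
  move=> j k /(congr1 e); rewrite !mulE => E; apply: eI; apply/funext => x.
  have [ei _ _] := eG i; have [[_ _ _ oj] jH _] := eG j; have [[_ _ _ ok] kH _] := eG k.
  have [Hx|nHx] := pselect (H x); last by rewrite oj // ok.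
  by apply: (emb_inj hH ei); [rewrite -jH; exists x|rewrite -kH; exists x|exact: (congr1 (fun g => g x) E)].
pose p i : 'S_n := perm (@mulI i).
(* Products of permutations compose on the other side, so p reverses the order; the group is
   abelian. *)
have pM i j : (p i * p j)%g = p (mul j i).
  by apply/permP => k; rewrite permM !permE; apply: eI; rewrite !mulE.
have [i0 ei0] := eR id (Gal_id H K).
have pI i j : p i = p j -> i = j.
  move=> /permP/(_ i0); rewrite !permE => /(congr1 e); rewrite !mulE ei0 => E.
  by apply: eI; apply/funext => x; exact: (congr1 (fun g => g x) E).
have p1 : p i0 = 1%g.
  by apply/permP => k; rewrite permE perm1; apply: eI; rewrite mulE ei0.
pose A := [set p i | i : 'I_n]%SET.
have memA i : p i \in A by apply: imset_f.
have gA : group_set A.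
  apply/group_setP; split; first by rewrite -p1.
  by move=> _ _ /imsetP[i _ ->] /imsetP[j _ ->]; rewrite pM.
pose G := Group gA.
have cardG : #|G| = n by rewrite card_imset ?card_ord //; exact: pI.
have abG : abelian G.
  apply/centsP => _ /imsetP[i _ ->] _ /imsetP[j _ ->]; rewrite /commute !pM; congr p; apply: eI.
  by rewrite !mulE abH.
pose pi_ (s : Aut) : 'S_n := oapp p 1%g [pick i | `[< e i = restr H s >]].
have piE s : GK d s -> exists2 i, e i = restr H s & pi_ s = p i.
  move=> Gs; rewrite /pi_; case: pickP => [i /asboolP E|none]; first by exists i.
  have [i Ei] := eR _ (restr_Gal galH (fun x => @Qsqrt_fix _ QD nQ s x Gs)).
  by have /asboolP := none i; rewrite Ei.
(* Some element of H is moved by [e k] unless [e k] is trivial; these finitely many elements witness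
   the continuity of the characters. *)
have sep k : exists2 x, H x & e k x = x -> forall y, H y -> e k y = y.
  have [ex|nex] := pselect (exists2 x, H x & e k x <> x); first by case: ex => x Hx nx; exists x.
  exists 0 => [|_ y Hy]; first exact: (sf0 hH).
  by apply: contrapT => ny; apply: nex; exists y.
pose y k := projT1 (cid2 (sep k)).
have Hy k : H (y k) by rewrite /y; case: (cid2 (sep k)).
have yP k : e k (y k) = y k -> e k = id.
  rewrite /y; case: (cid2 (sep k)) => x Hx /= P /P ek; apply/funext => z.
  have [Hz|nHz] := pselect (H z); first exact: ek.
  by have [[_ _ _ ok] _ _] := eG k; rewrite ok.
pose S := [seq y k | k : 'I_n].
have char i : gchar d (fun s => 'chi[G]_i (pi_ s)) h S.
  have lin : 'chi[G]_i \is a linear_char by move/char_abelianP: abG; apply.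
  split=> [s u Gs Gu|s Gs|s Gs fixs].
  - have [j ej ->] := piE s Gs; have [k ek ->] := piE u Gu.
    have [m em ->] := piE _ (GK_comp Gs Gu).
    have -> : m = mul j k.
      apply: eI; rewrite em mulE ej ek; apply: restr_comp galH _ => x.
      exact: (Qsqrt_fix QD nQ Gu).
    by rewrite -pM lin_charM ?memA // mulrC.
  - have [j ej ->] := piE s Gs; rewrite -lin_charX ?memA //.
    have := expg_cardG (memA j : p j \in G); rewrite cardG /n => ->.
    by rewrite lin_char1.
  - have [j ej ->] := piE s Gs; suff -> : j = i0 by rewrite p1 lin_char1.
    apply: eI; rewrite ei0; apply: yP; rewrite ej restrE // fixs //.
    by apply: map_f; rewrite mem_enum.
have [j ej pj] := piE t Gt.
have : p j \in (\bigcap_i cfker 'chi[G]_i)%SET.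
  apply/bigcapP => i _; have lin : 'chi[G]_i \is a linear_char by move/char_abelianP: abG; apply.
  rewrite cfkerEirr inE lin_char1 // -pj; apply/eqP; apply: triv (char i) _ => _ /mapP[k _ ->].
  exact: Hy.
rewrite TI_cfker_irr inE -p1 => /eqP/pI ji x Hx.
by rewrite -(restrE t Hx) -ej ji ei0.
Qed.
End FiniteAbelian.

(** In a product of discrete spaces a basic open set constrains finitely many coordinates. *)
Lemma nbhs_pointwise (x : Gal_space) (A : set Gal_space) : nbhs x A ->
  exists S : seq algC, forall y : Gal_space, (forall a, a \in S -> y a = x a) -> A y.
Proof.
rewrite nbhsE => -[_ [[Q Qfin <-] [V QV Vx]] VA]; have [L Lsub VE] := Qfin _ QV.
have coord (M : set Gal_space) : M \in L -> exists a, forall y : Gal_space, y a = x a -> M y.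
  move=> LM; have Mx : M x by have := Vx; rewrite -VE; apply.
  have /set_mem[a _ [B _ EM]] := Lsub M LM.
  by exists a => y ya; move: Mx; rewrite -EM /= ya.
pose c M := if pselect (M \in L) is left LM then projT1 (cid (coord M LM)) else 0.
exists [seq c M | M <- L] => y yx; suff Vy : V y by apply: VA; exists V.
move: VE; case: _ / => M /= LM.
have := yx _ (map_f c LM); rewrite /c; case: pselect => // LM'.
by case: (cid _) => /= a; apply.
Qed.

Lemma finite_continuity (f : Gal_space -> padic_space * bool) (G : set Gal_space) n x :
  {within G, continuous f} -> G x ->
  exists S : seq algC, forall y, G y -> (forall a, a \in S -> y a = x a) -> (f y).1 n = (f x).1 n.
Proof.
move=> /subspace_continuousP cf Gx.
have nU : nbhs (f x) [set u | u.1 n = (f x).1 n].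
  have nU : nbhs (f x).1 [set a : padic_space | a n = (f x).1 n].
    have pc := @proj_continuous nat (fun=> nat : topologicalType) n (f x).1.
    by have := pc [set (f x).1 n]; apply; apply: discrete_set1.
  by case: (f x) nU => a b nU; apply: (cvg_fst nU).
have [S yS] := nbhs_pointwise (cf x Gx _ nU).
by exists S => y Gy yx; apply: yS.
Qed.

(** * The characters phi_n of the anticyclotomic extension *)

Section AnticyclotomicCharacters.
Variables (d : int) (d_gt0 : 0 < d) (d_mod : (d = 2 %[mod 3])%Z).
Local Notation sD := (sqrtC (- 3 * d)%:~R : algC).
Local Notation K := (Qsqrt (- 3 * d)%:~R).
Variables (L : set algC) (f : Gal_space -> padic_space * bool).
Hypotheses (galK : is_galois K L) (galQ : is_galois rationals L).
Hypothesis isof : topgroup_iso (Gal L rationals : set Gal_space) Gal_mul (@dihedral 3) (@dihedral_mul 3) f.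
Hypothesis fK : f @` Gal L K = @padic_int 3 `*` [set false].
Let nQ := sqrt_neg_irrational (D_lt0 d_gt0).
Let QD : ((- 3 * d)%:~R : algC) \in Crat. Proof. exact: rpred_int. Qed.
Let KL : K `<=` L. Proof. by case: galK. Qed.

(** The Z_3-coordinate modulo 3^n, written as a root of unity; on [GK] this is the character
    phi_n. *)
Definition anti n (s : Aut) : algC := zroot n ^+ (f (restr L s)).1 n.

Let autQ (s : Aut) x : rationals x -> s x = x.
Proof. by move=> /CratP[q ->]; rewrite fmorph_rat. Qed.

Let GalQ (s : Aut) : Gal L rationals (restr L s).
Proof. by apply: (restr_Gal galQ) => x; apply: autQ. Qed.

Let GalK s : GK d s -> Gal L K (restr L s).
Proof. by move=> Gs; apply: (restr_Gal galK) => x; apply: (Qsqrt_fix QD nQ). Qed.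

Let fGK s : GK d s -> @padic_int 3 (f (restr L s)).1 /\ (f (restr L s)).2 = false.
Proof.
move=> Gs; have : (f @` Gal L K) (f (restr L s)) by exists (restr L s) => //; apply: GalK.
by rewrite fK => -[].
Qed.

Let fD (s : Aut) : @padic_int 3 (f (restr L s)).1.
Proof. by case: isof => -[fS _ _] _ _ _; have [] := fS _ (GalQ s). Qed.

Let fM (s t : Aut) : f (restr L (acomp s t)) = @dihedral_mul 3 (f (restr L s)) (f (restr L t)).
Proof.
case: isof => _ fM _ _; rewrite -fM; [congr f|exact: GalQ|exact: GalQ].
by apply: (restr_comp s galQ) => x; apply: autQ.
Qed.

Lemma anti_ext n (s t : Aut) : (forall x, s x = t x) -> anti n s = anti n t.
Proof. by move=> E; rewrite /anti; congr (_ ^+ (f _).1 n); rewrite /restr; apply/funext => x; rewrite E. Qed.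

Lemma antiM n s t : GK d s -> anti n (acomp s t) = anti n s * anti n t.
Proof.
move=> Gs; rewrite /anti fM /dihedral_mul; have [_ s2] := fGK Gs; rewrite s2.
by rewrite /= /padic_add (prim_expr_mod (zroot_prim n)) exprD.
Qed.

Lemma anti_lt n (s : Aut) : ((f (restr L s)).1 n < 3 ^ n)%N.
Proof. by have [] := fD s n. Qed.

Lemma anti_compat n c s : anti (n + c) s ^+ (3 ^ c) = anti n s.
Proof.
rewrite /anti -exprM mulnC exprM zrootX -[LHS](prim_expr_mod (zroot_prim n)); congr (_ ^+ _).
elim: c => [|c IHc]; first by rewrite addn0 modn_small // anti_lt.
have [_ E] := fD s (n + c)%N; rewrite -addnS in E.
by rewrite -{}IHc -E addnS modn_dvdm // dvdn_exp2l // leq_addr.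
Qed.

(** Complex conjugation moves sD, so it lies outside Gal(L/K) and f maps it to a reflection;
    conjugating by a reflection inverts Z_3. *)
Lemma anti_cconj n s : GK d s -> anti n (cconj s) = (anti n s)^-1.
Proof.
move=> Gs; have [_ s2] := fGK Gs.
have c2 : (f (restr L aconj)).2 = true.
  apply: contraT => /negbTE cf; have : (f @` Gal L K) (f (restr L aconj)).
    by rewrite fK; split; [exact: fD|].
  case=> g [eg gL gK] E; have [[_ fI _] _ _ _] := isof.
  have gr : g = restr L aconj.
    apply: fI; rewrite ?inE //; split=> // x Qx; apply: gK.
    by move: Qx => /CratP[q ->]; case: galK => hK _ _ _; apply: (sfrat hK).
  have KD : K sD by apply: Qsqrt_sqrt.
  have := gK _ KD; rewrite gr (restrE _ (KL KD)) (aconj_sD d_gt0).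
  move/eqP; rewrite eq_sym -addr_eq0 -mulr2n mulrn_eq0 /= => /eqP D0.
  by have := nQ; rewrite D0 rpred0.
have E : anti n (cconj s) = anti n (acomp aconj (acomp s aconj)).
  by apply: anti_ext => x; rewrite !acompE.
rewrite E /anti !fM; move: (anti_lt n s) (anti_lt n aconj) s2 c2.
case: (f (restr L s)) => a [] //; case: (f (restr L aconj)) => b [] //= an bn _ _.
have pz := zroot_prim n; have zX := prim_expr_mod pz; have nz k : zroot n ^+ k != 0 by rewrite expf_neq0 ?zroot_neq0.
rewrite /padic_add /padic_opp zX exprD zX; set m := ((a n + b n) %% 3 ^ n)%N.
have mE : zroot n ^+ m = zroot n ^+ a n * zroot n ^+ b n by rewrite zX exprD.
have mV : zroot n ^+ (3 ^ n - m) * zroot n ^+ m = 1.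
  by rewrite -exprD subnK ?(prim_expr_order pz) // ltnW // ltn_mod expn_gt0.
apply: (mulIf (nz m)); rewrite -mulrA mV mulr1 mE mulKf //.
Qed.

Lemma anti_continuous n g : Gal L rationals g -> exists S : seq algC,
  (forall x, x \in S -> L x) /\
  forall s : Aut, (forall x, x \in S -> s x = g x) -> anti n s = zroot n ^+ (f g).1 n.
Proof.
move=> Gg; case: isof => _ _ cf _; have [S PS] := finite_continuity n cf Gg.
exists [seq x <- S | `[< L x >]]; split=> [x|s sS]; first by rewrite mem_filter => /andP[/asboolP].
rewrite /anti (PS _ (GalQ s)) // => x Sx; have [Lx|nLx] := pselect (L x).
  by rewrite restrE // sS // mem_filter Sx andbT; apply/asboolP.
by rewrite restr_out //; have [[_ _ _ ->]] := Gg.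
Qed.

Lemma anti_gchar n : exists T, (forall x, x \in T -> L x) /\ gchar d (anti n) n T.
Proof.
have [S [LS PS]] := anti_continuous n (Gal_id L rationals).
exists S; split=> //; split=> [s t Gs Gt|s Gs|s Gs fixs]; first exact: antiM.
  by rewrite /anti exprAC (prim_expr_order (zroot_prim n)) expr1n.
have anti1 : anti n aid = 1.
  apply: (mulfI (_ : anti n aid != 0)); first by rewrite expf_neq0 // zroot_neq0.
  by rewrite -antiM // mulr1; apply: anti_ext.
rewrite (PS s) // -(PS aid) //.
Qed.

Lemma anti_nontrivial : exists2 s, GK d s & anti 1 s != 1.
Proof.
(* The generator 1 of Z_3, whose residue at level 0 is 0. *)
have [g Gg fg] : (f @` Gal L K) ((fun n => 1 %% 3 ^ n)%N, false).
  rewrite fK; split=> // n /=; split; first by rewrite ltn_mod expn_gt0.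
  by rewrite modn_dvdm // dvdn_exp2l.
have Gg' : Gal L rationals g.
  case: Gg => eg gL gK; split=> // x /CratP[q ->]; apply: gK.
  by case: galK => hK _ _ _; apply: (sfrat hK).
have [S [LS PS]] := anti_continuous 1 Gg'.
have KD : K sD by apply: Qsqrt_sqrt.
have [t tS] : exists t : Aut, forall x, x \in sD :: S -> t x = g x.
  apply: (Gal_lift galK Gg) => x; rewrite inE => /orP[/eqP->|/LS//]; exact: KL.
exists t; first by rewrite /GK tS ?mem_head //; case: Gg => _ _; apply.
rewrite PS => [|x Sx]; last by rewrite tS // inE Sx orbT.
by rewrite fg /= expr1 omega_neq1.
Qed.
End AnticyclotomicCharacters.

(** * Unramified characters as powers of phi_n *)

Section Main.
Variables (d : int) (d_gt0 : 0 < d) (d_mod : (d = 2 %[mod 3])%Z).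
Local Notation K := (Qsqrt (- 3 * d)%:~R).
Variables (H L : set algC) (h : nat).
Hypotheses (galH : is_galois K H) (unrH : unramified K H).
Hypothesis abH : forall s t, Gal H K s -> Gal H K t -> s \o t = t \o s.
Hypothesis cardH : (Gal H K #= `I_(3 ^ h)%N)%card.
Hypothesis class_number_Kd : ~~ (3 %| class_number (Qsqrt d%:~R))%N.
Hypothesis antiL : anticyclotomic 3 K L.
Let nQ := sqrt_neg_irrational (D_lt0 d_gt0).

Section Powers.
Variables (phi : nat -> Aut -> algC) (T : nat -> seq algC).
Hypothesis gphi : forall n, gchar d (phi n) n (T n).
Hypothesis phiX : forall n c s, GK d s -> phi (n + c)%N s ^+ (3 ^ c) = phi n s.
Hypothesis phic : forall n s, GK d s -> phi n (cconj s) = (phi n s)^-1.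
Hypothesis phi1_neq1 : exists2 s, GK d s & phi 1 s != 1.

(** phi_n has exact order 3^n, because its 3^(n-1)-th power is phi_1. *)
Lemma phi_power_dvd n j k : (forall s, GK d s -> phi n s ^+ (j * 3 ^ k) = 1) -> (k < n)%N -> (3 %| j)%N.
Proof.
move=> triv kn; have [s Gs ns1] := phi1_neq1; apply: contraNT ns1 => j3.
have := gcX (gphi n) Gs; have := triv s Gs; set z := phi n s => zj zn.
have zk : z ^+ (3 ^ k) = 1.
  have n3 : (0 < 3 ^ n)%N by rewrite expn_gt0.
  have [a _] := Bezoutl j n3.
  rewrite (eqP (_ : coprime (3 ^ n) j)) ?coprimeXl ?prime_coprime // => /dvdnP[q E].
  have z3q : (z ^+ (3 ^ k)) ^+ (q * 3 ^ n) = 1 by rewrite exprAC mulnC (exprM z) zn !expr1n.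
  move: z3q; rewrite -E exprD expr1 (exprM _ a) exprAC -(exprM z) [(3 ^ k * j)%N]mulnC zj expr1n mulr1.
  by [].
have n0 : (0 < n)%N by apply: leq_ltn_trans kn.
have := phiX 1 n.-1 Gs; rewrite add1n prednK // -/z => <-.
have -> : n.-1 = (k + (n.-1 - k))%N by rewrite subnKC // -ltnS prednK.
by rewrite expnD exprM zk expr1n.
Qed.

(** By induction psi^3 is a power of phi_n, whose exponent is some 3 i since psi has order at most
    3^(k+1) and k < n. Then psi phi_n^(-i) is cubic, hence a power of phi_1, which is itself a power
    of phi_n. *)
Lemma unramified_power k n psi S : (k <= n)%N -> (0 < n)%N -> gchar d psi n S ->
  (forall x, x \in S -> H x) -> (forall s, GK d s -> psi s ^+ (3 ^ k) = 1) ->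
  exists j, forall s, GK d s -> psi s = phi n s ^+ j.
Proof.
elim: k psi => [|k IHk] psi kn n0 hpsi SH psik.
  by exists 0%N => s Gs; rewrite expr0 -(psik s Gs) expn0 expr1.
have [|j psi3] := IHk (fun s => psi s ^+ 3) (ltnW kn) n0 (gcharX 3 hpsi) SH.
  by move=> s Gs; rewrite -exprM -expnS psik.
have /dvdnP[i ji] : (3 %| j)%N.
  apply: (phi_power_dvd (n := n) (k := k)) => // s Gs.
  by rewrite exprM -psi3 // -exprM -expnS psik.
(* Stands for - i modulo 3^n. *)
pose e := (i * (3 ^ n).-1)%N.
have phin s : GK d s -> phi n s ^+ i * phi n s ^+ e = 1.
  move=> Gs; rewrite -exprD /e -{1}[i]muln1 -mulnDr add1n prednK ?expn_gt0 //.
  by rewrite mulnC exprM (gcX (gphi n)) // expr1n.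
pose chi s := psi s * phi n s ^+ e.
have hchi : gchar d chi 1 (S ++ T n).
  apply: (gchar_exponent (gcharM hpsi (gcharX e (gphi n)))) => s Gs.
  by rewrite /chi expn1 exprMn psi3 // ji exprM -exprMn phin // expr1n.
have [j' chiE] := cubic_power d_gt0 d_mod galH unrH class_number_Kd gphi phiX phic phi1_neq1 n0 hpsi SH hchi
  (fun s Gs => erefl).
exists (3 ^ n.-1 * j' + i)%N => s Gs.
rewrite exprD exprM; have := phiX 1 n.-1 Gs; rewrite add1n prednK // => ->.
by rewrite -chiE // /chi -mulrA [_ ^+ e * _]mulrC phin // mulr1.
Qed.
End Powers.

Lemma unramified_sub_anticyclotomic : H `<=` L.
Proof.
have [[galK _] galQ [f [isof fK]]] := antiL.
have KL : K `<=` L by case: galK.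
have hL : subfield L by case: galK.
have gchars n := cid (anti_gchar d_gt0 galK galQ isof fK n).
pose T n := projT1 (gchars n).
have TL n x : x \in T n -> L x by rewrite /T; case: (gchars n) => S [+ _] /=; apply.
have gphi n : gchar d (anti L f n) n (T n) by rewrite /T; case: (gchars n) => S [].
(* The characters of H have exponent dividing 3^h; the maximum keeps n positive. *)
pose n := maxn h 1; have n0 : (0 < n)%N by rewrite leq_max orbT.
move=> x Hx; apply: (galois_fixed (s := sqrtC (- 3 * d)%:~R :: T n) hL) => [a|t tT].
  by rewrite inE => /orP[/eqP->|/TL//]; apply: KL; apply: Qsqrt_sqrt.
have Gt : GK d t by apply: tT; rewrite mem_head.
apply: (characters_separate nQ galH abH cardH Gt) Hx => psi S hpsi SH.
have hpsi' : gchar d psi n S.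
  apply: (gchar_exponent hpsi) => s Gs.
  by rewrite /n -(subnK (leq_maxl h 1)) expnD mulnC exprM (gcX hpsi) // expr1n.
have phiX m c s : GK d s -> anti L f (m + c) s ^+ (3 ^ c) = anti L f m s.
  by move=> _; apply: (anti_compat galQ isof).
have phic m s : GK d s -> anti L f m (cconj s) = (anti L f m s)^-1.
  exact: (anti_cconj d_gt0 galK galQ isof fK).
have phi1 := anti_nontrivial galK galQ isof fK.
have psi_n s : GK d s -> psi s ^+ (3 ^ n) = 1 by apply: (gcX hpsi').
have [j ->//] := unramified_power gphi phiX phic phi1 (leqnn n) n0 hpsi' SH psi_n.
by rewrite (gcS (gphi n) Gt) ?expr1n // => y Ty; apply: tT; rewrite inE Ty orbT.
Qed.
End Main.

Theorem theorem5p1 (D : int) (H Kinf : set algC)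
  (hD : D < 0)
  (hdisc : is_discriminant (Qsqrt D%:~R) D)
  (hmod : (D = 3 %[mod 9])%Z)
  (hclass : ~~ (3 %| class_number (Qsqrt (- D%:~R / 3)))%N)
  (hH : hilbert_p_class_field 3 (Qsqrt D%:~R) H)
  (hKinf : anticyclotomic 3 (Qsqrt D%:~R) Kinf) :
  H `<=` Kinf.
Proof.
(* From D = 9 k + 3 one gets d = - (3 k + 1), which is 2 modulo 3. *)
have [d DE] : exists d : int, D = - 3 * d by exists (- (D %/ 3)%Z); lia.
have d_gt0 : 0 < d by lia.
have d_mod : (d = 2 %[mod 3])%Z by lia.
have [[[galH abH] unrH [h cardH]] _] := hH.
rewrite {}DE in hclass galH abH unrH cardH hKinf.
have dE : - (- 3 * d)%:~R / 3 = d%:~R :> algC by rewrite intrM; field.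
rewrite dE in hclass.
exact: (unramified_sub_anticyclotomic d_gt0 d_mod galH unrH abH cardH hclass hKinf).
Qed.
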